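(* Let $\varepsilon=(\varepsilon_k)_{k\in\mathbb Z_+}$ be an adapted process with $\sup_{k\in\mathbb Z_+}\|\varepsilon_k\|_{L^\infty}\le1$, and let $T_\varepsilon$ be the associated martingale transform $T_\varepsilon(f):=\sum_{k\in\mathbb Z_+}\varepsilon_{k-1}d_kf$ (with $\varepsilon_{-1}:=0$). Let $b\in\mathrm{BMO}$ be a non-constant function. Then (i) the commutator $[T_\varepsilon,b]$ is bounded from $H_1$ to $L^{1,\infty}$; (ii) the commutator $[T_\varepsilon,b]$ is bounded from $H_1^b$ to $L^1$.
   Context: $\mathbb Z_+=\{0,1,2,\dots\}$. $(\Omega,\mathcal F,\mathbb P)$ is a complete probability space and $(\mathcal F_n)_{n\in\mathbb Z_+}$ is an increasing sequence of sub-$\sigma$-algebras of $\mathcal F$ with $\mathcal F=\sigma(\bigcup_n\mathcal F_n)$ and $\mathcal F_0=\{\emptyset,\Omega\}$; $\mathbb E_n$ is the conditional expectation given $\mathcal F_n$. Adapted: $\varepsilon_k$ is $\mathcal F_k$-measurable for each $k$. For a martingale $f=(f_n)$: $f_{-1}:=0$, $d_nf:=f_n-f_{n-1}$, $S(f):=(\sum_{n\ge0}|d_nf|^2)^{1/2}$. An $L^1$ function $f$ is identified with the martingale $(\mathbb E_n f)_n$. $H_1$: martingales with $\|f\|_{H_1}:=\|S(f)\|_{L^1}<\infty$. $\mathrm{BMO}$: martingales with $\|f\|_{\mathrm{BMO}_p}:=\sup_{n\in\mathbb Z_+}\|\mathbb E_n(|f-f_{n-1}|^p)\|_{L^\infty}^{1/p}<\infty$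 (equivalent norms for all $p\in[1,\infty)$). $\|f\|_{L^{1,\infty}}:=\sup_{t>0}t\,\mathbb P(|f|>t)$. Commutator of a linear operator $T$: $[T,b](f):=T(bf)-bT(f)$ for $f\in L^2$ (in particular $[\mathbb E_n,b](f)=\mathbb E_n(bf)-b\,\mathbb E_n(f)$), and for $f\in H_1$ it is defined by continuity from the dense subspace $L^2$. $H_1^b$: martingales $f$ (in $H_1$) with $\|f\|_{H_1^b}:=\|f\|_{H_1}\|b\|_{\mathrm{BMO}}+\big\|\sup_{n\in\mathbb Z_+}|[\mathbb E_n,b](f)|\big\|_{L^1}<\infty$. *)

(* Defs.v *)
From HB Require Import structures.
From mathcomp Require Import all_boot all_order all_algebra.
From mathcomp Require Import all_classical all_reals all_analysis.
From mathcomp Require Import ess_sup_inf measurable_realfun.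

Set Implicit Arguments.
Unset Strict Implicit.
Unset Printing Implicit Defensive.

Import Order.TTheory GRing.Theory Num.Theory.
Import numFieldNormedType.Exports.

Local Open Scope classical_set_scope.
Local Open Scope ring_scope.

Section definitions.
Context (d : measure_display) (Omega : measurableType d) (R : realType).
Variable P : probability Omega R.

Definition is_filtration (F : nat -> set (set Omega)) : Prop :=
  [/\ forall n, sigma_algebra [set: Omega] (F n),
      forall n, F n `<=` measurable,
      forall m n, (m <= n)%N -> F m `<=` F n,
      measurable = <<s \bigcup_n F n >> &
      F 0%N = [set set0; [set: Omega]]].

Definition measurable_wrt (G : set (set Omega)) d' (U : measurableType d')
    (f : Omega -> U) : Prop :=
  measurable_fun [set: g_sigma_algebraType G] (f : g_sigma_algebraType G -> U).

(* Intended for f integrable, or f measurable with values in [0, +oo] (and then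
   possibly not integrable); in both cases such a g exists and is unique
   P-almost everywhere. *)
Definition is_cond_exp (G : set (set Omega)) (f g : Omega -> \bar R) : Prop :=
  measurable_wrt G g /\
  forall A, G A -> (\int[P]_(x in A) g x = \int[P]_(x in A) f x)%E.

Definition cond_expe (G : set (set Omega)) (f : Omega -> \bar R) :
    Omega -> \bar R :=
  xget (cst 0%E) [set g | is_cond_exp G f g].

Definition cond_exp (G : set (set Omega)) (f : Omega -> R) : Omega -> R :=
  fine \o cond_expe G (EFin \o f).

Definition weakL1_norm (f : Omega -> R) : \bar R :=
  ereal_sup [set (t%:E * P [set x | (t < `|f x|)%R])%E
            | t in [set t : R | 0 < t]].

(* the process (X_{n-1})_n, with the convention X_{-1} := 0 *)
Definition pred_process (X : nat -> Omega -> R) (n : nat) : Omega -> R :=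
  if n is m.+1 then X m else cst 0.

Definition diff_seq (f : nat -> Omega -> R) (n : nat) : Omega -> R :=
  f n \- pred_process f n.

Definition square_function (f : nat -> Omega -> R) (x : Omega) : \bar R :=
  ((\sum_(0 <= n <oo) (`|diff_seq f n x| ^+ 2)%:E) `^ (2^-1))%E.

Definition H1_norm (f : nat -> Omega -> R) : \bar R :=
  'N[P]_1[square_function f].

Definition commutator (T : (Omega -> R) -> (Omega -> R)) (b f : Omega -> R) :
    Omega -> R :=
  T (b \* f) \- b \* T f.

Variable F : nat -> set (set Omega).

Definition adapted (X : nat -> Omega -> R) : Prop :=
  forall n, measurable_wrt (F n) (X n).

Definition is_martingale (f : nat -> Omega -> R) : Prop :=
  [/\ adapted f,
      forall n, f n \in Lfun P 1 &
      forall n, cond_exp (F n) (f n.+1) = f n %[ae P]].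

Definition martingale_of (u : Omega -> R) (n : nat) : Omega -> R :=
  cond_exp (F n) u.

Definition in_H1 (f : nat -> Omega -> R) : Prop :=
  is_martingale f /\ (H1_norm f < +oo)%E.

Definition BMO_norm (p : R) (b : Omega -> R) : \bar R :=
  ereal_sup (range (fun n =>
    ('N[P]_+oo[cond_expe (F n)
       (fun x => (`|b x - pred_process (martingale_of b) n x| `^ p)%:E)]
     `^ (p^-1))%E)).

Definition in_BMO (p : R) (b : Omega -> R) : Prop :=
  b \in Lfun P 1 /\ (BMO_norm p b < +oo)%E.

(* The series is summed pointwise; for u in L^1 it converges almost surely, and
   where it diverges limn takes a default value. *)
Definition martingale_transform (eps : nat -> Omega -> R) (u : Omega -> R) :
    Omega -> R :=
  fun x => limn (series (fun k =>
    pred_process eps k x * diff_seq (martingale_of u) k x)).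

Definition L2_approx (u : nat -> Omega -> R) (f : nat -> Omega -> R) : Prop :=
  (forall k, u k \in Lfun P 2%:E) /\
  H1_norm (fun n => martingale_of (u k) n \- f n) @[k --> \oo] --> 0%E.

(* g is the value at f of the extension of [T, b] by continuity from L^2, with
   the topology of H_1 on the source and that of L^{1,oo} on the target. *)
Definition is_commutator_H1 (T : (Omega -> R) -> (Omega -> R)) (b : Omega -> R)
    (f : nat -> Omega -> R) (g : Omega -> R) : Prop :=
  [/\ measurable_fun [set: Omega] g,
      exists u, L2_approx u f &
      forall u, L2_approx u f ->
        weakL1_norm (commutator T b (u k) \- g) @[k --> \oo] --> 0%E].

Definition commutator_H1 (T : (Omega -> R) -> (Omega -> R)) (b : Omega -> R)
    (f : nat -> Omega -> R) : Omega -> R :=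
  xget (cst 0) [set g | is_commutator_H1 T b f g].

Definition maximal_commutator (b : Omega -> R) (f : nat -> Omega -> R)
    (x : Omega) : \bar R :=
  ereal_sup (range (fun n => `|commutator_H1 (cond_exp (F n)) b f x|%:E)).

Definition H1b_norm (p : R) (b : Omega -> R) (f : nat -> Omega -> R) : \bar R :=
  (H1_norm f * BMO_norm p b + 'N[P]_1[maximal_commutator b f])%E.

Definition in_H1b (p : R) (b : Omega -> R) (f : nat -> Omega -> R) : Prop :=
  in_H1 f /\ (H1b_norm p b f < +oo)%E.

End definitions.

(* Main.v *)
(* Write Pi(f) = sum_k d_kf d_kb and T = T_eps. Summation by parts in
   b f = sum_k b_{k-1} d_kf + sum_k f_{k-1} d_kb + Pi(f) gives
     [T, b] f = T (Pi f) + U(f) - Pi (T f),   U(f) = sum_k (eps_{k-1} f_{k-1} - (T f)_{k-1}) d_kb,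
     [E_n, b] f = E_n (Pi f) - sum_{k <= n} d_kf d_kb - f_n (b - b_n).
   By John-Nirenberg, E_n sum_{k >= n} |d_kb|^2 is bounded, whence Fefferman's
   inequality E sum_k |d_kf d_kb| <= C |f|_{H_1} and the boundedness of the
   paraproduct U from H_1 to H_1. So U(f) and Pi (T f) are in L^1, and T (Pi f) is
   in L^{1,oo} because T is of weak type (1,1) and Pi f is in L^1: this is (i).
   Abel summation dominates sup_n |f_n| |b - b_n| by the maximal function of the
   paraproduct sum_k f*_{k-1} d_kb. Hence for f in H_1^b the second identity shows that
   sup_n |E_n (Pi f)| is in L^1, i.e. that Pi f is in H_1, and T (Pi f) is in L^1:
   this is (ii).
   Davis' inequalities, the weak type (1,1) bound and the almost sure convergence of
   transforms all follow from pathwise one-step estimates for explicit functions,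
   whose error terms are martingale differences. *)

Require Import Defs.
From HB Require Import structures.
From mathcomp Require Import all_boot all_order all_algebra.
From mathcomp Require Import all_classical all_reals all_analysis.
From mathcomp Require Import ess_sup_inf measurable_realfun.
From mathcomp Require Import ring lra.

Set Implicit Arguments.
Unset Strict Implicit.
Unset Printing Implicit Defensive.

Import Order.TTheory GRing.Theory Num.Theory.
Import numFieldNormedType.Exports.

Local Open Scope classical_set_scope.
Local Open Scope ring_scope.

(** * Pathwise forms of the Burkholder and Davis inequalities *)

(** Every inequality is proved for finitely many increments, with constants independent of the
    horizon, and only then passed to the limit by monotone convergence, Fatou's lemma or dominated
    convergence. The commutator on H_1 is specified only as a weak L^1 limit along L^2
    approximations. It is identified with an explicit function of the martingale ([comm_T] for T,
    [comm_E] for E_n) that agrees with the commutator on L^2, is additive almost everywhere and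
    satisfies a weak bound; density of L^2 in H_1 then determines the limit. The main obstacle is
    that, for f in L^2, neither b f nor Pi f is controlled in H_1. Their transforms still converge
    almost surely, because the weak type (1,1) bound allows L^1 approximation by bounded functions.
    The constants may depend on b, so BMO_p is only used through a bound on first-order
    oscillations, obtained from y <= 1 + y^p. In (ii) a multiple of |f|_{H_1} must be absorbed in
    |f|_{H_1} |b|_{BMO}, which is possible because |b|_{BMO} > 0. *)

Section pathwise.
Variable R : realType.
Implicit Types (x y z t d a b m : R) (f g h : nat -> R) (n k : nat).

Lemma cvgn_ge (u : nat -> R) l c : u @ \oo --> l -> (forall n, c <= u n) -> c <= l.
Proof.
move=> ul cu; rewrite -(cvg_lim _ ul)//; apply: limr_ge; last exact: nearW.
by apply/cvg_ex; exists l.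
Qed.

Lemma cvgn_le (u : nat -> R) l c : u @ \oo --> l -> (forall n, u n <= c) -> l <= c.
Proof.
move=> ul cu; rewrite -(cvg_lim _ ul)//; apply: limr_le; last exact: nearW.
by apply/cvg_ex; exists l.
Qed.

(* Burkholder's function: [burk f_n g_n] is a supermartingale when |dg| <= |df|.
   [burkX] and [burkY] are its partial derivatives, up to a choice on the set
   where it is not differentiable. *)
Definition burk (x y : R) : R :=
  if `|x| + `|y| <= 1 then y ^+ 2 - x ^+ 2 else 1 - 2 * `|x|.
Definition burkX (x y : R) : R :=
  if `|x| + `|y| <= 1 then - 2 * x else - 2 * Num.sg x.
Definition burkY (x y : R) : R := if `|x| + `|y| <= 1 then 2 * y else 0.

(** Together with [burk_ge]: on the strip |x| <= 1, [burk] is the minimum of its two branches. *)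
Lemma burk_le x y : `|x| + `|y| <= 1 -> y ^+ 2 - x ^+ 2 <= 1 - 2 * `|x|.
Proof.
move=> h; rewrite -(real_normK (num_real y)) -(real_normK (num_real x)).
have := normr_ge0 x; have := normr_ge0 y.
by move: `|x| `|y| h => u v; nra.
Qed.

Lemma burk_ge x y : 1 <= `|x| + `|y| -> `|x| <= 1 -> 1 - 2 * `|x| <= y ^+ 2 - x ^+ 2.
Proof.
rewrite -(real_normK (num_real y)) -(real_normK (num_real x)).
have := normr_ge0 x; have := normr_ge0 y.
by move: `|x| `|y| => u v; nra.
Qed.

Lemma sg_mul_le x y : Num.sg x * y <= `|y|.
Proof.
by case: (sgrP x) => _; rewrite ?mul0r ?mul1r ?mulN1r ?normr_ge0 ?ler_norm //
  -normrN ler_norm.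
Qed.

(** [burk] is concave along lines of slope at most 1, and the right-hand side is its tangent there.
    The cases record whether the new point ([h1]) and the old one ([h2]) lie in the diamond |x| +
    |y| <= 1. *)
Lemma burk_step x y a b : `|b| <= `|a| ->
  burk (x + a) (y + b) <= burk x y + burkX x y * a + burkY x y * b.
Proof.
move=> ba; rewrite /burk /burkX /burkY.
case: ifPn => [h1|h1]; case: ifPn => [h2|h2].
- have: b ^+ 2 <= a ^+ 2.
    by rewrite -(real_normK (num_real b)) -(real_normK (num_real a)) ler_sqr ?nnegrE.
  nra.
- have := burk_le h1; have := sg_mul_le x (x + a); have := normrEsg x; rewrite mulrDr; lra.
- have : b ^+ 2 <= a ^+ 2.
    by rewrite -(real_normK (num_real b)) -(real_normK (num_real a)) ler_sqr ?nnegrE.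
  rewrite -ltNge in h1 => bb.
  (* The new point has left the diamond. While |x + a| <= 1 the quadratic branch is still an upper
     bound by [burk_ge]; beyond that a polynomial inequality in the absolute values remains. *)
  case: (leP `|x + a| 1) => xa.
    have := burk_ge (ltW h1) xa; nra.
  have h3 : `|x + a| - `|x| <= `|a| by have := ler_normD x a; lra.
  have h4 : - (`|y| * `|a|) <= y * b.
    have : `|y * b| <= `|y| * `|a| by rewrite normrM ler_wpM2l.
    by rewrite ler_norml => /andP[].
  have : (x+a)^+2 = `|x+a| ^+2 by rewrite real_normK ?num_real.
  have : y^+2 = `|y| ^+2 by rewrite real_normK ?num_real.
  have : x^+2 = `|x| ^+2 by rewrite real_normK ?num_real.
  have : a^+2 = `|a| ^+2 by rewrite real_normK ?num_real.
  have := normr_ge0 x; have := normr_ge0 y; have := normr_ge0 a.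
  move: h1 h2 h3 h4 xa.
  move: `|x + a| `|a| `|x| `|y| => X A u v.
  nra.
- have := sg_mul_le x (x + a); have := normrEsg x; rewrite mulrDr; lra.
Qed.

Lemma burk_major x y : 1 <= `|y| -> 1 <= burk x y + 2 * `|x|.
Proof.
rewrite /burk => y1; case: ifPn => h; last by lra.
have -> : `|x| = 0 by have := normr_ge0 x; lra.
rewrite -(real_normK (num_real y)) -(real_normK (num_real x)).
have -> : `|x| = 0 by have := normr_ge0 x; lra.
nra.
Qed.

Lemma burk_lb x y : 0 <= burk x y + 2 * `|x|.
Proof.
rewrite /burk; case: ifPn => h; last by lra.
rewrite -(real_normK (num_real x)).
have := normr_ge0 x; have := normr_ge0 y; have := sqr_ge0 y.
by move: h; move: `|x| `|y| => u v; nra.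
Qed.

Lemma burk0 x : burk x 0 <= 0.
Proof.
rewrite /burk normr0 addr0; case: ifPn => h; last by rewrite -ltNge in h; lra.
by have := sqr_ge0 x; lra.
Qed.

Lemma burkX_bd x y : `|burkX x y| <= 2.
Proof.
rewrite /burkX; case: ifPn => h.
  rewrite normrM normrN normr_nat; have := normr_ge0 y; have := normr_ge0 x; lra.
rewrite normrM normrN normr_nat.
by case: (sgrP x) => _; rewrite ?normr0 ?normrN ?normr1; lra.
Qed.

Lemma burkY_bd x y : `|burkY x y| <= 2.
Proof.
rewrite /burkY; case: ifPn => h; last by rewrite normr0; lra.
rewrite normrM normr_nat; have := normr_ge0 y; have := normr_ge0 x; lra.
Qed.

(* To be evaluated at x = f_n, t = S_n(f)^2 and z = f*_n; z = 0 forces all increments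
   so far to vanish, and then Rocq's division gives the right value 0. *)
Definition davS (x t z : R) : R := (t - x ^+ 2 - 2 * z ^+ 2) / z.

Lemma davS_step x t z d : 0 <= z -> `|x| <= z -> 0 <= t -> (z = 0 -> t = 0) ->
  davS (x + d) (t + d ^+ 2) (Num.max z `|x + d|) <= davS x t z + (- 2 * (x / z)) * d.
Proof.
move=> z0 xz t0 zt; rewrite /davS.
have [zE|zN0] := eqVneq z 0.
  have x0 : x = 0 by apply/normr0_eq0/eqP; rewrite eq_le normr_ge0 -zE xz.
  rewrite (zt zE) zE x0 !add0r maxEle normr_ge0 invr0 !mulr0 mul0r addr0.
  have [->|d0] := eqVneq d 0; first by rewrite normr0 invr0 mulr0.
  rewrite ler_pdivrMr ?normr_gt0// mul0r real_normK ?num_real//; have := sqr_ge0 d; lra.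
have {}z0 : 0 < z by rewrite lt_neqAle eq_sym zN0.
(* The increment of t - x^2 is exactly -2 x d, so the step is an equality as long as z is still the
   maximum. *)
have -> : (t - x ^+ 2 - 2 * z ^+ 2) / z + (- 2 * (x / z)) * d =
  (t + d ^+ 2 - (x + d) ^+ 2 - 2 * z ^+ 2) / z by field.
case: (leP `|x + d| z) => // h.
set w := `|x + d| in h *.
have w0 : 0 < w by lra.
have -> : (x + d) ^+ 2 = w ^+ 2 by rewrite /w real_normK ?num_real.
(* At a new maximum w the gap between the two sides is (w - z)(t + d^2 - w^2 + 2 w z) up to a
   positive factor, and d^2 >= (w - z)^2 makes it nonnegative. *)
have hd : (w - z) ^+ 2 <= d ^+ 2.
  rewrite -[d ^+ 2](real_normK (num_real d)) ler_sqr ?nnegrE ?normr_ge0//; last lra.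
  have := ler_normD x d; rewrite -/w; lra.
rewrite ler_pdivrMr// mulrAC ler_pdivlMr//.
nra.
Qed.

Lemma davS_major x t z : 0 <= z -> `|x| <= z -> 0 <= t -> (z = 0 -> t = 0) ->
  Num.sqrt t <= davS x t z + 4 * z.
Proof.
move=> z0 xz t0 zt; rewrite /davS.
have [zE|zN0] := eqVneq z 0.
  by rewrite (zt zE) zE sqrtr0 invr0 !mulr0 addr0.
have {}z0 : 0 < z by rewrite lt_neqAle eq_sym zN0.
have -> : (t - x ^+ 2 - 2 * z ^+ 2) / z + 4 * z = (t - x ^+ 2 + 2 * z ^+ 2) / z by field.
rewrite ler_pdivlMr//.
have: x ^+ 2 <= z ^+ 2 by rewrite -(real_normK (num_real x)) ler_sqr ?nnegrE ?normr_ge0//; lra.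
have := sqr_sqrtr t0; have := sqrtr_ge0 t; move: (Num.sqrt t) => s; nra.
Qed.

(* To be evaluated at x = f_n, y = S_n(f) and m = the running maximum of |f| and S(f). *)
Definition davM (x y m : R) : R := m - 50 * y + x ^+ 2 / m.

Lemma davM_step x y m y' d : 0 <= y -> 0 <= y' -> y' ^+ 2 = y ^+ 2 + d ^+ 2 ->
  `|x| <= m -> y <= m ->
  davM (x + d) y' (Num.max m (Num.max `|x + d| y')) <= davM x y m + (2 * (x / m)) * d.
Proof.
move=> y0 y'0 yE xm ym; rewrite /davM.
have hd : `|d| ^+ 2 = d ^+ 2 by rewrite real_normK ?num_real.
have hX : `|x + d| ^+ 2 = (x + d) ^+ 2 by rewrite real_normK ?num_real.
have hx : `|x| ^+ 2 = x ^+ 2 by rewrite real_normK ?num_real.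
have yy' : y <= y' by rewrite -ler_sqr ?nnegrE// yE; have := sqr_ge0 d; lra.
have m0 : 0 <= m by lra.
have [mE|mN0] := eqVneq m 0.
  have x0 : x = 0 by apply/normr0_eq0/eqP; rewrite eq_le normr_ge0 -mE xm.
  have yy0 : y = 0 by lra.
  have ydE : y' = `|d|.
    by apply/eqP; rewrite -(eqrXn2 (n := 2))// yE yy0 hd; apply/eqP; ring.
  rewrite ydE mE x0 yy0 !add0r maxxx maxEle normr_ge0 invr0 !(mulr0, mul0r).
  have [->|d0] := eqVneq d 0; first by rewrite normr0 invr0; lra.
  rewrite -hd expr2 -mulrA divff ?normr_eq0//; have := normr_ge0 d; lra.
have {}m0 : 0 < m by rewrite lt_neqAle eq_sym mN0.
have -> : m - 50 * y + x ^+ 2 / m + 2 * (x / m) * d =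
  m - 50 * y + ((x + d) ^+ 2 - d ^+ 2) / m by field.
set m' := Num.max _ _.
have mm' : m <= m' by rewrite le_max lexx.
have Xm' : `|x + d| <= m' by rewrite !le_max lexx orbT.
have ym' : y' <= m' by rewrite !le_max lexx !orbT.
have m'P : [\/ m' = m, m' = `|x + d| | m' = y'].
  rewrite /m'; case: (leP m _) => _; last exact: Or31.
  case: (leP `|x + d| y') => _; [exact: Or33|exact: Or32].
have m'0 : 0 < m' by lra.
have dm : `|d| <= m + m'.
  by have := ler_normB (x + d) x; rewrite [x + d - x]addrAC subrr add0r; lra.
have dd : d ^+ 2 = (y' - y) * (y' + y) by rewrite -subr_sqr; lra.
clearbody m'.
rewrite -hX.
have dge : `|x + d| - m <= `|d| by have := ler_normD x d; lra.
(* If the maximum at most doubles, the error d^2 / m = (y' - y)(y' + y) / m is at most 4 (y' - y),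
   which the term -50 y pays for. *)
case: (leP m' (2 * m)) => hm.
  have h1 : d ^+ 2 / m <= 4 * (y' - y).
    rewrite ler_pdivrMr// dd; nra.
  have h2 : `|x + d| ^+ 2 / m' <= `|x + d| ^+ 2 / m.
    by rewrite ler_wpM2l ?sqr_ge0// lef_pV2 ?posrE.
  suff : m' - m + `|x + d| ^+ 2 / m' <= `|x + d| ^+ 2 / m + (y' - y).
    rewrite mulrBl; lra.
  case: m'P => [-> |mX|mY].
  - lra.
  - rewrite -mX in h2 *.
    have -> : m' ^+ 2 / m' = m' by field; rewrite gt_eqF.
    suff : 2 * m' - m <= m' ^+ 2 / m by lra.
    rewrite ler_pdivlMr//; have := sqr_ge0 (m' - m); nra.
  - lra.
(* If the maximum more than doubles, y' - y is at least a tenth of m'. All errors together are at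
   most 4 m', hence at most 40 (y' - y). *)
have key : m' <= 10 * (y' - y).
  case: m'P => [mE|mX|mY]; [lra| |lra].
  have h3 : m' / 2 <= `|d| by lra.
  have h4 : (m' / 2) ^+ 2 <= d ^+ 2.
    by rewrite -hd ler_sqr ?nnegrE ?normr_ge0//; lra.
  have h5 : y' + y <= 5/2 * m' by lra.
  nra.
have h6 : d ^+ 2 / m <= `|x + d| ^+ 2 / m + 2 * m' + m.
  have -> : `|x + d| ^+ 2 / m + 2 * m' + m = (`|x + d| ^+ 2 + 2 * m' * m + m ^+ 2) / m by field.
  rewrite ler_pM2r ?invr_gt0//.
  have : x ^+ 2 <= m ^+ 2 by rewrite -hx ler_sqr ?nnegrE ?normr_ge0//; lra.
  have : - ((x+d) * x) <= m' * m.
    have : `|(x+d) * x| <= m' * m by rewrite normrM ler_pM ?normr_ge0.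
    by rewrite ler_norml => /andP[]; lra.
  rewrite hX; nra.
have h7 : `|x + d| ^+ 2 / m' <= m'.
  by rewrite ler_pdivrMr// -expr2 ler_sqr ?nnegrE ?normr_ge0//; lra.
rewrite mulrBl; lra.
Qed.

Lemma davM_major x y m : 0 <= m -> m <= davM x y m + 50 * y.
Proof. by move=> m0; rewrite /davM; have := divr_ge0 (sqr_ge0 x) m0; lra. Qed.

(** * Increments, quadratic variation and running maxima of a path *)

Definition dl (f : nat -> R) n := f n - (if n is m.+1 then f m else 0).
Definition qv f n := \sum_(k < n.+1) dl f k ^+ 2.
Definition sq f n := Num.sqrt (qv f n).
Fixpoint mx f n := if n is m.+1 then Num.max (mx f m) `|f m.+1| else `|f 0%N|.
Fixpoint mm f n :=
  if n is m.+1 then Num.max (mm f m) (Num.max `|f m.+1| (sq f m.+1)) else `|f 0%N|.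

Lemma qv_ge0 f n : 0 <= qv f n.
Proof. by apply: sumr_ge0 => i _; exact: sqr_ge0. Qed.

Lemma qvS f n : qv f n.+1 = qv f n + dl f n.+1 ^+ 2.
Proof. by rewrite /qv big_ord_recr. Qed.

Lemma qv0 f : qv f 0 = f 0%N ^+ 2.
Proof. by rewrite /qv big_ord1 /dl subr0. Qed.

Lemma sq_ge0 f n : 0 <= sq f n. Proof. exact: sqrtr_ge0. Qed.

Lemma sq_sqr f n : sq f n ^+ 2 = qv f n.
Proof. by rewrite /sq sqr_sqrtr// qv_ge0. Qed.

Lemma mx_ge f n : `|f n| <= mx f n.
Proof. by case: n => [|n] //=; rewrite le_max lexx orbT. Qed.

Lemma mx_ge0 f n : 0 <= mx f n.
Proof. by rewrite (le_trans _ (mx_ge f n)). Qed.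

Lemma mx_mono f (m n : nat) : (m <= n)%N -> mx f m <= mx f n.
Proof.
elim: n => [|n IH]; first by rewrite leqn0 => /eqP ->.
by rewrite leq_eqVlt => /predU1P[->//|/IH h]; rewrite /= le_max h.
Qed.

Lemma mx_le f n c : (forall k, (k <= n)%N -> `|f k| <= c) -> mx f n <= c.
Proof.
elim: n => [|n IH] h /=; first exact: h.
by rewrite ge_max h// IH// => k kn; apply: h; rewrite (leq_trans kn).
Qed.

Lemma sq_mono f (m n : nat) : (m <= n)%N -> sq f m <= sq f n.
Proof.
elim: n => [|n IH]; first by rewrite leqn0 => /eqP ->.
rewrite leq_eqVlt => /predU1P[->//|/IH h]; rewrite (le_trans h)//.
by rewrite ler_wsqrtr// qvS lerDl sqr_ge0.
Qed.

Lemma dl_le_sq f n : `|dl f n| <= sq f n.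
Proof.
rewrite -sqrtr_sqr ler_wsqrtr//; case: n => [|n]; first by rewrite qv0 /dl subr0.
by rewrite qvS lerDr qv_ge0.
Qed.

Lemma dlS f n : f n.+1 = f n + dl f n.+1.
Proof. by rewrite /dl addrC subrK. Qed.

Lemma mx0_qv0 f n : mx f n = 0 -> qv f n = 0.
Proof.
elim: n => [|n IH] h.
  by rewrite qv0; have /normr0_eq0 -> := h; rewrite expr0n.
have h0 : mx f n = 0.
  by apply/eqP; rewrite eq_le mx_ge0 andbT -h (mx_mono f (leqnSn n)).
rewrite qvS IH// /dl.
have -> : f n.+1 = 0 by apply/normr0_eq0/eqP; rewrite eq_le normr_ge0 andbT -h mx_ge.
have -> : f n = 0 by apply/normr0_eq0/eqP; rewrite eq_le normr_ge0 andbT -h0 mx_ge.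
by rewrite subr0 expr0n addr0.
Qed.

(** The coefficients f k / mx f k are bounded by 1 and known at time k, so for a martingale in L^1
    the sum is integrable with zero expectation. *)
Lemma pathwise_davis_S f n :
  sq f n <= 4 * mx f n + \sum_(k < n) (- 2 * (f k / mx f k)) * dl f k.+1.
Proof.
suff h : davS (f n) (qv f n) (mx f n) <=
    \sum_(k < n) (- 2 * (f k / mx f k)) * dl f k.+1.
  have := @davS_major (f n) (qv f n) (mx f n) (mx_ge0 f n) (mx_ge f n) (qv_ge0 f n) (@mx0_qv0 f n).
  rewrite -/(sq f n); lra.
elim: n => [|n IH].
  rewrite big_ord0 qv0 /davS /=.
  have -> : f 0%N ^+ 2 - f 0%N ^+ 2 - 2 * `|f 0%N| ^+ 2 = - (2 * `|f 0%N| ^+ 2) by lra.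
  by rewrite mulNr oppr_le0 divr_ge0// mulr_ge0// sqr_ge0.
rewrite big_ord_recr /= qvS (dlS f).
have := @davS_step _ _ _ (dl f n.+1) (mx_ge0 f n) (mx_ge f n) (qv_ge0 f n) (@mx0_qv0 f n).
lra.
Qed.

Lemma mm_ge f n : `|f n| <= mm f n.
Proof. by case: n => [|n] //=; rewrite !le_max lexx orbT. Qed.

Lemma mm_ge_sq f n : sq f n <= mm f n.
Proof.
case: n => [|n] /=; last by rewrite !le_max lexx !orbT.
by rewrite /sq qv0 sqrtr_sqr.
Qed.

Lemma mx_le_mm f n : mx f n <= mm f n.
Proof.
elim: n => //= n IH; rewrite ge_max !le_max lexx orbT andbT.
by rewrite IH.
Qed.

Lemma mm_ge0 f n : 0 <= mm f n.
Proof. by rewrite (le_trans _ (mm_ge f n)). Qed.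

Lemma pathwise_davis_M f n :
  mx f n <= 50 * sq f n + \sum_(k < n) (2 * (f k / mm f k)) * dl f k.+1.
Proof.
suff h : davM (f n) (sq f n) (mm f n) <=
    \sum_(k < n) (2 * (f k / mm f k)) * dl f k.+1.
  have := @davM_major (f n) (sq f n) (mm f n) (mm_ge0 f n).
  have := mx_le_mm f n; lra.
elim: n => [|n IH].
  rewrite big_ord0 /davM /= /sq qv0 sqrtr_sqr.
  have := normr_ge0 (f 0%N).
  have [->|h] := eqVneq (f 0%N) 0; first by rewrite normr0 invr0; lra.
  by rewrite -[f 0%N ^+ 2](real_normK (num_real _)) expr2 mulfK ?normr_eq0//; lra.
rewrite big_ord_recr /= (dlS f).
have sqE : sq f n.+1 ^+ 2 = sq f n ^+ 2 + dl f n.+1 ^+ 2 by rewrite !sq_sqr qvS.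
have := davM_step (sq_ge0 f n) (sq_ge0 f n.+1) sqE (mm_ge f n) (mm_ge_sq f n).
lra.
Qed.

End pathwise.

(** * Integrability and expectation of real random variables *)

Section expectation.
Context d (Omega : measurableType d) (R : realType).
Variable P : probability Omega R.
Implicit Types (f g X : Omega -> R).

Definition Int f : Prop := P.-integrable setT (EFin \o f).
Definition Ex f : R := Rintegral P setT f.

Lemma Int_meas f : Int f -> measurable_fun setT f.
Proof. by move=> /(measurable_int P) /measurable_EFinP. Qed.

Lemma IntD f g : Int f -> Int g -> Int (fun x => f x + g x).
Proof. by move=> If Ig; exact (integrableD measurableT If Ig). Qed.

Lemma IntN f : Int f -> Int (fun x => - f x).
Proof. by move=> If; exact: (@integrableN _ _ _ P setT _ If). Qed.

Lemma IntB f g : Int f -> Int g -> Int (fun x => f x - g x).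
Proof. by move=> If Ig; apply: IntD => //; apply: IntN. Qed.

Lemma IntZ c f : Int f -> Int (fun x => c * f x).
Proof. by move=> If; exact: (@integrableZl _ _ _ P setT measurableT c _ If). Qed.

Lemma Int_cst c : Int (fun=> c).
Proof. exact: finite_measure_integrable_cst. Qed.

Lemma Int_sum (J : Type) (s : seq J) (Q : pred J) (h : J -> Omega -> R) :
  (forall i, Q i -> Int (h i)) -> Int (fun x => \sum_(i <- s | Q i) h i x).
Proof.
move=> Ih; elim: s => [|i s IH].
  by under eq_fun do rewrite big_nil; exact: Int_cst.
under eq_fun do rewrite big_cons.
by case Qi: (Q i) => //; apply: IntD => //; apply: Ih.
Qed.

Lemma Int_le f g : measurable_fun setT f -> (forall x, `|f x| <= g x) -> Int g -> Int f.
Proof.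
move=> mf fg Ig; apply: (le_integrable measurableT _ _ Ig).
  exact/measurable_EFinP.
by move=> x _ /=; rewrite lee_fin (le_trans (fg x))// ler_norm.
Qed.

Lemma Int_norm f : Int f -> Int (fun x => `|f x|).
Proof.
by move=> If; exact (integrable_norm If).
Qed.

Lemma Int_bd c f : measurable_fun setT f -> (forall x, `|f x| <= c) -> Int f.
Proof. by move=> mf fc; apply: Int_le mf fc (Int_cst c). Qed.

Lemma IntMb c f g : Int f -> measurable_fun setT g -> (forall x, `|g x| <= c) ->
  Int (fun x => g x * f x).
Proof.
move=> If mg gc; apply: (@Int_le _ (fun x => c * `|f x|)).
- by apply: measurable_funM => //; exact: Int_meas.
- by move=> x; rewrite normrM ler_wpM2r.
- exact/IntZ/Int_norm.
Qed.

Lemma Int_indM A f : measurable A -> Int f -> Int (fun x => \1_A x * f x).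
Proof.
move=> mA If; apply: (@IntMb 1) => //.
by move=> x; rewrite indicE; case: (_ \in _); rewrite ?normr1 ?normr0.
Qed.

Lemma Int_max f g : Int f -> Int g -> Int (fun x => Num.max (f x) (g x)).
Proof.
move=> If Ig; apply: (@Int_le _ (fun x => `|f x| + `|g x|)).
- by apply: measurable_maxr; exact: Int_meas.
- move=> x; have := normr_ge0 (f x); have := normr_ge0 (g x).
  by case: (leP (f x) (g x)) => _; lra.
- by apply: IntD; exact: Int_norm.
Qed.

Lemma eq_Ex f g : f =1 g -> Ex f = Ex g.
Proof. by move=> fg; apply: eq_Rintegral => x _. Qed.

Lemma ExD f g : Int f -> Int g -> Ex (fun x => f x + g x) = Ex f + Ex g.
Proof. exact: RintegralD. Qed.

Lemma ExB f g : Int f -> Int g -> Ex (fun x => f x - g x) = Ex f - Ex g.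
Proof. exact: RintegralB. Qed.

Lemma ExZ c f : Int f -> Ex (fun x => c * f x) = c * Ex f.
Proof. exact: RintegralZl. Qed.

Lemma ExN f : Int f -> Ex (fun x => - f x) = - Ex f.
Proof.
move=> If; rewrite -[RHS]mulN1r -ExZ//.
by apply: eq_Ex => x; rewrite mulN1r.
Qed.

Lemma Ex_cst c : Ex (fun=> c) = c.
Proof. by rewrite /Ex Rintegral_cst// [X in fine X](@probability_setT _ _ _ P) mulr1. Qed.

Lemma Ex_sum (J : Type) (s : seq J) (Q : pred J) (h : J -> Omega -> R) :
  (forall i, Q i -> Int (h i)) ->
  Ex (fun x => \sum_(i <- s | Q i) h i x) = \sum_(i <- s | Q i) Ex (h i).
Proof.
move=> Ih; elim: s => [|i s IH].
  by under eq_Ex do rewrite big_nil; rewrite Ex_cst big_nil.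
rewrite big_cons; under eq_Ex do rewrite big_cons.
case Qi: (Q i) => //; rewrite ExD ?IH//; first exact: Ih.
exact: Int_sum.
Qed.

Lemma Ex_le f g : Int f -> Int g -> (forall x, f x <= g x) -> Ex f <= Ex g.
Proof. by move=> If Ig fg; apply: le_Rintegral. Qed.

Lemma Ex_ge0 f : (forall x, 0 <= f x) -> 0 <= Ex f.
Proof. by move=> f0; apply: Rintegral_ge0. Qed.

Lemma Ex_norm f : Int f -> `|Ex f| <= Ex (fun x => `|f x|).
Proof. exact: le_normr_Rintegral. Qed.

Lemma ae_eq_Ex f g : measurable_fun setT f -> measurable_fun setT g ->
  f = g %[ae P] -> Ex f = Ex g.
Proof.
move=> mf mg fg; congr fine; apply: ae_eq_integral => //; try exact/measurable_EFinP.
by apply: filterS fg => x /= /[apply] ->.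
Qed.

Lemma ae_Int f g : measurable_fun setT g -> f = g %[ae P] -> Int f -> Int g.
Proof.
move=> mg fg If; apply/integrableP; split; first exact/measurable_EFinP.
have /integrableP[mf] := If.
rewrite (@ae_eq_integral _ _ _ P setT (abse \o (EFin \o g)) (abse \o (EFin \o f)))//.
- exact: measurableT_comp.
- by apply: measurableT_comp => //; apply/measurable_EFinP.
- by apply: filterS fg => x /= /[apply] ->.
Qed.

Lemma ExE f : Int f -> (\int[P]_x (f x)%:E)%E = (Ex f)%:E.
Proof. by move=> If; rewrite /Ex /Rintegral fineK//; exact: integrable_fin_num. Qed.

Lemma Ex_ind A : measurable A -> Ex (\1_A) = fine (P A).
Proof. by move=> mA; rewrite /Ex /Rintegral integral_indic// setIT. Qed.

Lemma Ex_dct (f_ : nat -> Omega -> R) f g :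
  (forall n, measurable_fun setT (f_ n)) -> measurable_fun setT f -> Int g ->
  (\forall x \ae P, f_ ^~ x @ \oo --> f x) ->
  (\forall x \ae P, forall n, `|f_ n x| <= g x) ->
  Int f /\ Ex (f_ n) @[n --> \oo] --> Ex f.
Proof.
move=> mf_ mf Ig cf df.
have [] := @dominated_convergence _ _ _ P setT measurableT (fun n => EFin \o f_ n)
  (EFin \o f) (EFin \o g).
- by move=> n; exact/measurable_EFinP.
- exact/measurable_EFinP.
- by apply: filterS cf => x cfx _; apply: cvg_EFin => //; exact: nearW.
- exact: Ig.
- by apply: filterS df => x dfx n _; rewrite /= lee_fin.
move=> If _ c; split; first exact: If.
by apply: fine_cvg; rewrite -/(Rintegral P setT f) -/(Ex f) -ExE.
Qed.

Lemma Ex_eq0 f : Int f -> (forall x, 0 <= f x) -> Ex f = 0 -> f = (cst 0) %[ae P].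
Proof.
move=> If f0 Ef.
have mf : measurable_fun setT (EFin \o f) by apply/measurable_EFinP; exact: Int_meas.
have : (\int[P]_x `|(EFin \o f) x| = 0)%E.
  by under eq_integral do rewrite gee0_abs ?lee_fin//; rewrite ExE// Ef.
move/(ae_eq_integral_abs P measurableT mf).
by apply: filterS => x /= /[apply] -[].
Qed.

End expectation.

(** * Conditional expectations *)

Section sub_sigma_algebra.
Context d (Omega : measurableType d) (R : realType) (P : probability Omega R).
Variable G : set (set Omega).
Hypothesis sG : sigma_algebra setT G.
Hypothesis GM : G `<=` measurable.
Notation E := (Ex P).
Notation Int := (Int P).

(** The identity from Omega to Omega equipped with G; its distribution [subP] is the restriction of
    P to G. *)
Definition to_sub : Omega -> g_sigma_algebraType G := idfun.

Lemma sub_measurableE : (measurable : set (set (g_sigma_algebraType G))) = G.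
Proof. exact: measurable_g_measurableTypeE. Qed.

Lemma measurable_to_sub : measurable_fun setT to_sub.
Proof. by move=> _ A; rewrite sub_measurableE setTI => GA; exact: GM. Qed.

HB.instance Definition _ := @isMeasurableFun.Build _ _ _ _ to_sub measurable_to_sub.

Definition subP := distribution P to_sub.

Lemma wrt_measurable d' (U : measurableType d') (X : Omega -> U) :
  measurable_wrt G X -> measurable_fun setT X.
Proof. by move=> WX; exact: (measurableT_comp WX measurable_to_sub). Qed.

Lemma wrt_preimage d' (U : measurableType d') (X : Omega -> U) B :
  measurable_wrt G X -> measurable B -> G (X @^-1` B).
Proof. by move=> WX mB; have := WX measurableT _ mB; rewrite sub_measurableE setTI. Qed.

Lemma wrt_indic A : G A -> measurable_wrt G (\1_A : Omega -> R).
Proof. by move=> GA; apply: measurable_indic; rewrite sub_measurableE. Qed.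

Section charge.
Variables (f : Omega -> R) (If : Int f).

(** The charge f dP on G. Its Radon-Nikodym derivative with respect to [subP] is the conditional
    expectation built in [cond_exp_ex]. *)
Definition sub_charge (A : set (g_sigma_algebraType G)) : \bar R :=
  induced_charge If A.

Let sub_charge0 : sub_charge set0 = 0%E.
Proof. exact: charge0. Qed.

Let sub_charge_fin A : measurable A -> sub_charge A \is a fin_num.
Proof. by rewrite sub_measurableE => /GM mA; exact: fin_num_measure. Qed.

Let sub_charge_sigma_additive : semi_sigma_additive sub_charge.
Proof.
move=> F mF tF mUF; apply: charge_semi_sigma_additive => //.
- by move=> n; apply: GM; rewrite -sub_measurableE.
- by apply: GM; rewrite -sub_measurableE.
Qed.

HB.instance Definition _ := isCharge.Build _ _ _ sub_charge
  sub_charge0 sub_charge_fin sub_charge_sigma_additive.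

Lemma sub_charge_dominated : sub_charge `<< subP.
Proof.
apply/null_content_dominatesP => A; rewrite sub_measurableE => GA PA0.
rewrite /sub_charge /induced_charge null_set_integral//; first exact: GM.
by apply: measurable_funTS; exact: measurable_int If.
Qed.

End charge.

Lemma int_setE A f : measurable A -> Int f ->
  (\int[P]_(x in A) (f x)%:E)%E = (E (fun x => \1_A x * f x))%:E.
Proof.
move=> mA If; rewrite -ExE; last exact: Int_indM.
rewrite integral_mkcond; apply: eq_integral => x _.
by rewrite epatch_indic /= -EFinM mulrC.
Qed.

Lemma sub_integral A (h : Omega -> \bar R) : G A -> measurable_wrt G h ->
  (\int[subP]_(x in A) h x)%E = (\int[P]_(x in A) h x)%E.
Proof.
move=> GA Wh; rewrite integralE [RHS]integralE.
have mA : measurable (A : set (g_sigma_algebraType G)) by rewrite sub_measurableE.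
congr (_ - _)%E; rewrite (ge0_integral_pushforward measurable_to_sub)//.
- by apply: measurable_funTS; exact: measurable_funepos.
- by apply: measurable_funTS; exact: measurable_funeneg.
Qed.

Lemma cond_exp_ex f : Int f -> exists g : Omega -> R,
  [/\ measurable_wrt G g, Int g & forall A, G A ->
     E (fun x => \1_A x * g x) = E (fun x => \1_A x * f x)].
Proof.
move=> If; have dom := sub_charge_dominated If.
pose h := Radon_Nikodym (sub_charge If) subP.
have hfin x : h x \is a fin_num by exact: Radon_Nikodym_fin_num.
have Ih : subP.-integrable setT h by exact: Radon_Nikodym_integrable.
have hE : EFin \o (fine \o h) = h by apply/funext => x; rewrite /= fineK.
have mh : measurable_fun setT h := measurable_int _ Ih.
have Wh : measurable_wrt G (fine \o h).
  apply/measurable_EFinP; rewrite hE; exact: mh.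
have Ih' : Int (fine \o h).
  apply/integrableP; split.
    by apply/measurable_EFinP; exact: wrt_measurable.
  move: Ih => /integrableP[_]; rewrite ge0_integral_distribution//; last first.
    exact: measurableT_comp.
  by rewrite -[in X in X -> _]hE.
exists (fine \o h); split => // A GA.
have mA := GM GA.
apply: EFin_inj; rewrite -!int_setE// -sub_integral//; last exact/measurable_EFinP.
rewrite -[RHS]/(sub_charge If A) (Radon_Nikodym_integral dom) ?sub_measurableE//.
by apply: eq_integral => x _; rewrite fineK.
Qed.

Lemma ae_sub (Q : set Omega) : (\forall x \ae subP, Q x) -> (\forall x \ae P, Q x).
Proof.
move=> [N [mN N0 QN]]; exists N; split => //.
by apply: GM; rewrite -sub_measurableE.
Qed.

(** The extended-real version h is arbitrary because [cond_expe] is picked by [xget]: neither its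
    finiteness nor its integrability is known beforehand. *)
Lemma cond_expe_ae f g (h : Omega -> \bar R) : Int f ->
  measurable_wrt G g -> Int g -> (forall A, G A ->
     E (fun x => \1_A x * g x) = E (fun x => \1_A x * f x)) ->
  is_cond_exp P G (EFin \o f) h -> EFin \o g = h %[ae P].
Proof.
move=> If Wg Ig gf [Wh hf].
apply: ae_sub; apply: (@integral_ae_eq _ (g_sigma_algebraType G) _ subP setT) => //.
- apply/integrableP; split; first exact/measurable_EFinP.
  rewrite ge0_integral_distribution//; last first.
    by apply: measurableT_comp => //; apply/measurable_EFinP.
  by move: Ig => /integrableP[].
- move=> A _; rewrite sub_measurableE => GA.
  rewrite sub_integral//; last exact/measurable_EFinP.
  rewrite sub_integral// hf//.
  by rewrite int_setE ?gf -?int_setE//; exact: GM.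
Qed.

Lemma is_cond_exp_EFin f g : Int f -> measurable_wrt G g -> Int g ->
  (forall A, G A -> E (fun x => \1_A x * g x) = E (fun x => \1_A x * f x)) ->
  is_cond_exp P G (EFin \o f) (EFin \o g).
Proof.
move=> If Wg Ig gf; split; first exact/measurable_EFinP.
by move=> A GA; rewrite !int_setE ?gf//; exact: GM.
Qed.

Lemma cond_expP f : Int f ->
  [/\ measurable_wrt G (cond_exp P G f), Int (cond_exp P G f) &
   forall A, G A ->
     E (fun x => \1_A x * cond_exp P G f x) = E (fun x => \1_A x * f x)].
Proof.
move=> If; have [g [Wg Ig gf]] := cond_exp_ex If.
have icf : is_cond_exp P G (EFin \o f) (cond_expe P G (EFin \o f)).
  by apply: xgetPex; exists (EFin \o g); exact: is_cond_exp_EFin.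
have Wc : measurable_wrt G (cond_exp P G f).
  by apply: measurableT_comp icf.1 => //; exact: fine_measurable.
have gc : g = cond_exp P G f %[ae P].
  by apply: filterS (cond_expe_ae If Wg Ig gf icf) => x /= + _ => /(_ I); rewrite /cond_exp /= => <-.
have mc := wrt_measurable Wc.
split => //; first exact: ae_Int gc Ig.
move=> A GA; rewrite -gf//; apply: ae_eq_Ex.
- apply: measurable_funM => //; apply: measurable_indic; exact: GM.
- apply: measurable_funM; last exact: wrt_measurable.
  apply: measurable_indic; exact: GM.
- by apply: filterS gc => x /= /[apply] ->.
Qed.

Lemma cond_exp_uniq f g : Int f -> measurable_wrt G g -> Int g ->
  (forall A, G A -> E (fun x => \1_A x * g x) = E (fun x => \1_A x * f x)) ->
  g = cond_exp P G f %[ae P].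
Proof.
move=> If Wg Ig gf; have [Wc Ic cf] := cond_expP If.
have := cond_expe_ae If Wg Ig gf (is_cond_exp_EFin If Wc Ic cf).
by apply: filterS => x /= /[apply] -[].
Qed.

Lemma wrt_ge0 g : measurable_wrt G g -> Int g ->
  (forall A, G A -> 0 <= E (fun x => \1_A x * g x)) -> \forall x \ae P, 0 <= g x.
Proof.
move=> Wg Ig g0; pose A := g @^-1` `]-oo, 0[.
have GA : G A by apply: wrt_preimage Wg _; exact: measurable_itv.
have IA : Int (fun x => \1_A x * g x) by apply: Int_indM => //; exact: GM.
have h : (fun x => - (\1_A x * g x)) = cst 0 %[ae P].
  apply: Ex_eq0; first exact: IntN.
    move=> x; rewrite indicE; case: (boolP (x \in A)) => [|_]; last by rewrite mul0r oppr0.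
    by rewrite inE /A /= in_itv/= mul1r oppr_ge0 => /ltW.
  apply/eqP; rewrite eq_le; apply/andP; split.
    by rewrite ExN// oppr_le0; exact: g0.
  apply: Ex_ge0 => x.
  rewrite indicE; case: (boolP (x \in A)) => [|_]; last by rewrite mul0r oppr0.
  by rewrite inE /A /= in_itv/= mul1r oppr_ge0 => /ltW.
apply: filterS h => x /(_ I) /=; rewrite indicE leNgt.
case: (boolP (x \in A)) => [xA|xA _]; last first.
  by apply: contra xA; rewrite inE /A /= in_itv.
by rewrite mul1r => /eqP; rewrite oppr_eq0 => /eqP ->; rewrite ltxx.
Qed.

Import HBNNSimple.

(** From indicators to nonnegative G-measurable weights, by simple functions and dominated
    convergence. Conditional inequalities are used below in this integrated form. *)
Lemma Ex_mul_ge0 phi (X : Omega -> R) : Int phi -> (forall A, G A -> 0 <= E (fun x => \1_A x * phi x)) ->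
  measurable_wrt G X -> (forall x, 0 <= X x) -> Int (fun x => X x * phi x) ->
  0 <= E (fun x => X x * phi x).
Proof.
move=> Iphi phi0 WX X0 IX.
have mX : measurable_fun [set: g_sigma_algebraType G] (EFin \o X) by exact/measurable_EFinP.
pose h n : Omega -> R := nnsfun_approx measurableT mX n.
have Wh n : measurable_wrt G (h n) by exact: measurable_funP.
have mh n := wrt_measurable (Wh n).
have mphi := Int_meas Iphi.
have h0 n x : 0 <= h n x by exact: fun_ge0.
have hX n x : h n x <= X x.
  by rewrite -lee_fin /h nnsfun_approxE (@le_approx _ _ _ setT (EFin \o X))// => y _; rewrite lee_fin.
have ch x : h ^~ x @ \oo --> X x.
  have := @cvg_nnsfun_approx _ (g_sigma_algebraType G) _ setT measurableT (EFin \o X) mX.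
  move=> /(_ (fun y _ => X0 y) x I) /fine_cvg; exact.
have [|_ cE] := @Ex_dct _ _ _ P (fun n x => h n x * phi x) (fun x => X x * phi x)
  (fun x => `|X x * phi x|) (fun n => measurable_funM (mh n) mphi)
  (Int_meas IX) (Int_norm IX)
  (aeW _ (fun x => cvgM (ch x) (cvg_cst (phi x)))).
  apply: aeW => x n; rewrite !normrM ler_wpM2r//.
  by rewrite !ger0_norm.
apply: (cvgn_ge cE) => n.
have -> : E (fun x => h n x * phi x) = E (fun x => \sum_(y <- finmap.enum_fset (fset_set (range (h n))))
   y * (\1_(h n @^-1` [set y]) x * phi x)).
  apply: eq_Ex => x.
  rewrite {1}/h fimfunE fsbig_finite//= mulr_suml.
  by apply: eq_bigr => y _; rewrite mulrA.
have mY y : G (h n @^-1` [set y]) by apply: wrt_preimage => //; exact: measurable_set1.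
rewrite Ex_sum; last by move=> y _; apply/IntZ/Int_indM => //; exact: GM.
rewrite big_seq; apply: sumr_ge0 => y; rewrite in_fset_set; last exact: (fimfunP (nnsfun_approx measurableT mX n)).
move=> /set_mem[x _ <-].
rewrite ExZ; last by apply/Int_indM => //; exact: GM.
by apply: mulr_ge0 => //; apply: phi0.
Qed.

End sub_sigma_algebra.

Section conditional_bounds.
Context d (Omega : measurableType d) (R : realType) (P : probability Omega R).
Variable G : set (set Omega).
Hypothesis sG : sigma_algebra setT G.
Hypothesis GM : G `<=` measurable.
Notation E := (Ex P).
Notation Int := (Int P).

Lemma Ex_mul_eq0 phi (X : Omega -> R) : Int phi ->
  (forall A, G A -> E (fun x => \1_A x * phi x) = 0) ->
  measurable_wrt G X -> Int (fun x => X x * phi x) -> E (fun x => X x * phi x) = 0.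
Proof.
move=> Iphi phi0 WX IX.
have nphi0 A : G A -> E (fun x => \1_A x * - phi x) = 0.
  move=> GA; under eq_Ex do rewrite mulrN.
  by rewrite ExN ?phi0 ?oppr0//; apply: Int_indM => //; exact: GM.
have key (Y : Omega -> R) : measurable_wrt G Y -> (forall x, 0 <= Y x) ->
    Int (fun x => Y x * phi x) -> E (fun x => Y x * phi x) = 0.
  move=> WY Y0 IY; apply/eqP; rewrite eq_le; apply/andP; split; last first.
    by apply: (Ex_mul_ge0 sG GM) => // A GA; rewrite phi0.
  rewrite -oppr_ge0 -ExN//; under eq_Ex do rewrite -mulrN.
  apply: (Ex_mul_ge0 sG GM) => //; first exact: IntN.
    by move=> A GA; rewrite nphi0.
  by under eq_fun do rewrite mulrN; exact: IntN.
have W0 : measurable_wrt G (cst (0 : R) : Omega -> R) by exact: measurable_cst.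
have WN : measurable_wrt G (fun x => - X x) by exact: measurable_funN.
have Wp : measurable_wrt G (fun x => Num.max (X x) 0) by exact: measurable_maxr.
have Wn : measurable_wrt G (fun x => Num.max (- X x) 0) by exact: measurable_maxr.
have dom (Y : Omega -> R) : measurable_wrt G Y -> (forall x, `|Y x| <= `|X x|) ->
    Int (fun x => Y x * phi x).
  move=> WY YX; apply: (@Int_le _ _ _ P _ (fun x => `|X x * phi x|)); last exact: Int_norm.
    by apply: measurable_funM; [exact: (wrt_measurable sG GM)|exact: Int_meas Iphi].
  by move=> x; rewrite !normrM ler_wpM2r.
have Ip : Int (fun x => Num.max (X x) 0 * phi x).
  apply: dom => // x; case: (leP (X x) 0) => // _; by rewrite normr0.
have In : Int (fun x => Num.max (- X x) 0 * phi x).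
  apply: dom => // x; case: (leP (- X x) 0) => _; by rewrite ?normr0 ?normrN.
have -> : E (fun x => X x * phi x) = E (fun x => Num.max (X x) 0 * phi x - Num.max (- X x) 0 * phi x).
  apply: eq_Ex => x; rewrite -mulrBl; congr (_ * _).
  by case: (leP (X x) 0) => h; case: (leP (- X x) 0) => h'; lra.
rewrite ExB// !key ?subrr// => x; by rewrite le_max lexx orbT.
Qed.

(** Since phi may fail to be integrable, it is cut into slices [psi k] with values in [0, 1], whose
    conditional expectations are summed. The BMO norm needs this: it involves |b - b_{n-1}|^p before
    its integrability is known. *)
Lemma cond_expe_nneg (phi : Omega -> R) : measurable_fun setT phi -> (forall x, 0 <= phi x) ->
  is_cond_exp P G (EFin \o phi) (cond_expe P G (EFin \o phi)).
Proof.
move=> mphi phi0; apply: xgetPex.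
pose psi (k : nat) x := Num.min (phi x) k.+1%:R - Num.min (phi x) k%:R.
have psi0 k x : 0 <= psi k x.
  by rewrite subr_ge0 le_min !ge_min lexx ler_nat leqnSn orbT.
have psi1 k x : `|psi k x| <= 1.
  rewrite ger0_norm// /psi -natr1.
  by case: (leP (phi x) (k%:R + 1)) => h; case: (leP (phi x) k%:R) => h'; lra.
have mpsi k : measurable_fun setT (psi k).
  by apply: measurable_funB; apply: measurable_minr.
have Ipsi k : Int (psi k) by exact: Int_bd (mpsi k) (psi1 k).
(* The conditional expectation of a slice is nonnegative only almost everywhere; its positive part
   gives a series of nonnegative terms at every point. *)
pose g k x := Num.max (cond_exp P G (psi k) x) 0.
have g0 k x : 0 <= g k x by rewrite le_max lexx orbT.
have gP k : [/\ measurable_wrt G (g k), Int (g k) & forall A, G A ->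
     E (fun x => \1_A x * g k x) = E (fun x => \1_A x * psi k x)].
  have [Wc Ic cE] := cond_expP sG GM (Ipsi k).
  have Wg : measurable_wrt G (g k) by apply: measurable_maxr => //; exact: measurable_cst.
  have Ig : Int (g k) by apply: Int_max => //; exact: Int_cst.
  split => // A GA; rewrite -cE//.
  have mA : measurable (A : set Omega) by exact: GM.
  apply: (@ae_eq_Ex _ _ _ P).
  - exact: (Int_meas (Int_indM mA Ig)).
  - exact: (Int_meas (Int_indM mA Ic)).
  have : \forall x \ae P, 0 <= cond_exp P G (psi k) x.
    apply: (wrt_ge0 sG GM) => // B GB; rewrite cE//; apply: Ex_ge0 => x.
    by rewrite mulr_ge0// indicE.
  apply: filterS => x c0 _; congr (_ * _); rewrite /g; exact/max_idPl.
have Wg k : measurable_wrt G (fun x => (g k x)%:E) by apply/measurable_EFinP; case: (gP k).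
have mg k : measurable_fun setT (fun x => (g k x)%:E) by exact: (wrt_measurable sG GM).
exists (fun x => \sum_(0 <= k <oo) (g k x)%:E)%E; split.
  apply: (@ge0_emeasurable_sum _ (g_sigma_algebraType G) _ setT
    (fun k x => (g k x)%:E) xpredT) => [k x _ _|k _]; first by rewrite lee_fin.
  exact: Wg.
move=> A GA; have mA : measurable (A : set Omega) by exact: GM.
rewrite integral_nneseries//; last first.
- by move=> k x _; rewrite lee_fin.
- by move=> k; exact: measurable_funTS.
transitivity (\sum_(0 <= k <oo) \int[P]_(x in A) (psi k x)%:E)%E.
  by apply: eq_eseriesr => k _; have [_ Ig gE] := gP k; rewrite !int_setE ?gE.
rewrite -integral_nneseries//; last first.
- by move=> k x _; rewrite lee_fin.
- by move=> k; apply: measurable_funTS; exact/measurable_EFinP.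
apply: eq_integral => x _; apply/cvg_lim => //.
have psum n : (\sum_(0 <= k < n) (psi k x)%:E)%E = (Num.min (phi x) n%:R)%:E.
  rewrite sumEFin; congr EFin; rewrite telescope_sumr//.
  by rewrite [Num.min _ 0](min_idPr _)// subr0.
rewrite (_ : (fun n => _) = (fun n => (Num.min (phi x) n%:R)%:E)); last exact/funext.
apply: cvg_near_cst; near=> n; congr EFin; apply/min_idPl.
near: n; exact: nbhs_infty_ger.
Unshelve. all: by end_near. Qed.

Lemma Linfty_ae (h : Omega -> \bar R) (K : \bar R) :
  ('N[P]_+oo[h] <= K)%E -> \forall x \ae P, (`|h x| <= K)%E.
Proof.
rewrite unlock /Lnorm [X in (0 < X)%E](@probability_setT _ _ _ P) lte01.
by move/ess_supP.
Qed.

Lemma sub_setT : G setT.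
Proof. by case: sG => G0 GC _; rewrite -(setD0 setT); exact: GC. Qed.

(** Integrability of phi is part of the conclusion: it comes from testing the bound on the whole
    space. *)
Lemma cond_expe_Linfty (phi : Omega -> R) (K : R) :
  measurable_fun setT phi -> (forall x, 0 <= phi x) ->
  ('N[P]_+oo[cond_expe P G (EFin \o phi)] <= K%:E)%E ->
  Int phi /\ forall A, G A -> E (fun x => \1_A x * phi x) <= K * E (\1_A).
Proof.
move=> mphi phi0 hK'; have hK := Linfty_ae hK'.
have K0 : (0 <= K%:E)%E by apply: le_trans hK'; exact: Lnorm_ge0.
have [] := cond_expe_nneg mphi phi0; move: hK; move: (cond_expe P G _) => h hK Wh hE.
have le A : G A -> (\int[P]_(x in A) (phi x)%:E <= K%:E * P A)%E.
  move=> GA; have mA : measurable (A : set Omega) by exact: GM.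
  rewrite -[X in (X <= _)%E](hE A GA) -integral_cst//.
  have mh : measurable_fun A h by apply: measurable_funTS; exact: (wrt_measurable sG GM).
  rewrite (le_trans (lee_abs _))// (le_trans (le_abse_integral P mA mh))//.
  apply: ae_ge0_le_integral => //.
  - exact: measurableT_comp.
  - by apply: filterS hK => x hx _.
have Iphi : Int phi.
  apply/integrableP; split; first exact/measurable_EFinP.
  under eq_integral do rewrite /= ger0_norm//.
  rewrite (le_lt_trans (le setT sub_setT))// [X in (_ * X)%E](@probability_setT _ _ _ P) mule1 ltry//.
split => // A GA; have mA : measurable (A : set Omega) by exact: GM.
have := le A GA; rewrite int_setE// Ex_ind//.
by rewrite -[P A in X in X -> _]fineK ?fin_num_measure// -EFinM lee_fin.
Qed.
End conditional_bounds.

(** * Martingales and martingale transforms *)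

Section measurable_paths.
Context d (T : measurableType d) (R : realType).
Implicit Types f : nat -> T -> R.

Lemma measurable_invr (g : T -> R) : measurable_fun setT g -> measurable_fun setT (fun x => (g x)^-1).
Proof.
move=> mg; apply: (measurableT_comp (f := @GRing.inv R) _ mg).
have m0 : measurable ([set 0] : set R) by exact: measurable_set1.
have : measurable_fun (~` [set 0] `|` [set (0 : R)]) (@GRing.inv R).
  apply/measurable_funU => //; first exact: measurableC.
  split; last exact: measurable_fun_set1.
  apply: open_continuous_measurable_fun.
    by rewrite openC; exact: closed_eq.
  by apply/in_setP => x /= /eqP x0; exact: inv_continuous.
by rewrite setvU.
Qed.

Lemma measurable_sqrtr (g : T -> R) : measurable_fun setT g ->
  measurable_fun setT (fun x => Num.sqrt (g x)).
Proof.
move=> mg; apply: (measurableT_comp (f := @Num.sqrt R) _ mg).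
by apply: continuous_measurable_fun; exact: sqrt_continuous.
Qed.

(** Measurability is asked only up to time n, here and in the next lemmas, so that they also apply
    with F n as the sigma-algebra and then prove adaptedness. *)
Lemma measurable_dl f n : (forall k, (k <= n)%N -> measurable_fun setT (f k)) ->
  measurable_fun setT (fun x => dl (f ^~ x) n).
Proof.
move=> mf; rewrite /dl; apply: measurable_funB; first exact: mf.
by case: n mf => [|n] mf; [exact: measurable_cst|exact: mf].
Qed.

Lemma measurable_qv f n : (forall k, (k <= n)%N -> measurable_fun setT (f k)) ->
  measurable_fun setT (fun x => qv (f ^~ x) n).
Proof.
move=> mf; rewrite /qv; apply: measurable_sum => k; apply: measurable_funX.
by apply: measurable_dl => j jk; apply: mf; rewrite (leq_trans jk)// -ltnS.
Qed.

Lemma measurable_sq f n : (forall k, (k <= n)%N -> measurable_fun setT (f k)) ->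
  measurable_fun setT (fun x => sq (f ^~ x) n).
Proof. by move=> mf; apply/measurable_sqrtr/measurable_qv. Qed.

Lemma measurable_norm (g : T -> R) : measurable_fun setT g ->
  measurable_fun setT (fun x => `|g x|).
Proof. by move=> mg; exact: measurableT_comp. Qed.

Lemma measurable_mx f n : (forall k, (k <= n)%N -> measurable_fun setT (f k)) ->
  measurable_fun setT (fun x => mx (f ^~ x) n).
Proof.
elim: n => [|n IH] mf /=; first by apply: measurable_norm; exact: mf.
apply: measurable_maxr; last by apply: measurable_norm; exact: mf.
by apply: IH => k kn; apply: mf; rewrite (leq_trans kn).
Qed.

Lemma measurable_mm f n : (forall k, (k <= n)%N -> measurable_fun setT (f k)) ->
  measurable_fun setT (fun x => mm (f ^~ x) n).
Proof.
elim: n => [|n IH] mf /=; first by apply: measurable_norm; exact: mf.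
apply: measurable_maxr.
  by apply: IH => k kn; apply: mf; rewrite (leq_trans kn).
apply: measurable_maxr; first by apply: measurable_norm; exact: mf.
exact: measurable_sq.
Qed.

End measurable_paths.

Section martingales.
Context d (Omega : measurableType d) (R : realType) (P : probability Omega R).
Variable F : nat -> set (set Omega).
Hypothesis HF : is_filtration F.
Notation E := (Ex P).
Notation Int := (Int P).
Notation W n X := (measurable_wrt (F n) X).
Implicit Types f : nat -> Omega -> R.

Lemma filt_sigma n : sigma_algebra setT (F n). Proof. by case: HF. Qed.
Lemma filt_measurable n : F n `<=` measurable. Proof. by case: HF. Qed.
Lemma filt_le m n : (m <= n)%N -> F m `<=` F n. Proof. by case: HF => _ _ + _ _; exact. Qed.
Hint Resolve filt_sigma filt_measurable : core.

Lemma filt_setT n : F n setT. Proof. exact: sub_setT. Qed.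

Lemma W_le m n d' (U : measurableType d') (X : Omega -> U) : (m <= n)%N -> W m X -> W n X.
Proof.
move=> mn WX _ B mB; rewrite sub_measurableE// setTI.
by apply: (filt_le mn); exact: wrt_preimage WX mB.
Qed.

Lemma W_meas n d' (U : measurableType d') (X : Omega -> U) : W n X -> measurable_fun setT X.
Proof. exact: wrt_measurable. Qed.

(** The martingale property is tested on sets of F n, which avoids versions of conditional
    expectations; [is_martingale_mart] links it to the official notion. *)
Definition mart f := [/\ forall n, W n (f n), forall n, Int (f n) &
  forall n A, F n A -> E (fun x => \1_A x * (f n.+1 x - f n x)) = 0].

Lemma mart_mul f n (X : Omega -> R) : mart f -> W n X ->
  Int (fun x => X x * dl (f ^~ x) n.+1) -> E (fun x => X x * dl (f ^~ x) n.+1) = 0.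
Proof.
move=> [Wf If Ef] WX IX; apply: (@Ex_mul_eq0 _ _ _ _ (F n)) => //.
  by apply: IntB.
by move=> A FA; exact: Ef.
Qed.

Lemma mart_Int_dl f n : mart f -> Int (fun x => dl (f ^~ x) n).
Proof.
move=> [Wf If Ef]; rewrite /dl; apply: IntB => //.
by case: n => [|n] //; exact: Int_cst.
Qed.

Lemma mart_Int_mx f n : (forall k, Int (f k)) -> Int (fun x => mx (f ^~ x) n).
Proof.
move=> If; elim: n => [|n IH] /=; first exact: Int_norm.
by apply: Int_max => //; exact: Int_norm.
Qed.

Lemma sq_le_sum (a : nat -> R) n : sq a n <= \sum_(k < n.+1) `|dl a k|.
Proof.
rewrite /sq -[leRHS]ger0_norm; last by apply: sumr_ge0.
rewrite -sqrtr_sqr ler_wsqrtr// /qv.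
elim: n.+1 => [|m IH]; first by rewrite !big_ord0 expr0n.
rewrite !big_ord_recr /= -[dl a m ^+ 2](real_normK (num_real _)).
have h : 0 <= \sum_(i < m) `|dl a i| by apply: sumr_ge0.
have := normr_ge0 (dl a m); nra.
Qed.

Lemma mart_Int_sq f n : mart f -> Int (fun x => sq (f ^~ x) n).
Proof.
move=> mf; have [Wf If Ef] := mf.
apply: (@Int_le _ _ _ _ _ (fun x => \sum_(k < n.+1) `|dl (f ^~ x) k|)).
- by apply: measurable_sq => k _; exact: Int_meas (If k).
- by move=> x; rewrite ger0_norm ?sq_ge0// sq_le_sum.
- by apply: Int_sum => k _; apply: Int_norm; exact: mart_Int_dl.
Qed.

Lemma mart_sum_mul f (h : nat -> Omega -> R) c N : mart f -> (forall n, W n (h n)) ->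
  (forall n x, `|h n x| <= c) ->
  Int (fun x => \sum_(k < N) h k x * dl (f ^~ x) k.+1) /\
  E (fun x => \sum_(k < N) h k x * dl (f ^~ x) k.+1) = 0.
Proof.
move=> mf Wh hc.
have I k : Int (fun x => h k x * dl (f ^~ x) k.+1).
  by apply: IntMb (hc k); [exact: mart_Int_dl|exact: W_meas (Wh k)].
split; first exact: Int_sum.
by rewrite Ex_sum// big1// => k _; exact: mart_mul.
Qed.

Lemma ratio_le1 (a b : R) : `|a| <= b -> `|a / b| <= 1.
Proof.
move=> ab; have b0 : 0 <= b by exact: le_trans ab.
rewrite normrM normfV (ger0_norm b0).
have [->|b1] := eqVneq b 0; first by rewrite invr0 mulr0.
by rewrite ler_pdivrMr ?mul1r// lt_neqAle eq_sym b1.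
Qed.

Lemma davis_S f N : mart f -> E (fun x => sq (f ^~ x) N) <= 4 * E (fun x => mx (f ^~ x) N).
Proof.
move=> mf; have [Wf If Ef] := mf.
have Wfk n k : (k <= n)%N -> W n (f k) by move=> kn; exact: W_le kn _.
pose h n x := - 2 * (f n x / mx (f ^~ x) n).
have Wh n : W n (h n).
  apply: measurable_funM; first exact: measurable_cst.
  apply: measurable_funM; first exact: Wf.
  by apply: measurable_invr; apply: measurable_mx => k; exact: Wfk.
have hc n x : `|h n x| <= 2.
  rewrite normrM normrN normr_nat ler_piMr//; exact/ratio_le1/mx_ge.
have [Ih Eh] := mart_sum_mul N mf Wh hc.
have Im := mart_Int_mx N If.
rewrite -[leRHS]addr0 -[X in _ + X]Eh -ExZ// -ExD//; last exact: IntZ.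
apply: Ex_le; [exact: mart_Int_sq|by apply: IntD => //; exact: IntZ|].
by move=> x; exact: pathwise_davis_S.
Qed.

Lemma davis_M f N : mart f -> E (fun x => mx (f ^~ x) N) <= 50 * E (fun x => sq (f ^~ x) N).
Proof.
move=> mf; have [Wf If Ef] := mf.
have Wfk n k : (k <= n)%N -> W n (f k) by move=> kn; exact: W_le kn _.
pose h n x := 2 * (f n x / mm (f ^~ x) n).
have Wh n : W n (h n).
  apply: measurable_funM; first exact: measurable_cst.
  apply: measurable_funM; first exact: Wf.
  by apply: measurable_invr; apply: measurable_mm => k; exact: Wfk.
have hc n x : `|h n x| <= 2.
  rewrite normrM normr_nat ler_piMr//; exact/ratio_le1/mm_ge.
have [Ih Eh] := mart_sum_mul N mf Wh hc.
have Is := mart_Int_sq N mf.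
rewrite -[leRHS]addr0 -[X in _ + X]Eh -ExZ// -ExD//; last exact: IntZ.
apply: Ex_le; [exact: mart_Int_mx|by apply: IntD => //; exact: IntZ|].
by move=> x; exact: pathwise_davis_M.
Qed.

End martingales.

(** * Tails, transforms and stopped transforms of a path *)

Section paths.
Variable R : realType.
Implicit Types (a th : nat -> R).

(** The path restarted from 0 at time N. The time index is not shifted, so that the tail of an
    adapted process is adapted. *)
Definition tail a N := fun n => a (maxn n N) - a N.

Lemma dl_tail a N n : dl (tail a N) n = if (N < n)%N then dl a n else 0.
Proof.
rewrite /dl /tail; case: n => [|n]; first by rewrite ltn0 max0n subrr subr0.
rewrite ltnS; case: (boolP (N <= n)%N) => [Nn|]; last rewrite -ltnNge => nN.
  by rewrite (maxn_idPl (leqW Nn)) (maxn_idPl Nn) opprB addrA subrK.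
by rewrite (maxn_idPr nN) (maxn_idPr (ltnW nN)) !subrr.
Qed.

Lemma qv_tail a N M : qv (tail a N) M = if (N <= M)%N then qv a M - qv a N else 0.
Proof.
elim: M => [|M IH].
  rewrite qv0 leqn0 /tail; case: eqP => [->|_]; first by rewrite maxnn !subrr expr0n.
  by rewrite max0n subrr expr0n.
rewrite qvS IH dl_tail ltnS.
case: (leqP N M) => [NM|MN]; first by rewrite (leqW NM) qvS addrAC.
rewrite expr0n addr0; case: leqP => // MN'.
have -> : N = M.+1 by apply/eqP; rewrite eqn_leq MN' MN.
by rewrite subrr.
Qed.

(** The tail has square function sqrt((t - s)(t + s)), split by the arithmetic-geometric mean
    inequality. In [E_sq_tail] c is chosen small first and N afterwards, so that a bound on E S(f)
    is enough to make tails small. *)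
Lemma sq_tail a N M c : 0 < c ->
  sq (tail a N) M <= c * sq a (maxn M N) + (sq a (maxn M N) - sq a N) / c.
Proof.
move=> c0; rewrite /sq qv_tail.
have hM : sq a N <= sq a (maxn M N) by apply: sq_mono; exact: leq_maxr.
case: (boolP (N <= M)%N) => [NM|MN]; last first.
  rewrite sqrtr0 addr_ge0// ?mulr_ge0 ?sq_ge0 ?(ltW c0)// ?invr_ge0 ?(ltW c0)//.
  by rewrite subr_ge0.
rewrite (maxn_idPl NM) in hM *.
rewrite -!/(sq _ _) -!sq_sqr.
have := sq_ge0 a N; move: (sq a N) (sq a M) hM => s t st s0.
rewrite -[leRHS]ger0_norm; last first.
  by rewrite addr_ge0// ?divr_ge0 ?mulr_ge0 ?subr_ge0 ?(ltW c0)//; exact: le_trans st.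
rewrite -sqrtr_sqr ler_wsqrtr//.
set w := (t - s) / c.
have wE : t - s = w * c by rewrite /w divfK// gt_eqF.
have w0 : 0 <= w by rewrite divr_ge0 ?subr_ge0 ?(ltW c0).
have sE : s = t - w * c by lra.
rewrite sE; rewrite sE in s0.
have : 0 <= w * c by rewrite mulr_ge0// ltW.
have := sqr_ge0 w; have := sqr_ge0 (c * t - w).
nra.
Qed.

(** The increment at k+1 carries the coefficient th k and the increment at 0 is dropped: this is the
    convention eps_{-1} = 0. *)
Definition tr th a n := \sum_(k < n) th k * dl a k.+1.

Lemma dl_tr th a n : dl (tr th a) n = if n is m.+1 then th m * dl a n else 0.
Proof.
rewrite /dl /tr; case: n => [|n]; first by rewrite big_ord0 subrr.
by rewrite big_ord_recr /= addrAC subrr add0r.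
Qed.

Lemma sq_tr th a n : (forall k, `|th k| <= 1) -> sq (tr th a) n <= sq a n.
Proof.
move=> h; rewrite ler_wsqrtr// /qv; apply: ler_sum => k _; rewrite dl_tr.
case: (k : nat) => [|m]; first by rewrite expr0n sqr_ge0.
rewrite exprMn ler_piMl ?sqr_ge0// -(real_normK (num_real _)).
by rewrite expr_le1.
Qed.

Lemma burk_path th a n : (forall k, `|th k| <= 1) ->
  burk (a n) (tr th a n) <= \sum_(k < n)
    (burkX (a k) (tr th a k) + burkY (a k) (tr th a k) * th k) * dl a k.+1.
Proof.
move=> h; elim: n => [|n IH].
  by rewrite /tr !big_ord0 burk0.
rewrite big_ord_recr /= (dlS a) (dlS (tr th a)) dl_tr.
have : `|th n * dl a n.+1| <= `|dl a n.+1| by rewrite normrM ler_piMl.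
move=> /(@burk_step _ (a n) (tr th a n)); rewrite mulrDl mulrA; lra.
Qed.

(** Once the transform has reached size lam the coefficients are switched off, and the stopped
    transform keeps its value. A bound at the final time thus becomes a bound on the running
    maximum. *)
Definition stop (lam : R) th a k := if mx (tr th a) k < lam then th k else 0.

Lemma stop_tr lam th a n :
  (mx (tr th a) n < lam -> tr (stop lam th a) a n = tr th a n) /\
  (lam <= mx (tr th a) n -> lam <= `|tr (stop lam th a) a n|).
Proof.
have rec m (th' : nat -> R) : tr th' a m.+1 = tr th' a m + th' m * dl a m.+1.
  by rewrite /tr big_ord_recr.
elim: n => [|n [IH1 IH2]].
  by rewrite /= /tr !big_ord0; split.
rewrite !rec [mx _ n.+1]/= rec [stop lam th a n]/stop.
case: (ltP (mx (tr th a) n) lam) => h.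
  rewrite IH1//; split => //.
  by rewrite le_max => /orP[|//]; rewrite leNgt h.
rewrite mul0r addr0; split; last by move=> _; exact: IH2.
by rewrite gt_max => /andP[]; rewrite ltNge h.
Qed.

End paths.

(** * Markov's inequality and a criterion for almost sure convergence *)

Section probability_bounds.
Context d (Omega : measurableType d) (R : realType) (P : probability Omega R).
Notation E := (Ex P).
Notation Int := (Int P).
Notation pr A := (fine (P A)).

Lemma measurable_ge (f : Omega -> R) t : measurable_fun setT f -> measurable [set x | t <= f x].
Proof.
move=> mf; rewrite (_ : [set x | _] = f @^-1` `[t, +oo[).
  by rewrite -[X in measurable X]setTI; apply: mf => //; exact: measurable_itv.
by apply/seteqP; split => x /=; rewrite in_itv/= andbT.
Qed.

Lemma measurable_gt (f : Omega -> R) t : measurable_fun setT f -> measurable [set x | t < f x].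
Proof.
move=> mf; rewrite (_ : [set x | _] = f @^-1` `]t, +oo[).
  by rewrite -[X in measurable X]setTI; apply: mf => //; exact: measurable_itv.
by apply/seteqP; split => x /=; rewrite in_itv/= andbT.
Qed.

Lemma pr_le (A B : set Omega) : measurable A -> measurable B -> A `<=` B -> pr A <= pr B.
Proof.
move=> mA mB AB; rewrite fine_le ?fin_num_measure//.
by apply: le_measure => //; rewrite inE.
Qed.

Lemma pr_leU (A B C : set Omega) : measurable A -> measurable B -> measurable C ->
  A `<=` B `|` C -> pr A <= pr B + pr C.
Proof.
move=> mA mB mC AB.
rewrite -fineD ?fin_num_measure// fine_le ?fin_num_measure//.
  by rewrite fin_numD !fin_num_measure.
apply: le_trans (measureU2 P mB mC).
by apply: le_measure; rewrite ?inE//; exact: measurableU.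
Qed.

Lemma markov_ge f t : Int f -> (forall x, 0 <= f x) -> 0 < t ->
  t * pr [set x | t <= f x] <= E f.
Proof.
move=> If f0 t0.
have mA := measurable_ge t (Int_meas If).
rewrite -Ex_ind// -ExZ; last first.
  by have := Int_indM mA (Int_cst P 1); under eq_fun do rewrite mulr1.
apply: Ex_le => //.
  by apply: IntZ; have := Int_indM mA (Int_cst P 1); under eq_fun do rewrite mulr1.
move=> x; rewrite indicE; case: (boolP (_ \in _)) => [|_].
  by rewrite inE /= mulr1.
by rewrite mulr0.
Qed.

(** A path that does not converge is not Cauchy: for some i it belongs, for every N, to the event
    that the oscillation after N reaches 1/(i+1). The hypothesis makes the intersection over N of
    these events null. *)
Lemma cvg_criterion (g : nat -> Omega -> R) :
  (forall n, measurable_fun setT (g n)) ->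
  (forall t e : R, 0 < t -> 0 < e -> exists N, forall M,
     pr [set x | t <= mx (tail (g ^~ x) N) M] <= e) ->
  \forall x \ae P, cvgn (g ^~ x).
Proof.
move=> mg H.
pose A i N M := [set x | i.+1%:R^-1 <= mx (tail (g ^~ x) N) M].
have mA i N M : measurable (A i N M).
  apply: measurable_ge; apply: (@measurable_mx _ _ _ (fun n x => g (maxn n N) x - g N x)).
  by move=> k _; apply: measurable_funB.
have A_nd i N : nondecreasing_seq (A i N).
  move=> m n mn; apply/subsetPset => x; rewrite /A /= => /le_trans; apply.
  exact: mx_mono.
have mB i N : measurable (\bigcup_M A i N M) by exact: bigcupT_measurable.
have C0 i : P (\bigcap_N \bigcup_M A i N M) = 0%E.
  have mC : measurable (\bigcap_N \bigcup_M A i N M) by exact: bigcapT_measurable.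
  rewrite -[LHS]fineK ?fin_num_measure//; congr EFin.
  apply/eqP; rewrite eq_le fine_ge0 ?measure_ge0// andbT.
  apply/ler_addgt0Pl => e e0; rewrite addr0.
  have i0 : 0 < i.+1%:R^-1 :> R by rewrite invr_gt0.
  have [N HN] := H _ _ i0 e0.
  apply: (@le_trans _ _ (pr (\bigcup_M A i N M))).
    by apply: pr_le => // x Cx; exact: Cx.
  have cv := nondecreasing_cvg_mu (mA i N) (mB i N) (A_nd i N) (mu := P).
  have {}cv : pr (A i N M) @[M --> \oo] --> pr (\bigcup_M A i N M).
    by apply: fine_cvg; rewrite fineK ?fin_num_measure.
  exact: cvgn_le cv HN.
exists (\bigcup_i \bigcap_N \bigcup_M A i N M); split.
- by apply: bigcupT_measurable => i; exact: bigcapT_measurable.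
- have /negligibleP : P.-negligible (\bigcup_i \bigcap_N \bigcup_M A i N M).
    by apply: negligible_bigcup => i; apply/negligibleP; [exact: bigcapT_measurable|exact: C0].
  by apply; apply: bigcupT_measurable => i; exact: bigcapT_measurable.
move=> x /= ncx; apply: contrapT => nB; apply: ncx.
apply/cauchy_cvgP/cauchy_exP => e e0.
have [i ie] : exists i, i.+1%:R^-1 < e.
  by have [i _ /(_ i (leqnn i)) h] := near_infty_natSinv_lt (PosNum e0); exists i.
have : ~ (\bigcap_N \bigcup_M A i N M) x by move=> h; apply: nB; exists i.
rewrite -[X in X -> _]/((~` (\bigcap_N \bigcup_M A i N M)) x) setC_bigcap => -[N _ hN].
exists (g N x); exists N => // n /= Nn.
rewrite /ball /= distrC (le_lt_trans _ ie)//.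
rewrite leNgt; apply/negP => h; apply: hN; exists n => //.
rewrite /A /= (le_trans (ltW h))// (le_trans _ (mx_ge _ _))// /tail.
by rewrite (maxn_idPl _).
Qed.

End probability_bounds.

(** * Martingale transforms and their weak type (1,1) bound *)

Section transforms.
Context d (Omega : measurableType d) (R : realType) (P : probability Omega R).
Variable F : nat -> set (set Omega).
Hypothesis HF : is_filtration F.
Notation E := (Ex P).
Notation Int := (Int P).
Notation W n X := (measurable_wrt (F n) X).
Notation pr A := (fine (P A)).
Notation mart := (mart P F).
Implicit Types f g th : nat -> Omega -> R.
Let sF n : sigma_algebra setT (F n) := filt_sigma HF n.
Let mF n : F n `<=` measurable := filt_measurable HF (n := n).
Hint Resolve sF mF : core.

Lemma W_dl n f : (forall n, W n (f n)) -> W n (fun x => dl (f ^~ x) n).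
Proof.
by move=> Wf; apply: measurable_dl => k kn; exact: (W_le HF kn).
Qed.

Lemma W_tr n (th f : nat -> Omega -> R) : (forall n, W n (f n)) -> (forall n, W n (th n)) ->
  W n (fun x => tr (th ^~ x) (f ^~ x) n).
Proof.
move=> Wf Wth; rewrite /tr.
have H (k : 'I_n) : W n (fun x => th k x * dl (f ^~ x) k.+1).
  apply: measurable_funM; first exact: (W_le HF (ltnW (ltn_ord k))).
  by apply: (W_le HF (ltn_ord k)); exact: W_dl.
exact: measurable_sum.
Qed.

(** Only the integrability of each term is asked, since the coefficients of a paraproduct are
    unbounded. *)
Lemma mart_trans th f : mart f -> (forall n, W n (th n)) ->
  (forall n, Int (fun x => th n x * dl (f ^~ x) n.+1)) ->
  mart (fun n x => tr (th ^~ x) (f ^~ x) n).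
Proof.
move=> mf Wth Ith; have [Wf If Ef] := mf; split.
- by move=> n; exact: W_tr.
- by move=> n; exact: Int_sum.
- move=> n A FA.
  transitivity (E (fun x => (\1_A x * th n x) * dl (f ^~ x) n.+1)).
    apply: eq_Ex => x; rewrite -mulrA; congr (_ * _).
    by rewrite /tr big_ord_recr /= addrAC subrr add0r.
  apply: (mart_mul HF mf).
    apply: measurable_funM; last exact: Wth.
    exact: (wrt_indic (sF n) FA).
  under eq_fun do rewrite -mulrA.
  by apply: Int_indM => //; exact: mF FA.
Qed.

Lemma mart_tr c th f : mart f -> (forall n, W n (th n)) -> (forall n x, `|th n x| <= c) ->
  mart (fun n x => tr (th ^~ x) (f ^~ x) n).
Proof.
move=> mf Wth hc; apply: mart_trans => // n.
apply: (@IntMb _ _ _ _ c) (mart_Int_dl n.+1 mf) _ (hc n).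
exact: (W_meas HF (Wth n)).
Qed.

Lemma mart_scale c f : mart f -> mart (fun n x => c * f n x).
Proof.
move=> [Wf If Ef]; split.
- by move=> n; apply: measurable_funM => //; exact: Wf.
- by move=> n; exact: IntZ.
- move=> n A FA; under eq_Ex do rewrite -mulrBr mulrCA.
  rewrite ExZ ?Ef ?mulr0//; apply: Int_indM; first exact: mF FA.
  exact: IntB.
Qed.

Lemma mart_sub f g : mart f -> mart g -> mart (fun n x => f n x - g n x).
Proof.
move=> [Wf If Ef] [Wg Ig Eg]; split.
- by move=> n; apply: measurable_funB; [exact: Wf|exact: Wg].
- by move=> n; exact: IntB.
- move=> n A FA.
  transitivity (E (fun x => \1_A x * (f n.+1 x - f n x) - \1_A x * (g n.+1 x - g n x))).
    by apply: eq_Ex => x; ring.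
  rewrite ExB ?Ef ?Eg ?subrr//; apply: Int_indM; solve [exact: mF FA|exact: IntB].
Qed.

Lemma tail_tr (a : nat -> R) N n : tail a N n = tr (fun k => (N <= k)%N%:R) a n.
Proof.
elim: n => [|n IH]; first by rewrite /tail /tr big_ord0 max0n subrr.
by rewrite dlS IH dl_tail ltnS /tr big_ord_recr /=; case: ifP; rewrite ?mul1r ?mul0r.
Qed.

Lemma mart_tail f N : mart f -> mart (fun n x => tail (f ^~ x) N n).
Proof.
move=> mf; rewrite (_ : (fun n x => _) = (fun n x => tr (fun k => (N <= k)%N%:R) (f ^~ x) n)).
  apply: (@mart_tr 1 (fun k _ => (N <= k)%N%:R)) => // [n|n x].
    exact: measurable_cst.
  by case: (N <= n)%N; rewrite ?normr1 ?normr0.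
by apply/funext => n; apply/funext => x; exact: tail_tr.
Qed.

Lemma E_sq_tail f c : mart f -> (forall n, E (fun x => sq (f ^~ x) n) <= c) ->
  forall e, 0 < e -> exists N, forall M, E (fun x => sq (tail (f ^~ x) N) M) <= e.
Proof.
move=> mf hc e e0; set s := fun n => E (fun x => sq (f ^~ x) n).
have Is n := mart_Int_sq n mf.
have c0 : 0 <= c by apply: le_trans (hc 0%N); apply: Ex_ge0 => x; exact: sq_ge0.
have s_nd (m n : nat) : (m <= n)%N -> s m <= s n.
  by move=> mn; apply: Ex_le => // x; exact: sq_mono.
(* [del] makes the first term of [sq_tail] at most e / 2; N is then a time at which E S_N(f) is
   within [eta] of its supremum, which bounds the second term. Adding 1 to c avoids a division by
   0. *)
pose del := e / (2 * (c + 1)).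
have del0 : 0 < del by rewrite divr_gt0// mulr_gt0//; lra.
have delE : del * c <= e / 2.
  rewrite /del mulrAC ler_pdivrMr; last by rewrite mulr_gt0//; lra.
  nra.
pose eta := del * (e / 2).
have eta0 : 0 < eta by rewrite mulr_gt0//; lra.
have hs : has_sup (range s).
  by split; [exists (s 0%N), 0%N|exists c => _ [n _ <-]; exact: hc].
have [_ [N _ <-] hN] := sup_adherent eta0 hs.
exists N => M; have hM : s (maxn M N) <= sup (range s).
  by apply: sup_upper_bound => //; exists (maxn M N).
apply: (@le_trans _ _ (del * s (maxn M N) + (s (maxn M N) - s N) / del)).
  rewrite -ExB// -[X in _ + X]mulrC -!ExZ//; last exact: IntB.
  rewrite -ExD//; try exact/IntZ; last exact/IntZ/IntB.
  apply: Ex_le.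
  - exact: mart_Int_sq _ (mart_tail _ mf).
  - by apply: IntD; [exact: IntZ|apply/IntZ/IntB].
  - by move=> x; rewrite [_^-1 * _]mulrC; exact: sq_tail.
have : del * s (maxn M N) <= e / 2.
  by apply: le_trans delE; rewrite ler_wpM2l ?(ltW del0)//; exact: hc.
have : (s (maxn M N) - s N) / del <= e / 2.
  by rewrite ler_pdivrMr// mulrC -/eta; lra.
lra.
Qed.

Lemma pr_tail f c : mart f -> (forall n, E (fun x => sq (f ^~ x) n) <= c) ->
  forall t e, 0 < t -> 0 < e -> exists N, forall M,
  pr [set x | t <= mx (tail (f ^~ x) N) M] <= e.
Proof.
move=> mf hc t e t0 e0.
have [|N HN] := E_sq_tail mf hc (e := t * e / 50); first by rewrite divr_gt0// mulr_gt0.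
exists N => M; have mt := mart_tail N mf.
have [_ It _] := mt.
rewrite -(ler_pM2l t0); apply: le_trans (markov_ge (mart_Int_mx M It) _ t0) _.
  by move=> x; exact: mx_ge0.
apply: le_trans (davis_M HF M mt) _; have := HN M; lra.
Qed.

Lemma mart_cvg f c : mart f -> (forall n, E (fun x => sq (f ^~ x) n) <= c) ->
  \forall x \ae P, cvgn (f ^~ x).
Proof.
move=> mf hc; apply: cvg_criterion; last exact: pr_tail mf hc.
by move=> n; case: mf => Wf _ _; exact: (W_meas HF (Wf n)).
Qed.

(** By [burk_major] and [burk_lb] the indicator of the event is at most [burk] plus 2 |g N|, and by
    [burk_path] the first summand is at most a sum of zero expectation. *)
Lemma weak11_one th g N : mart g -> (forall n, W n (th n)) -> (forall n x, `|th n x| <= 1) ->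
  pr [set x | 1 <= `|tr (th ^~ x) (g ^~ x) N| ] <= 2 * E (fun x => `|g N x|).
Proof.
move=> mg Wth th1; have [Wg Ig Eg] := mg.
have mh := mart_tr mg Wth th1; have [Wh Ih Eh] := mh.
have mA : measurable [set x | 1 <= `|tr (th ^~ x) (g ^~ x) N| ].
  by apply: measurable_ge; apply: measurable_norm; exact: (W_meas HF (Wh N)).
pose h n x := burkX (g n x) (tr (th ^~ x) (g ^~ x) n) +
  burkY (g n x) (tr (th ^~ x) (g ^~ x) n) * th n x.
have Wif n (p q : Omega -> R) : W n p -> W n q ->
  W n (fun x => if `|g n x| + `|tr (th ^~ x) (g ^~ x) n| <= 1 then p x else q x).
  move=> Wp Wq; apply: measurable_fun_ifT => //.
  apply: measurable_fun_ler; last exact: measurable_cst.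
  by apply: measurable_funD; apply: measurable_norm; [exact: Wg|exact: Wh].
have Wsg n : W n (fun x => Num.sg (g n x)).
  rewrite (_ : (fun x => _) = (fun x => g n x / `|g n x|)).
    apply: measurable_funM; first exact: Wg.
    by apply/measurable_invr/measurable_norm; exact: Wg.
  apply/funext => x; have [->|gx] := eqVneq (g n x) 0; first by rewrite sgr0 mul0r.
  by rewrite {2}[g n x]numEsg mulfK// normr_eq0.
have WXn n : W n (h n).
  apply: measurable_funD; last apply: measurable_funM; last exact: Wth.
    apply: (Wif n (fun x => - 2 * g n x) (fun x => - 2 * Num.sg (g n x))).
      by apply: measurable_funM => //; exact: Wg.
    by apply: measurable_funM => //; exact: Wsg.
  apply: (Wif n (fun x => 2 * tr (th ^~ x) (g ^~ x) n) (fun=> 0)); last exact: measurable_cst.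
  by apply: measurable_funM => //; exact: Wh.
have hc n x : `|h n x| <= 4.
  rewrite (le_trans (ler_normD _ _))// normrM.
  have := burkX_bd (g n x) (tr (th ^~ x) (g ^~ x) n).
  have := burkY_bd (g n x) (tr (th ^~ x) (g ^~ x) n).
  have := th1 n x; have := normr_ge0 (th n x).
  have := normr_ge0 (burkY (g n x) (tr (th ^~ x) (g ^~ x) n)).
  nra.
have [IS ES] := mart_sum_mul HF N mg WXn hc.
have Ig2 : Int (fun x => 2 * `|g N x|) by apply/IntZ/Int_norm.
rewrite -ExZ; last exact: Int_norm.
rewrite -[leRHS]addr0 -[X in _ + X]ES -ExD// -Ex_ind//.
apply: Ex_le; [|exact: IntD|].
  by have := Int_indM mA (Int_cst P 1); under eq_fun do rewrite mulr1.
move=> x.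
have hB : burk (g N x) (tr (th ^~ x) (g ^~ x) N) <= \sum_(k < N) h k x * dl (g ^~ x) k.+1.
  exact: (@burk_path _ (th ^~ x) (g ^~ x) N (th1 ^~ x)).
rewrite indicE; case: (boolP (_ \in _)) => [|_].
  rewrite inE /= mulr1n => /(burk_major (g N x)); lra.
rewrite mulr0n; have := burk_lb (g N x) (tr (th ^~ x) (g ^~ x) N); lra.
Qed.

(** Rescaling g by 1/t and stopping the transform at level t reduce the maximum to the value at time
    N. *)
Lemma weak11 th g N t : mart g -> (forall n, W n (th n)) -> (forall n x, `|th n x| <= 1) ->
  0 < t ->
  t * pr [set x | t <= mx (tr (th ^~ x) (g ^~ x)) N] <= 2 * E (fun x => `|g N x|).
Proof.
move=> mg Wth th1 t0; have [Wg Ig Eg] := mg.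
pose th' k x := stop t (th ^~ x) (g ^~ x) k.
have th'1 n x : `|th' n x| <= 1 by rewrite /th' /stop; case: ifP => //; rewrite normr0.
have Wth' n : W n (th' n).
  apply: measurable_fun_ifT => //; last exact: Wth.
  apply: measurable_fun_ltr; last exact: measurable_cst.
  apply: (@measurable_mx _ (g_sigma_algebraType (F n)) _ (fun k x => tr (th ^~ x) (g ^~ x) k)) => k kn.
  have := @W_tr k _ _ Wg Wth; exact: (W_le HF kn).
have mg' := mart_scale t^-1 mg.
have := weak11_one N mg' Wth' th'1.
have -> : E (fun x => `|t^-1 * g N x|) = t^-1 * E (fun x => `|g N x|).
  rewrite -ExZ; last exact: Int_norm.
  by apply: eq_Ex => x; rewrite normrM gtr0_norm ?invr_gt0.
move=> h.
rewrite -ler_pdivlMl// mulrCA; apply: le_trans h.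
have mh n : measurable_fun setT (fun x => tr (th ^~ x) (g ^~ x) n).
  exact: (W_meas HF (@W_tr n _ _ Wg Wth)).
have [Wh _ _] := mart_tr mg' Wth' th'1.
apply: pr_le.
- apply: measurable_ge.
  by apply: (@measurable_mx _ _ _ (fun k x => tr (th ^~ x) (g ^~ x) k)) => k _; exact: mh.
- by apply: measurable_ge; apply: measurable_norm; exact: (W_meas HF (Wh N)).
move=> x /= /(stop_tr t (th ^~ x) (g ^~ x) N).2.
have -> : tr (th' ^~ x) (fun n => t^-1 * g n x) N = t^-1 * tr (stop t (th ^~ x) (g ^~ x)) (g ^~ x) N.
  rewrite /tr mulr_sumr; apply: eq_bigr => k _; rewrite mulrCA; congr (_ * _).
  by rewrite /dl mulrBr.
by rewrite normrM gtr0_norm ?invr_gt0// ler_pdivlMl// mulr1.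
Qed.

End transforms.

(** * Path inequalities behind the John-Nirenberg inequality *)

Section bmo_paths.
Variable R : realType.
Implicit Types (a b A : nat -> R).

Lemma mx_tail a N M : mx (tail a N) M <= 2 * mx a (maxn M N).
Proof.
apply: mx_le => k kM; rewrite /tail (le_trans (ler_normB _ _))//.
have h1 : `|a (maxn k N)| <= mx a (maxn M N).
  by apply: le_trans (mx_ge _ _) (mx_mono _ _); rewrite geq_max !leq_max kM leqnn orbT.
have h2 : `|a N| <= mx a (maxn M N).
  by apply: le_trans (mx_ge _ _) (mx_mono _ _); rewrite leq_maxr.
lra.
Qed.

Lemma mxD_le a b (c : nat -> R) M : (forall n, a n = b n + c n) -> mx a M <= mx b M + mx c M.
Proof.
move=> h; apply: mx_le => k kM; rewrite h (le_trans (ler_normD _ _))// lerD//;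
  exact: le_trans (mx_ge _ _) (mx_mono _ kM).
Qed.

Lemma mx_tail0 a n k : (k <= n)%N -> mx (tail a n) k = 0.
Proof.
move=> kn; apply/eqP; rewrite eq_le mx_ge0 andbT; apply: mx_le => j jk.
by rewrite /tail (maxn_idPr _) ?subrr ?normr0// (leq_trans jk).
Qed.

(** The function u -> (u - c) |u - c| has derivative 2 |u - c|, which on [u, v] is at most 2 (|c -
    v| + (v - u)). *)
Lemma jn_step (c u v : R) : u <= v ->
  (v - c) * `|v - c| - (u - c) * `|u - c| <= 2 * ((v - u) * (`|c - v| + (v - u))).
Proof.
move=> uv; rewrite [`|c - v|]distrC.
have -> : v - u = (v - c) - (u - c) by lra.
have : u - c <= v - c by lra.
move: (v - c) (u - c) => p q qp; have := sqr_ge0 (p - q).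
have [p0|p0] := leP 0 p; have [q0|q0] := leP 0 q.
- rewrite (ger0_norm p0) (ger0_norm q0); nra.
- rewrite (ger0_norm p0) (ltr0_norm q0).
  have : 0 <= p * - q by rewrite mulr_ge0// oppr_ge0 ltW.
  have := sqr_ge0 q; have := sqr_ge0 p; nra.
- lra.
- rewrite (ltr0_norm p0) (ltr0_norm q0); nra.
Qed.

(** The running maximum grows only when it becomes |a (k+1)|, and its distance to |a N| is then at
    most |a N - a (k+1)|, an oscillation that BMO controls conditionally. [jn_step] is summed with c
    = |a N|, and (m - c)^2 + c^2 >= m^2 / 2 concludes. *)
Lemma jn_path a B N : a 0%N = 0 -> (forall k, `|dl a k| <= B) ->
  mx a N ^+ 2 <= 4 * \sum_(k < N) (mx a k.+1 - mx a k) * (`|a N - a k.+1| + B).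
Proof.
move=> a0 aB; set c := `|a N|.
have step n : (mx a n - c) * `|mx a n - c| - (0 - c) * `|0 - c| <=
    2 * \sum_(k < n) (mx a k.+1 - mx a k) * (`|a N - a k.+1| + B).
  elim: n => [|n IH].
    by rewrite big_ord0 /= a0 normr0 subrr mulr0.
  rewrite big_ord_recr /= -/(mx a n.+1).
  have hm : mx a n <= mx a n.+1 by exact: mx_mono.
  have := jn_step c hm.
  suff : (mx a n.+1 - mx a n) * (`|c - mx a n.+1| + (mx a n.+1 - mx a n)) <=
    (mx a n.+1 - mx a n) * (`|a N - a n.+1| + B) by rewrite /=; lra.
  rewrite /=; case: (leP (mx a n) `|a n.+1|) => h; last by rewrite subrr !mul0r.
  apply: ler_wpM2l; first by rewrite subr_ge0.
  apply: lerD; first exact: ler_dist_dist.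
  have := mx_ge a n; have := aB n.+1; rewrite (dlS a n).
  have := ler_normD (a n) (dl a n.+1); lra.
have hc : c <= mx a N by exact: mx_ge.
have c0 : 0 <= c by exact: normr_ge0.
have := step N; rewrite sub0r normrN (ger0_norm c0) ger0_norm ?subr_ge0//.
have := sqr_ge0 (mx a N - 2 * c); nra.
Qed.

Lemma sqr_path a n : a n ^+ 2 = qv a n + 2 * \sum_(k < n) a k * dl a k.+1.
Proof.
elim: n => [|n IH]; first by rewrite big_ord0 qv0 mulr0 addr0.
rewrite (dlS a n) sqrrD IH qvS big_ord_recr /= mulr2n; ring.
Qed.

Lemma sum_dl A n : \sum_(j < n.+1) dl A j = A n.
Proof.
elim: n => [|n IH]; first by rewrite big_ord1 /dl subr0.
by rewrite big_ord_recr /= IH [RHS]dlS.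
Qed.

(** The bracketed factor is the sum of dl a k ^ 2 over j <= k <= N. Abel summation moves the weight
    to its increments dl A j, known at time j, where [bmo_qv] can be applied. *)
Lemma abel_path A a N :
  \sum_(j < N.+1) dl A j * (qv a N - qv a j + dl a j ^+ 2) =
  \sum_(k < N.+1) A k * dl a k ^+ 2.
Proof.
elim: N => [|N IH].
  by rewrite !big_ord1 subrr add0r /dl !subr0.
have e : A N.+1 * dl a N.+1 ^+ 2 = A N * dl a N.+1 ^+ 2 + dl A N.+1 * dl a N.+1 ^+ 2.
  by rewrite -mulrDl -dlS.
rewrite big_ord_recr [RHS]big_ord_recr /= -IH subrr add0r e addrA; congr (_ + _).
rewrite -(sum_dl A N) mulr_suml -big_split /=; apply: eq_bigr => j _.
rewrite qvS; ring.
Qed.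

End bmo_paths.

(** * Almost sure convergence of transforms of closed martingales *)

Section transform_convergence.
Context d (Omega : measurableType d) (R : realType) (P : probability Omega R).
Variable F : nat -> set (set Omega).
Hypothesis HF : is_filtration F.
Notation E := (Ex P).
Notation W n X := (measurable_wrt (F n) X).
Notation pr A := (fine (P A)).
Notation mart := (mart P F).
Implicit Types f g u th : nat -> Omega -> R.

(** The transform of the approximation u has small tails by Davis' inequality, while that of g - u
    is small in probability by the weak type bound. *)
Lemma tr_cvg th g : mart g -> (forall n, W n (th n)) -> (forall n x, `|th n x| <= 1) ->
  (forall e : R, 0 < e -> exists u c, [/\ mart u, forall n, E (fun x => sq (u ^~ x) n) <= c &
     forall n, E (fun x => `|g n x - u n x|) <= e]) ->
  \forall x \ae P, cvgn (tr (th ^~ x) (g ^~ x)).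
Proof.
move=> mg Wth th1 H.
have mT f : mart f -> forall n, measurable_fun setT (fun x => tr (th ^~ x) (f ^~ x) n).
  by move=> [Wf _ _] n; exact: (W_meas HF (@W_tr _ _ _ _ HF n _ _ Wf Wth)).
apply: (@cvg_criterion _ _ _ _ (fun n x => tr (th ^~ x) (g ^~ x) n)); first exact: mT.
move=> t e t0 e0.
(* The 16 collects the threshold t / 4 (a tail is at most twice the maximum), the constant 2 of
   [weak11] and the target probability e / 2. *)
have [|u [c [mu uc gu]]] := H (t * e / 16); first by rewrite divr_gt0// mulr_gt0.
have mtu := mart_tr HF mu Wth th1.
have sc n : E (fun x => sq (tr (th ^~ x) (u ^~ x)) n) <= c.
  apply: le_trans (uc n).
  apply: Ex_le; [exact: (mart_Int_sq n mtu)|exact: (mart_Int_sq n mu)|].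
  by move=> x; apply: sq_tr => k; exact: th1.
have t20 : 0 < t / 2 by lra. have e20 : 0 < e / 2 by lra.
have [N HN] := pr_tail HF mtu sc t20 e20.
exists N => M.
have mgu := mart_sub HF mg mu.
have := @weak11 _ _ _ _ _ HF _ _ (maxn M N) (t / 4) mgu Wth th1.
move=> /(_ ltac:(lra)) h2.
have h3 := gu (maxn M N).
have mtail f n : mart f ->
   measurable_fun setT (fun x => mx (tail (tr (th ^~ x) (f ^~ x)) N) n).
  move=> mf; apply: (@measurable_mx _ _ _ (fun k x => tr (th ^~ x) (f ^~ x) (maxn k N) - tr (th ^~ x) (f ^~ x) N)).
  by move=> k _; apply: measurable_funB; exact: mT.
have mmT f n : mart f -> measurable_fun setT (fun x => mx (tr (th ^~ x) (f ^~ x)) n).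
  by move=> mf; apply: (@measurable_mx _ _ _ (fun k x => tr (th ^~ x) (f ^~ x) k)) => k _; exact: mT.
apply: le_trans (@pr_leU _ _ _ P _ [set x | t / 2 <= mx (tail (tr (th ^~ x) (u ^~ x)) N) M]
  [set x | t / 4 <= mx (tr (th ^~ x) (fun n => g n x - u n x)) (maxn M N)] _ _ _ _) _.
- by apply: measurable_ge; exact: mtail.
- by apply: measurable_ge; exact: mtail.
- by apply: measurable_ge; exact: (mmT (fun n x => g n x - u n x)).
- move=> x /=; rewrite -/(tr (th ^~ x) (g ^~ x)) => h.
  have [h4|h4] := leP (t / 2) (mx (tail (tr (th ^~ x) (u ^~ x)) N) M); first by left.
  right.
  have trB n : tr (th ^~ x) (g ^~ x) n = tr (th ^~ x) (u ^~ x) n + tr (th ^~ x) (fun n => g n x - u n x) n.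
    rewrite /tr -big_split; apply: eq_bigr => k _ /=; rewrite /dl -mulrDr; congr (_ * _); ring.
  have := @mxD_le _ (tail (tr (th ^~ x) (g ^~ x)) N) (tail (tr (th ^~ x) (u ^~ x)) N)
    (tail (tr (th ^~ x) (fun n => g n x - u n x)) N) M.
  move=> /(_ ltac:(by move=> n; rewrite /tail !trB; lra)).
  have := mx_tail (tr (th ^~ x) (fun n => g n x - u n x)) N M.
  lra.
have := HN M.
set p1 := pr _; set p2 := pr _ in h2 *; move=> h1.
suff : p2 <= e / 2 by lra.
have : t / 4 * p2 <= t / 4 * (e / 2) by lra.
by rewrite ler_pM2l//; lra.
Qed.

End transform_convergence.

(** * The John-Nirenberg and Fefferman inequalities *)

Section bmo_process.
Context d (Omega : measurableType d) (R : realType) (P : probability Omega R).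
Variable F : nat -> set (set Omega).
Hypothesis HF : is_filtration F.
Notation E := (Ex P).
Notation Int := (Int P).
Notation W n X := (measurable_wrt (F n) X).
Notation mart := (mart P F).
Let sF n : sigma_algebra setT (F n) := filt_sigma HF n.
Let mF n : F n `<=` measurable := filt_measurable HF (n := n).

(* A version of the martingale (E_n b)_n whose jumps are bounded everywhere, and not
   only almost everywhere. *)
Definition bmo_process (B : R) (b : nat -> Omega -> R) :=
  [/\ mart b, forall n x, `|dl (b ^~ x) n| <= B &
   forall m n A, (m <= n)%N -> F m A ->
     E (fun x => \1_A x * `|b n x - b m x|) <= B * E (\1_A)].

Variables (B : R) (b : nat -> Omega -> R).
Hypothesis Hb : bmo_process B b.

Let mb : mart b. Proof. by case: Hb. Qed.
Let Wb n : W n (b n). Proof. by case: mb. Qed.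
Let dlB n x : `|dl (b ^~ x) n| <= B. Proof. by case: Hb. Qed.
Let mbm n : measurable_fun setT (b n). Proof. exact: (W_meas HF (@Wb n)). Qed.

Lemma bmo_ge0 : 0 <= B.
Proof.
have [x _] : [set: Omega] !=set0 by exists point.
exact: le_trans (dlB 0 x).
Qed.

Lemma bmo_bd n x : `|b n x| <= n.+1%:R * B.
Proof.
elim: n => [|n IH]; first by rewrite mul1r; have := dlB 0 x; rewrite /dl subr0.
rewrite [b n.+1 x](dlS (b ^~ x)) (le_trans (ler_normD _ _))//.
have := dlB n.+1 x; move: IH => /=; rewrite -[n.+2%:R]natr1 mulrDl mul1r; lra.
Qed.

Lemma bmo_mx_bd n x : mx (b ^~ x) n <= n.+1%:R * B.
Proof.
apply: mx_le => k kn; apply: le_trans (bmo_bd k x) _.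
by rewrite ler_wpM2r ?bmo_ge0// ler_nat.
Qed.

Lemma bmo_qv_bd n x : qv (b ^~ x) n <= n.+1%:R * B ^+ 2.
Proof.
rewrite /qv -[n.+1 in leRHS]card_ord -sum1_card natr_sum mulr_suml.
apply: ler_sum => k _; rewrite mul1r -(real_normK (num_real (dl _ _))).
by rewrite ler_sqr ?nnegrE ?bmo_ge0.
Qed.

Lemma bmo_osc m n (X : Omega -> R) : (m <= n)%N -> W m X -> (forall x, 0 <= X x) -> Int X ->
  E (fun x => X x * `|b n x - b m x|) <= B * E X.
Proof.
move=> mn WX X0 IX; have [_ Ib _] := mb; have [_ _ Hosc] := Hb.
have bd x : `| `|b n x - b m x| | <= n.+1%:R * B + m.+1%:R * B.
  rewrite normr_id (le_trans (ler_normB _ _))//.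
  by have := bmo_bd n x; have := bmo_bd m x; lra.
have mo : measurable_fun setT (fun x => `|b n x - b m x|).
  by apply: measurable_norm; apply: measurable_funB.
have IXo : Int (fun x => X x * `|b n x - b m x|).
  by under eq_fun do rewrite mulrC; exact: IntMb bd.
have Iosc : Int (fun x => `|b n x - b m x|) by apply: Int_norm; apply: IntB.
rewrite -subr_ge0 -ExZ// -ExB//; last exact: IntZ.
have -> : E (fun x => B * X x - X x * `|b n x - b m x|) =
    E (fun x => X x * (B - `|b n x - b m x|)) by apply: eq_Ex => x; ring.
apply: (Ex_mul_ge0 (sF m) (mF (n := m))) => //.
- by apply: IntB => //; exact: Int_cst.
- move=> A FA; have mA : measurable A := mF FA.
  have I1 : Int (\1_A) by have := Int_indM mA (Int_cst P 1); under eq_fun do rewrite mulr1.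
  have -> : E (fun x => \1_A x * (B - `|b n x - b m x|)) =
      E (fun x => B * \1_A x - \1_A x * `|b n x - b m x|) by apply: eq_Ex => x; ring.
  rewrite ExB; [|exact: IntZ|exact: Int_indM].
  by rewrite ExZ// subr_ge0; exact: Hosc.
- have : Int (fun x => B * X x - X x * `|b n x - b m x|) by apply: IntB => //; exact: IntZ.
  by congr Int; apply/funext => x; ring.
Qed.

Let mxt_bd n N x : `|mx (tail (b ^~ x) n) N| <= 2 * ((maxn N n).+1%:R * B).
Proof.
rewrite ger0_norm ?mx_ge0// (le_trans (mx_tail _ _ _))//.
by rewrite ler_pM2l//; exact: bmo_mx_bd.
Qed.

Let W_mxt n N : (n <= N)%N -> W N (fun x => mx (tail (b ^~ x) n) N).
Proof.
move=> nN; apply: (@measurable_mx _ (g_sigma_algebraType (F N)) _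
   (fun k x => b (maxn k n) x - b n x)) => k kN.
apply: measurable_funB; last exact: (W_le HF nN).
by apply: (W_le HF _ (@Wb _)); rewrite geq_max kN.
Qed.

Let Int_ind (A : set Omega) : measurable A -> Int (\1_A).
Proof. by move=> mA; have := Int_indM mA (Int_cst P 1); under eq_fun do rewrite mulr1. Qed.

(** Integrating [jn_path] gives E 1_A m^2 <= 8 B E 1_A m for the maximal oscillation m, and 8 B m <=
    m^2 / 2 + 32 B^2 allows absorption. So first-order oscillation bounds yield a second-order
    maximal bound. *)
Lemma john_nirenberg n N A : (n <= N)%N -> F n A ->
  E (fun x => \1_A x * mx (tail (b ^~ x) n) N ^+ 2) <= 64 * B ^+ 2 * E (\1_A).
Proof.
move=> nN FA; have mA : measurable A := mF FA; have B0 := bmo_ge0.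
pose a x := tail (b ^~ x) n.
pose Y k x := \1_A x * (mx (a x) k.+1 - mx (a x) k) : R.
have mmx k : measurable_fun setT (fun x => mx (a x) k).
  apply: (@measurable_mx _ _ _ (fun k x => b (maxn k n) x - b n x)) => j _.
  exact: measurable_funB.
have Imx k : Int (fun x => mx (a x) k) by apply: Int_bd (mmx k) (mxt_bd n k).
have Imx2 k : Int (fun x => mx (a x) k ^+ 2).
  by under eq_fun do rewrite expr2; exact: IntMb (mxt_bd n k).
have Y0 k x : 0 <= Y k x.
  by rewrite mulr_ge0 ?indicE// subr_ge0; exact: mx_mono.
have IY k : Int (Y k) by apply: Int_indM => //; exact: IntB.
have mo k : measurable_fun setT (fun x => `|a x N - a x k.+1|).
  by apply: measurable_norm; apply: measurable_funB; apply: measurable_funB.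
have bo k x : `| `|a x N - a x k.+1| | <= (maxn N n).+1%:R * B + (maxn k.+1 n).+1%:R * B.
  rewrite normr_id /a /tail opprB addrA subrK (le_trans (ler_normB _ _))//.
  by have := bmo_bd (maxn N n) x; have := bmo_bd (maxn k.+1 n) x; lra.
have IYo k : Int (fun x => Y k x * `|a x N - a x k.+1|).
  by under eq_fun do rewrite mulrC; exact: IntMb (bo k).
(* The increment [Y k] of the maximum is known at time k+1, from which the expected oscillation up
   to N is at most B; before time n it vanishes. *)
have key k : (k < N)%N -> E (fun x => Y k x * `|a x N - a x k.+1|) <= B * E (Y k).
  move=> kN; case: (leqP n k) => [nk|kn].
    have WY : W k.+1 (Y k).
      apply: measurable_funM.
        by apply: (W_le HF (leqW nk)); exact: (wrt_indic (sF n) FA).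
      apply: measurable_funB; first by apply: W_mxt; exact: leqW.
      by apply: (W_le HF (leqnSn k)); exact: W_mxt.
    have -> : E (fun x => Y k x * `|a x N - a x k.+1|) = E (fun x => Y k x * `|b N x - b k.+1 x|).
      apply: eq_Ex => x; rewrite /a /tail (maxn_idPl nN) (maxn_idPl (leqW nk)).
      by rewrite opprB addrA subrK.
    exact: bmo_osc.
  have Yz x : Y k x = 0 by rewrite /Y /a !mx_tail0 ?subrr ?mulr0// ltnW.
  have -> : E (fun x => Y k x * `|a x N - a x k.+1|) = 0.
    by rewrite -(Ex_cst P 0); apply: eq_Ex => x; rewrite Yz mul0r.
  by rewrite mulr_ge0//; apply: Ex_ge0.
have h1 : E (fun x => \1_A x * mx (a x) N ^+ 2) <= 8 * B * E (fun x => \1_A x * mx (a x) N).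
  apply: (@le_trans _ _ (E (fun x => 4 * \sum_(k < N) (Y k x * `|a x N - a x k.+1| + B * Y k x)))).
    apply: Ex_le.
    - exact: Int_indM.
    - by apply/IntZ/Int_sum => k _; apply: IntD => //; exact: IntZ.
    move=> x; have := @jn_path _ (a x) B N.
    have a0 : a x 0%N = 0 by rewrite /a /tail max0n subrr.
    move=> /(_ a0) h.
    have {}h : mx (a x) N ^+ 2 <= 4 * \sum_(k < N) (mx (a x) k.+1 - mx (a x) k) * (`|a x N - a x k.+1| + B).
      apply: h => k; rewrite dl_tail; case: ifP => // _; by rewrite normr0.
    have i0 : 0 <= \1_A x :> R by rewrite indicE.
    apply: le_trans (ler_wpM2l i0 h) _.
    rewrite mulrCA ler_pM2l// mulr_sumr; apply: ler_sum => k _.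
    by rewrite /Y mulrDr [B * _]mulrC mulrDr !mulrA.
  rewrite ExZ; last by apply/Int_sum => k _; apply: IntD => //; exact: IntZ.
  rewrite Ex_sum; last by move=> k _; apply: IntD => //; exact: IntZ.
  have -> : E (fun x => \1_A x * mx (a x) N) = \sum_(k < N) E (Y k).
    rewrite -Ex_sum//; apply: eq_Ex => x; rewrite /Y -mulr_sumr; congr (_ * _).
    elim: (N) => [|M IH]; first by rewrite big_ord0 /a mx_tail0.
    by rewrite big_ord_recr -IH /= addrC subrK.
  rewrite -mulrA (_ : 8 = 4 * 2) -?mulrA; last by rewrite -natrM.
  rewrite ler_pM2l// !mulr_sumr; apply: ler_sum => k _.
  rewrite ExD//; last exact: IntZ.
  rewrite ExZ//; have := key k (ltn_ord k); lra.
have h2 : 8 * B * E (fun x => \1_A x * mx (a x) N) <=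
    2^-1 * E (fun x => \1_A x * mx (a x) N ^+ 2) + 32 * B ^+ 2 * E (\1_A).
  have I1 := Int_indM mA (Imx N); have I2 := Int_indM mA (Imx2 N); have I3 := Int_ind mA.
  rewrite -!ExZ// -ExD; [|exact: IntZ|exact: IntZ].
  apply: Ex_le; [exact: IntZ|by apply: IntD; exact: IntZ|].
  move=> x; have i0 : 0 <= \1_A x :> R by rewrite indicE.
  have := sqr_ge0 (mx (a x) N - 8 * B); nra.
lra.
Qed.

(** The quadratic variation of the tail is its final square minus cross terms of zero expectation,
    hence 64 B^2 by [john_nirenberg]; the jump at time n adds B^2. *)
Lemma bmo_qv n N A : (n <= N)%N -> F n A ->
  E (fun x => \1_A x * (qv (b ^~ x) N - qv (b ^~ x) n + dl (b ^~ x) n ^+ 2)) <=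
  65 * B ^+ 2 * E (\1_A).
Proof.
move=> nN FA; have mA : measurable A := mF FA; have B0 := bmo_ge0.
pose a x := tail (b ^~ x) n.
have mta := mart_tail HF n mb.
have mmx k : measurable_fun setT (fun x => mx (a x) k).
  apply: (@measurable_mx _ _ _ (fun k x => b (maxn k n) x - b n x)) => j _.
  exact: measurable_funB.
have Imx2 k : Int (fun x => mx (a x) k ^+ 2).
  under eq_fun do rewrite expr2; apply: IntMb (mxt_bd n k) => //.
  exact: Int_bd (mmx k) (mxt_bd n k).
have ma k : measurable_fun setT (fun x => a x k) by apply: measurable_funB.
have abd k x : `|a x k| <= 2 * ((maxn k n).+1%:R * B).
  by apply: le_trans (mx_ge _ _) _; apply: le_trans (ler_norm _) (mxt_bd n k x).
have Ic k : Int (fun x => a x k * dl (a x) k.+1).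
  by apply: IntMb (abd k) => //; exact: (mart_Int_dl _ mta).
have Ec k : E (fun x => (\1_A x * a x k) * dl (a x) k.+1) = 0.
  apply: (mart_mul HF mta).
    case: (leqP n k) => nk.
      apply: measurable_funM; first by apply: (W_le HF nk); exact: (wrt_indic (sF n) FA).
      by case: mta => Wa _ _; exact: Wa.
    rewrite (_ : (fun x => _) = cst 0); first exact: measurable_cst.
    by apply/funext => x; rewrite /a /tail (maxn_idPr (ltnW nk)) subrr mulr0.
  by under eq_fun do rewrite -mulrA; exact: Int_indM.
have I1 := Int_ind mA.
have IS : Int (fun x => \1_A x * \sum_(k < N) a x k * dl (a x) k.+1).
  by apply: Int_indM => //; exact: Int_sum.
have ES : E (fun x => \1_A x * \sum_(k < N) a x k * dl (a x) k.+1) = 0.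
  under eq_Ex do rewrite mulr_sumr.
  rewrite Ex_sum; last by move=> k _; exact: Int_indM.
  rewrite big1// => k _; rewrite -(Ec k).
  by apply: eq_Ex => x; rewrite mulrA.
have h := john_nirenberg nN FA.
have IJ := Int_indM mA (Imx2 N).
apply: (@le_trans _ _ (E (fun x => \1_A x * mx (a x) N ^+ 2 + (B ^+ 2 * \1_A x -
   2 * (\1_A x * \sum_(k < N) a x k * dl (a x) k.+1))))); last first.
  rewrite ExD//; last by apply: IntB; exact: IntZ.
  rewrite ExB ?ExZ//; [|exact: IntZ|exact: IntZ].
  rewrite ES; move: h; rewrite -/a; lra.
apply: Ex_le.
- apply: Int_indM => //; apply: (@Int_bd _ _ _ _ (N.+1%:R * B ^+ 2 + n.+1%:R * B ^+ 2 + B ^+ 2)).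
    apply: measurable_funD; first by apply: measurable_funB; apply: measurable_qv.
    by apply: measurable_funX; exact: measurable_dl.
  move=> x; have h1 := bmo_qv_bd N x; have h2 := bmo_qv_bd n x.
  have h3 : dl (b ^~ x) n ^+ 2 <= B ^+ 2.
    by rewrite -(real_normK (num_real (dl _ _))) ler_sqr ?nnegrE.
  have := qv_ge0 (b ^~ x) N; have := qv_ge0 (b ^~ x) n; have := sqr_ge0 (dl (b ^~ x) n).
  by move=> h4 h5 h6; rewrite ler_norml; apply/andP; split; lra.
- by apply: IntD => //; apply: IntB; exact: IntZ.
move=> x; have i0 : 0 <= \1_A x :> R by rewrite indicE.
have h3 : dl (b ^~ x) n ^+ 2 <= B ^+ 2.
  by rewrite -(real_normK (num_real (dl _ _))) ler_sqr ?nnegrE.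
have h4 := sqr_path (a x) N.
have h5 : a x N ^+ 2 <= mx (a x) N ^+ 2.
  by rewrite -(real_normK (num_real (a x N))) ler_sqr ?nnegrE ?mx_ge0// mx_ge.
have h6 : qv (a x) N = qv (b ^~ x) N - qv (b ^~ x) n by rewrite qv_tail nN.
suff : qv (b^~ x) N - qv (b^~ x) n + dl (b^~ x) n ^+ 2 <=
   mx (a x) N ^+ 2 + B ^+ 2 - 2 * \sum_(k < N) a x k * dl (a x) k.+1.
  move=> /(ler_wpM2l i0); lra.
lra.
Qed.

End bmo_process.

(** * Path inequalities for brackets and paraproducts *)

Section fefferman_paths.
Variable R : realType.
Implicit Types (a b f c A : nat -> R).

Lemma sq_increment a n : dl a n ^+ 2 / sq a n <= 2 * dl (sq a) n.
Proof.
have [s0|s0] := eqVneq (sq a n) 0.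
  rewrite s0 invr0 mulr0 mulr_ge0// /dl subr_ge0; case: n s0 => [|n] s0; first exact: sq_ge0.
  exact: sq_mono.
have sp : 0 < sq a n by rewrite lt_neqAle eq_sym s0 sq_ge0.
rewrite ler_pdivrMr//; case: n sp {s0} => [|n] sp.
  have := sq_ge0 a 0; have : sq a 0 ^+ 2 = dl a 0 ^+ 2 by rewrite sq_sqr qv0 /dl subr0.
  rewrite {3}/dl; move=> <-; nra.
have h1 : sq a n.+1 ^+ 2 = sq a n ^+ 2 + dl a n.+1 ^+ 2 by rewrite !sq_sqr qvS.
have h2 : sq a n <= sq a n.+1 by exact: sq_mono.
rewrite [dl (sq a) _]/dl; have := sq_ge0 a n; nra.
Qed.

(** Divide df_k by the square root of S_k and multiply db_k by it. The first squares sum to at most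
    2 S(f) by [sq_increment]; the second have the increasing weight S_k required by
    [bmo_weighted]. *)
Lemma fefferman_path f b k : `|dl f k * dl b k| <=
  2 * dl (sq f) k + sq f k * dl b k ^+ 2.
Proof.
apply: le_trans (lerD (sq_increment f k) (lexx _)).
have [s0|s0] := eqVneq (sq f k) 0.
  have : `|dl f k| <= 0 by rewrite -s0 dl_le_sq.
  rewrite normr_le0 => /eqP ->.
  by rewrite s0 !mul0r normr0 expr0n mul0r addr0.
have sp : 0 < sq f k by rewrite lt_neqAle eq_sym s0 sq_ge0.
rewrite normrM -(real_normK (num_real (dl f k))) -(real_normK (num_real (dl b k))).
move: `|dl f k| `|dl b k| (sq f k) sp s0 => x y s sp s0.
have -> : x ^+ 2 / s + s * y ^+ 2 = (x ^+ 2 + (s * y) ^+ 2) / s by field.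
rewrite ler_pdivlMr//; have := sqr_ge0 (x - s * y); have := sqr_ge0 x; have := sqr_ge0 (s * y).
nra.
Qed.

(** One factor of c^2 is bounded by A N and the other stays in the weighted sum w, so that the
    square function is at most sqrt(A N w) <= A N + w. *)
Lemma para_path c A b N : (forall k, `|c k| <= A k) -> (forall k, A k <= A k.+1) ->
  sq (tr c b) N <= A N + \sum_(k < N.+1) A k * dl b k ^+ 2.
Proof.
move=> cA AA.
have A0 k : 0 <= A k by apply: le_trans (cA k).
have Amono m n : (m <= n)%N -> A m <= A n.
  elim: n => [|n IH]; first by rewrite leqn0 => /eqP ->.
  by rewrite leq_eqVlt => /predU1P[->//|/IH h]; exact: le_trans (AA n).
set w := \sum_(k < N.+1) _.
have w0 : 0 <= w by apply: sumr_ge0 => k _; rewrite mulr_ge0 ?sqr_ge0.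
rewrite -[leRHS]ger0_norm; last by rewrite addr_ge0.
rewrite -sqrtr_sqr ler_wsqrtr//.
apply: (@le_trans _ _ (A N * w)); last by have := A0 N; nra.
rewrite /qv /w mulr_sumr; apply: ler_sum => k _; rewrite dl_tr.
case: k => -[|k] kN /=; first by rewrite expr0n mulr_ge0// mulr_ge0// sqr_ge0.
rewrite exprMn mulrA ler_wpM2r ?sqr_ge0//.
rewrite -(real_normK (num_real (c k))) expr2.
apply: ler_pM => //; apply: le_trans (cA k) _; first by apply: Amono; exact: ltnW.
exact: AA.
Qed.

(** The increments of b are those of V divided by mx f. After multiplication by mx f n the quotients
    are the weights [w k], which decrease from 1, so Abel summation loses only a factor 2. *)
Lemma abel_transform f b n m : (n <= m)%N ->
  `|f n| * `|b m - b n| <= 2 * mx (tr (mx f) b) m.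
Proof.
move=> nm; set V := tr (mx f) b; set M := mx V m.
have M0 : 0 <= M by exact: mx_ge0.
have [A0|A0] := eqVneq (mx f n) 0.
  have := mx_ge f n; rewrite A0 normr_le0 => /eqP ->.
  by rewrite normr0 mul0r mulr_ge0.
have Ap : 0 < mx f n by rewrite lt_neqAle eq_sym A0 mx_ge0.
have Apk k : (n <= k)%N -> 0 < mx f k by move=> nk; apply: lt_le_trans Ap (mx_mono f nk).
pose w k := mx f n / mx f k.
have wn : w n = 1 by rewrite /w divff.
have w_le k : (n <= k)%N -> w k.+1 <= w k.
  move=> nk; rewrite /w ler_pM2l// lef_pV2 ?posrE ?Apk// ?(leqW nk)//.
  exact: mx_mono.
have w0 k : 0 <= w k by rewrite divr_ge0 ?mx_ge0.
have VM k : (k <= m)%N -> `|V k| <= M.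
  by move=> km; apply: le_trans (mx_ge _ _) (mx_mono _ km).
(* Abel summation as an invariant: a step adds at most M (w k - w (k+1)), and these quantities
   telescope because w is nonincreasing. *)
have key k : (n + k <= m)%N ->
  `|mx f n * (b (n + k)%N - b n) - w (n + k)%N * V (n + k)%N| <= M * (2 - w (n + k)%N).
  elim: k => [|k IH] h.
    rewrite addn0 in h *; rewrite subrr mulr0 sub0r normrN wn mul1r.
    by have := VM n nm; lra.
  rewrite addnS in h *.
  have -> : mx f n * (b (n + k).+1 - b n) - w (n + k).+1 * V (n + k).+1 =
    (mx f n * (b (n + k)%N - b n) - w (n + k)%N * V (n + k)%N) +
    (w (n + k)%N - w (n + k).+1) * V (n + k).+1.
    have -> : V (n + k).+1 = V (n + k)%N + mx f (n + k)%N * dl b (n + k).+1.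
      by rewrite /V /tr big_ord_recr.
    have : w (n + k)%N * mx f (n + k)%N = mx f n.
      by rewrite /w divfK// gt_eqF// Apk// leq_addr.
    rewrite (dlS b (n + k)); nra.
  rewrite (le_trans (ler_normD _ _))// normrM.
  have wl := w_le (n + k)%N (leq_addr _ _).
  rewrite [`|w _ - _|]ger0_norm ?subr_ge0//.
  have := IH (ltnW h); have := VM _ h; nra.
have := key (m - n)%N; rewrite subnKC// => /(_ (leqnn m)) h.
have h1 : `|mx f n * (b m - b n)| <= 2 * M.
  have -> : mx f n * (b m - b n) = (mx f n * (b m - b n) - w m * V m) + w m * V m by ring.
  rewrite (le_trans (ler_normD _ _))// normrM (ger0_norm (w0 m)).
  have := VM m (leqnn m); have := w0 m; nra.
apply: le_trans h1; rewrite normrM (ger0_norm (mx_ge0 _ _)).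
by rewrite ler_wpM2r// mx_ge.
Qed.

End fefferman_paths.

(** * Fefferman's inequality and boundedness of paraproducts *)

Section bmo_estimates.
Context d (Omega : measurableType d) (R : realType) (P : probability Omega R).
Variable F : nat -> set (set Omega).
Hypothesis HF : is_filtration F.
Notation E := (Ex P).
Notation Int := (Int P).
Notation W n X := (measurable_wrt (F n) X).
Notation mart := (mart P F).
Implicit Types f A c : nat -> Omega -> R.
Let sF n : sigma_algebra setT (F n) := filt_sigma HF n.
Let mF n : F n `<=` measurable := filt_measurable HF (n := n).
Variables (B : R) (b : nat -> Omega -> R).
Hypothesis Hb : bmo_process P F B b.
Let K := 65 * B ^+ 2.
Let mb : mart b. Proof. by case: Hb. Qed.
Let Wb n : W n (b n). Proof. by case: mb. Qed.
Let mbm n : measurable_fun setT (b n). Proof. exact: (W_meas HF (@Wb n)). Qed.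
Let B0 : 0 <= B := bmo_ge0 Hb.
Let dlB n x : `|dl (b ^~ x) n| <= B. Proof. by case: Hb. Qed.
Let mdl n : measurable_fun setT (fun x => dl (b ^~ x) n).
Proof. exact: measurable_dl. Qed.
Let dl2_bd n x : `|dl (b ^~ x) n ^+ 2| <= B ^+ 2.
Proof. by rewrite normrX ler_sqr ?nnegrE. Qed.

(** After [abel_path] the weights are the increments of A, nonnegative and known at time j. [bmo_qv]
    bounds each term, and the increments sum back to A N. *)
Lemma bmo_weighted A N : (forall n, W n (A n)) -> (forall n x, 0 <= A n x) ->
  (forall n x, A n x <= A n.+1 x) -> (forall n, Int (A n)) ->
  Int (fun x => \sum_(k < N.+1) A k x * dl (b ^~ x) k ^+ 2) /\
  E (fun x => \sum_(k < N.+1) A k x * dl (b ^~ x) k ^+ 2) <= K * E (A N).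
Proof.
move=> WA A0 AA IA.
have IAd k : Int (fun x => A k x * dl (b ^~ x) k ^+ 2).
  by under eq_fun do rewrite mulrC; apply: IntMb (dl2_bd k) => //; exact: measurable_funX.
split; first exact: Int_sum.
pose D j x := dl (A ^~ x) j.
pose Q j x := qv (b ^~ x) N - qv (b ^~ x) j + dl (b ^~ x) j ^+ 2.
have WD j : W j (D j) by exact: W_dl.
have D0 j x : 0 <= D j x.
  by rewrite /D /dl; case: j => [|j]; rewrite subr_ge0.
have ID j : Int (D j).
  by rewrite /D /dl; apply: IntB => //; case: j => [|j] //; exact: Int_cst.
have mQ j : measurable_fun setT (Q j).
  apply: measurable_funD; last by apply: measurable_funX.
  by apply: measurable_funB; apply: measurable_qv.
have Qbd j x : `|Q j x| <= N.+1%:R * B ^+ 2 + j.+1%:R * B ^+ 2 + B ^+ 2.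
  have h1 := bmo_qv_bd Hb N x; have h2 := bmo_qv_bd Hb j x.
  have h3 := dl2_bd j x; rewrite ger0_norm ?sqr_ge0// in h3.
  have := qv_ge0 (b ^~ x) N; have := qv_ge0 (b ^~ x) j; have := sqr_ge0 (dl (b ^~ x) j).
  by move=> h4 h5 h6; rewrite ler_norml; apply/andP; split; rewrite /Q; lra.
have IQ j : Int (Q j) by exact: Int_bd (mQ j) (Qbd j).
have IDQ j : Int (fun x => D j x * Q j x).
  by under eq_fun do rewrite mulrC; exact: IntMb (Qbd j).
have key j : (j <= N)%N -> E (fun x => D j x * Q j x) <= K * E (D j).
  move=> jN; rewrite -subr_ge0 -ExZ// -ExB//; last exact: IntZ.
  have e : (fun x => K * D j x - D j x * Q j x) = (fun x => D j x * (K - Q j x)).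
    by apply/funext => x; ring.
  rewrite e; apply: (Ex_mul_ge0 (sF j) (mF (n := j))) => //.
  - by apply: IntB => //; exact: Int_cst.
  - move=> G FG; have mG : measurable G := mF FG.
    have I1 : Int (\1_G) by have := Int_indM mG (Int_cst P 1); under eq_fun do rewrite mulr1.
    have -> : E (fun x => \1_G x * (K - Q j x)) = E (fun x => K * \1_G x - \1_G x * Q j x).
      by apply: eq_Ex => x; ring.
    rewrite ExB; [|exact: IntZ|exact: Int_indM].
    by rewrite ExZ// subr_ge0; exact: (bmo_qv HF Hb).
  - by rewrite -e; apply: IntB => //; exact: IntZ.
have -> : E (fun x => \sum_(k < N.+1) A k x * dl (b ^~ x) k ^+ 2) =
    E (fun x => \sum_(j < N.+1) D j x * Q j x).
  by apply: eq_Ex => x; rewrite -(abel_path (A ^~ x)).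
rewrite Ex_sum//.
have -> : E (A N) = \sum_(j < N.+1) E (D j).
  by rewrite -Ex_sum//; apply: eq_Ex => x; rewrite -(sum_dl (A ^~ x)).
by rewrite mulr_sumr; apply: ler_sum => j _; apply: key; rewrite -ltnS.
Qed.

Lemma fefferman f N : mart f ->
  Int (fun x => \sum_(k < N.+1) `|dl (f ^~ x) k * dl (b ^~ x) k|) /\
  E (fun x => \sum_(k < N.+1) `|dl (f ^~ x) k * dl (b ^~ x) k|) <=
    (2 + K) * E (fun x => sq (f ^~ x) N).
Proof.
move=> mf; have [Wf If Ef] := mf.
have I1 : Int (fun x => \sum_(k < N.+1) `|dl (f ^~ x) k * dl (b ^~ x) k|).
  apply: Int_sum => k _; apply: Int_norm; under eq_fun do rewrite mulrC.
  by apply: IntMb (dlB k) => //; exact: (mart_Int_dl k mf).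
split => //.
have [||||IS ES] := @bmo_weighted (fun n x => sq (f ^~ x) n) N.
- by move=> n; apply: (@measurable_sq _ (g_sigma_algebraType (F n)) _ f) => k kn; exact: (W_le HF kn).
- by move=> n x; exact: sq_ge0.
- by move=> n x; exact: sq_mono.
- by move=> n; exact: (mart_Int_sq n mf).
have Isq := mart_Int_sq N mf.
rewrite mulrDl -[X in X + _]ExZ//; apply: le_trans (lerD (lexx _) ES).
rewrite -ExD//; last exact: IntZ.
apply: Ex_le => //; first by apply: IntD => //; exact: IntZ.
move=> x; rewrite -(sum_dl (sq (f ^~ x))) mulr_sumr -big_split /=.
by apply: ler_sum => k _; exact: fefferman_path.
Qed.

Lemma paraproduct c A : (forall n, W n (c n)) -> (forall n, W n (A n)) ->
  (forall n x, `|c n x| <= A n x) ->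
  (forall n x, A n x <= A n.+1 x) -> (forall n, Int (A n)) ->
  mart (fun n x => tr (c ^~ x) (b ^~ x) n) /\
  forall N, E (fun x => sq (tr (c ^~ x) (b ^~ x)) N) <= (1 + K) * E (A N).
Proof.
move=> Wc WA cA AA IA.
have Ic n : Int (c n) by apply: Int_le (cA n) (IA n); exact: (W_meas HF (Wc n)).
have mt : mart (fun n x => tr (c ^~ x) (b ^~ x) n).
  apply: mart_trans => // n; under eq_fun do rewrite mulrC.
  exact: IntMb (dlB n.+1).
split => // N.
have A0 n x : 0 <= A n x by apply: le_trans (cA n x).
have [IS ES] := bmo_weighted N WA A0 AA IA.
rewrite mulrDl mul1r; apply: le_trans (lerD (lexx _) ES).
rewrite -ExD//; apply: Ex_le; [exact: (mart_Int_sq N mt)|exact: IntD|].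
by move=> x; exact: (@para_path _ (c ^~ x) (A ^~ x) (b ^~ x) N (cA ^~ x) (AA ^~ x)).
Qed.

End bmo_estimates.

(** * Passage to the limit *)

Section pointwise_limits.
Context d (Omega : measurableType d) (R : realType) (P : probability Omega R).
Notation E := (Ex P).
Notation Int := (Int P).
Notation pr A := (fine (P A)).
Implicit Types g : nat -> Omega -> R.

(* Everywhere defined and measurable; [fine] sends infinite upper limits to 0. *)
Definition limf g x : R := fine (limn_esup (fun n => (g n x)%:E)).

Lemma measurable_limf g : (forall n, measurable_fun setT (g n)) -> measurable_fun setT (limf g).
Proof.
move=> mg; apply: (measurableT_comp (f := fine)); first exact: fine_measurable.
by apply: measurable_fun_limn_esup => n; exact/measurable_EFinP.
Qed.

Lemma limf_lim g x (l : R) : g ^~ x @ \oo --> l -> limf g x = l.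
Proof.
move=> gl; have [|_ h] := @cvg_limn_einf_sup _ (fun n => (g n x)%:E) l%:E.
  by apply: cvg_EFin => //; exact: nearW.
by rewrite /limf h.
Qed.

Lemma limf_cvg g x : cvgn (g ^~ x) -> g ^~ x @ \oo --> limf g x.
Proof. by move=> cg; rewrite (limf_lim cg). Qed.

Lemma fatou_L1 g (f : Omega -> R) c : (forall n, Int (g n)) -> measurable_fun setT f ->
  (\forall x \ae P, g ^~ x @ \oo --> f x) -> (forall n, E (fun x => `|g n x|) <= c) ->
  Int f /\ E (fun x => `|f x|) <= c.
Proof.
move=> Ig mf gf gc.
have mg n := Int_meas (Ig n).
have := @fatou _ _ _ P setT measurableT (fun n x => `|g n x|%:E).
move=> /(_ _ _)/Wrap[|n|].
- by move=> n; apply/measurable_EFinP; exact: measurable_norm.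
- by move=> x _; rewrite lee_fin.
move=> h.
have h2 : (\int[P]_x `|f x|%:E <= c%:E)%E.
  rewrite (_ : (\int[P]_x `|f x|%:E)%E = (\int[P]_x limn_einf (fun n => `|g n x|%:E))%E); last first.
    apply: ae_eq_integral => //.
    - by apply/measurable_EFinP; exact: measurable_norm.
    - rewrite (_ : (fun x => _) = (fun x => - limn_esup (fun n => - `|g n x|%:E))%E).
        apply: measurableT_comp => //; apply: measurable_fun_limn_esup => n.
        by apply: measurableT_comp => //; apply/measurable_EFinP; exact: measurable_norm.
      by apply/funext => x; rewrite limn_esupN oppeK.
    - apply: filterS gf => x gfx _; apply/esym.
      by apply: (cvg_limn_einf_sup _).1; apply: cvg_EFin; [exact: nearW|exact: cvg_norm].
  apply: le_trans h _; rewrite limn_einf_lim; apply: lime_le; first exact: is_cvg_einfs.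
  apply: nearW => n; apply: (@le_trans _ _ (\int[P]_x `|g n x|%:E)%E).
    by apply: ereal_inf_lbound; exists n => /=.
  by rewrite ExE ?lee_fin//; exact: Int_norm.
have If : Int f.
  apply/integrableP; split; first exact/measurable_EFinP.
  exact: le_lt_trans h2 (ltry _).
by split => //; rewrite -lee_fin -ExE//; exact: Int_norm.
Qed.

Lemma monotone_L1 g c : (forall n, Int (g n)) -> (forall n x, 0 <= g n x) ->
  (forall n x, g n x <= g n.+1 x) -> (forall n, E (g n) <= c) ->
  exists G, [/\ Int G, E G <= c, forall x, 0 <= G x &
    \forall x \ae P, g ^~ x @ \oo --> G x /\ forall n, g n x <= G x].
Proof.
move=> Ig g0 g_nd gc.
have mg n := Int_meas (Ig n).
have nd x : nondecreasing_seq (g ^~ x) by apply/nondecreasing_seqP.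
have ndE x : nondecreasing_seq (fun n => (g n x)%:E) by move=> m n mn; rewrite lee_fin; exact: nd.
pose Phi x := limn (fun n => (g n x)%:E).
have cPhi x : (g n x)%:E @[n --> \oo] --> Phi x by exact: ereal_nondecreasing_is_cvgn.
have mPhi : measurable_fun setT Phi.
  rewrite (_ : Phi = (fun x => limn_esup (fun n => (g n x)%:E))).
    by apply: measurable_fun_limn_esup => n; exact/measurable_EFinP.
  by apply/funext => x; rewrite is_cvg_limn_esupE//; exact: ereal_nondecreasing_is_cvgn.
have Phi0 x : (0 <= Phi x)%E.
  by apply: lime_ge; [exact: ereal_nondecreasing_is_cvgn|apply: nearW => n; rewrite lee_fin].
have IPhi : P.-integrable setT Phi.
  apply/integrableP; split => //; under eq_integral do rewrite gee0_abs//.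
  have -> : (\int[P]_x Phi x)%E = limn (fun n => \int[P]_x (g n x)%:E)%E.
    apply: monotone_convergence => //.
    - by move=> n; exact/measurable_EFinP.
    - by move=> n x _; rewrite lee_fin.
  apply: (@le_lt_trans _ _ c%:E); last exact: ltry.
  apply: lime_le.
    apply: ereal_nondecreasing_is_cvgn => m n mn.
    by rewrite !ExE// lee_fin; apply: Ex_le => // x; exact: nd.
  by apply: nearW => n; rewrite ExE// lee_fin.
have fin := integrable_ae measurableT IPhi.
pose G x := `|limf g x|.
have mG : measurable_fun setT G by apply: measurable_norm; exact: measurable_limf.
have cG : \forall x \ae P, g ^~ x @ \oo --> G x.
  apply: filterS fin => x /(_ I) Pf.
  have h : g n x @[n --> \oo] --> fine (Phi x).
    by have := cPhi x; rewrite -[X in _ --> X](fineK Pf) => /fine_cvg.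
  by rewrite /G (limf_lim h) ger0_norm// fine_ge0.
have [|IG EG] := fatou_L1 (c := c) Ig mG cG.
  by move=> n; under eq_Ex do rewrite ger0_norm//.
exists G; split => //.
  apply: le_trans EG; apply: Ex_le => //; first exact: Int_norm.
  by move=> x; exact: ler_norm.
  by move=> x; exact: normr_ge0.
apply: filterS cG => x h; split => // n.
have cg : cvgn (g ^~ x) by apply/cvg_ex; exists (G x).
by rewrite -(cvg_lim _ h)//; exact: nondecreasing_cvgn_le.
Qed.

(** The strict inequality t < |limf g x| forces t <= |g n x| for some n, and the events defined by
    the running maxima increase with n. *)
Lemma limf_weak g t c : (forall n, measurable_fun setT (g n)) ->
  (\forall x \ae P, cvgn (g ^~ x)) ->
  (forall n, pr [set x | t <= mx (g ^~ x) n] <= c) ->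
  pr [set x | t < `|limf g x| ] <= c.
Proof.
move=> mg cg gc.
pose A N := [set x | t <= mx (g ^~ x) N].
have mA N : measurable (A N) by apply: measurable_ge; exact: measurable_mx.
have A_nd : nondecreasing_seq A.
  by move=> m n mn; apply/subsetPset => x /le_trans; apply; exact: mx_mono.
have mB : measurable (\bigcup_N A N) by exact: bigcupT_measurable.
have mL : measurable [set x | t < `|limf g x| ].
  by apply: measurable_gt; apply: measurable_norm; exact: measurable_limf.
have [N [mN N0 NP]] := cg.
apply: (@le_trans _ _ (pr (\bigcup_N A N) + pr N)).
  apply: pr_leU => // x /= tx; apply: contrapT => /not_orP[nA nN].
  have cx : cvgn (g ^~ x) by apply: contrapT => h; apply: nN; exact: NP.
  have /cvg_norm nc := limf_cvg cx.
  have : exists n, t <= `|g n x|.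
    apply: contrapT => /forallNP h; move: tx; rewrite ltNge => /negP; apply.
    by apply: (cvgn_le nc) => n; rewrite leNgt; apply/negP => /ltW; exact: h.
  move=> [n tn]; apply: nA; exists n => //; exact: le_trans tn (mx_ge (g ^~ x) n).
rewrite N0 addr0.
have cv := nondecreasing_cvg_mu mA mB A_nd (mu := P).
have {}cv : pr (A M) @[M --> \oo] --> pr (\bigcup_N A N).
  by apply: fine_cvg; rewrite fineK ?fin_num_measure.
exact: cvgn_le cv gc.
Qed.

End pointwise_limits.

(** * Truncation *)

Section clamp.
Variable R : realType.
Implicit Types x m : R.

Definition clamp m x := Num.max (- m) (Num.min x m).

Lemma clamp_bd m x : 0 <= m -> `|clamp m x| <= m.
Proof.
move=> m0; rewrite /clamp ler_norml le_max lexx /= ge_max ge_min lexx orbT andbT.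
lra.
Qed.

Lemma clamp_id m x : `|x| <= m -> clamp m x = x.
Proof.
by rewrite ler_norml => /andP[h1 h2]; rewrite /clamp (min_idPl h2); exact/max_idPr.
Qed.

Lemma clamp_sqr m x : 0 <= m -> clamp m x ^+ 2 <= clamp m x * x.
Proof.
move=> m0; rewrite /clamp.
case: (leP x m) => xm; case: (leP (- m) _) => h; rewrite expr2; nra.
Qed.

Lemma clamp_dist m x : 0 <= m -> `|x - clamp m x| <= `|x|.
Proof.
move=> m0; rewrite /clamp; have := ler_norm x; have := ler_norm (- x); rewrite normrN.
case: (leP x m) => xm; case: (leP (- m) _) => h h1 h2; rewrite ler_norml; apply/andP; split; lra.
Qed.

Lemma clamp_cvg x : clamp n%:R x @[n --> \oo] --> x.
Proof.
apply: cvg_near_cst; near=> n; apply: clamp_id.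
near: n; exact: nbhs_infty_ger.
Unshelve. all: by end_near. Qed.

Lemma measurable_clamp d (T : measurableType d) m (f : T -> R) :
  measurable_fun setT f -> measurable_fun setT (fun y => clamp m (f y)).
Proof.
move=> mf; apply: measurable_maxr; first exact: measurable_cst.
by apply: measurable_minr => //; exact: measurable_cst.
Qed.

Lemma measurable_sgr d (T : measurableType d) (f : T -> R) :
  measurable_fun setT f -> measurable_fun setT (fun y => Num.sg (f y)).
Proof.
move=> mf; rewrite (_ : (fun y => _) = (fun y => f y / `|f y|)).
  by apply: measurable_funM => //; apply/measurable_invr/measurable_norm.
apply/funext => y; have [->|fx] := eqVneq (f y) 0; first by rewrite sgr0 mul0r.
by rewrite {2}[f y]numEsg mulfK// normr_eq0.
Qed.

Lemma sgr_bd x : `|Num.sg x| <= 1.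
Proof. by rewrite normr_sg; case: (x != 0). Qed.

End clamp.

(** * The martingale of conditional expectations of an integrable function *)

Section conditional_martingale.
Context d (Omega : measurableType d) (R : realType) (P : probability Omega R).
Variable F : nat -> set (set Omega).
Hypothesis HF : is_filtration F.
Notation E := (Ex P).
Notation Int := (Int P).
Notation W n X := (measurable_wrt (F n) X).
Notation mart := (mart P F).
Notation mof := (martingale_of P F).
Let sF n : sigma_algebra setT (F n) := filt_sigma HF n.
Let mF n : F n `<=` measurable := filt_measurable HF (n := n).
Implicit Types u v : Omega -> R.

Lemma mof_W u n : Int u -> W n (mof u n).
Proof. by move=> Iu; have [] := cond_expP (sF n) (mF (n := n)) Iu. Qed.

Lemma mof_Int u n : Int u -> Int (mof u n).
Proof. by move=> Iu; have [] := cond_expP (sF n) (mF (n := n)) Iu. Qed.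

Lemma mof_E u n A : Int u -> F n A -> E (fun x => \1_A x * mof u n x) = E (fun x => \1_A x * u x).
Proof. by move=> Iu FA; have [_ _ ->] := cond_expP (sF n) (mF (n := n)) Iu. Qed.

Lemma mof_uniq u n (g : Omega -> R) : Int u -> W n g -> Int g ->
  (forall A, F n A -> E (fun x => \1_A x * g x) = E (fun x => \1_A x * u x)) ->
  g = mof u n %[ae P].
Proof. by move=> *; exact: (cond_exp_uniq (sF n) (mF (n := n))). Qed.

Lemma mof_mart u : Int u -> mart (mof u).
Proof.
move=> Iu; split; [by move=> n; exact: mof_W|by move=> n; exact: mof_Int|].
move=> n A FA; have mA : measurable A := mF FA.
under eq_Ex do rewrite mulrBr.
rewrite ExB; [|by apply: Int_indM => //; exact: mof_Int..].
by rewrite !mof_E ?subrr//; exact: (filt_le HF (leqnSn n)).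
Qed.

Lemma is_martingale_mart f : is_martingale P F f -> mart f.
Proof.
move=> [Wf Lf Ef]; have If n : Int (f n) by apply/Lfun1_integrable.
split => // n A FA; have mA : measurable A := mF FA.
under eq_Ex do rewrite mulrBr.
rewrite ExB; [|exact: Int_indM..].
have [Wc Ic cE] := cond_expP (sF n) (mF (n := n)) (If n.+1).
rewrite -cE// (_ : E (fun x => \1_A x * f n x) = E (fun x => \1_A x * cond_exp P (F n) (f n.+1) x)) ?subrr//.
apply: ae_eq_Ex.
- exact: (Int_meas (Int_indM mA (If n))).
- exact: (Int_meas (Int_indM mA Ic)).
- by apply: filterS (Ef n) => x /= /[apply] ->.
Qed.

Lemma mof_mul u n (X : Omega -> R) : Int u -> W n X -> Int (fun x => X x * (u x - mof u n x)) ->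
  E (fun x => X x * (u x - mof u n x)) = 0.
Proof.
move=> Iu WX IX; apply: (Ex_mul_eq0 (sF n) (mF (n := n))) => //.
  by apply: IntB => //; exact: mof_Int.
move=> A FA; have mA : measurable A := mF FA.
under eq_Ex do rewrite mulrBr.
by rewrite ExB; [rewrite mof_E// subrr|exact: Int_indM|apply: Int_indM => //; exact: mof_Int].
Qed.

Lemma mof_mulE u n (X : Omega -> R) c : Int u -> W n X -> (forall x, `|X x| <= c) ->
  E (fun x => X x * mof u n x) = E (fun x => X x * u x).
Proof.
move=> Iu WX Xc; have mX := W_meas HF WX.
have I1 : Int (fun x => X x * u x) by apply: IntMb Xc.
have I2 : Int (fun x => X x * mof u n x) by apply: IntMb Xc => //; exact: mof_Int.
have IX : Int (fun x => X x * (u x - mof u n x)).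
  by under eq_fun do rewrite mulrBr; exact: IntB.
have := mof_mul Iu WX IX; under eq_Ex do rewrite mulrBr.
by rewrite ExB// => /eqP; rewrite subr_eq0 => /eqP ->.
Qed.

Lemma mof_norm u n : Int u -> E (fun x => `|mof u n x|) <= E (fun x => `|u x|).
Proof.
move=> Iu.
have Ws : W n (fun x => Num.sg (mof u n x)) by apply: measurable_sgr; exact: mof_W.
have sb x : `|Num.sg (mof u n x)| <= 1 := sgr_bd _.
rewrite (eq_Ex _ (g := fun x => Num.sg (mof u n x) * mof u n x)); last by move=> x; rewrite -normrEsg.
rewrite (mof_mulE Iu Ws sb); apply: Ex_le.
- by apply: IntMb sb => //; exact: (W_meas HF Ws).
- exact: Int_norm.
move=> x; apply: le_trans (ler_norm _) _; rewrite normrM ler_piMl//.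
Qed.

Lemma mof_sub u v n : Int u -> Int v -> mof (fun x => u x - v x) n = (fun x => mof u n x - mof v n x) %[ae P].
Proof.
move=> Iu Iv; apply: ae_eq_sym; apply: mof_uniq; first exact: IntB.
- by apply: measurable_funB; exact: mof_W.
- by apply: IntB; exact: mof_Int.
move=> A FA; have mA : measurable A := mF FA.
rewrite (eq_Ex _ (g := fun x => \1_A x * mof u n x - \1_A x * mof v n x)); last by move=> x; ring.
rewrite (eq_Ex _ (f := fun x => \1_A x * (u x - v x)) (g := fun x => \1_A x * u x - \1_A x * v x)); last by move=> x; ring.
rewrite !ExB; [|by apply: Int_indM => //; try exact: mof_Int..].
by rewrite !mof_E.
Qed.

Lemma Int_mul_sqr (f g : Omega -> R) : Int (fun x => f x ^+ 2) -> Int (fun x => g x ^+ 2) ->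
  measurable_fun setT f -> measurable_fun setT g -> Int (fun x => f x * g x).
Proof.
move=> If Ig mf mg; apply: (@Int_le _ _ _ _ _ (fun x => f x ^+ 2 + g x ^+ 2)).
- exact: measurable_funM.
- move=> x; rewrite normrM -(real_normK (num_real (f x))) -(real_normK (num_real (g x))).
  have := sqr_ge0 (`|f x| - `|g x|); have := sqr_ge0 (`|f x|); have := sqr_ge0 (`|g x|); nra.
- exact: IntD.
Qed.

(** As the square of E_n u is not yet known to be integrable, it is truncated: E X^2 <= E X E_n u =
    E X u <= (E X^2 + E u^2) / 2 for the truncation X, and Fatou's lemma removes it. *)
Lemma mof_L2 u n : Int u -> Int (fun x => u x ^+ 2) ->
  Int (fun x => mof u n x ^+ 2) /\ E (fun x => mof u n x ^+ 2) <= E (fun x => u x ^+ 2).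
Proof.
move=> Iu Iu2; have mf := Int_meas (mof_Int n Iu).
pose X m x := clamp m%:R (mof u n x) : R.
have mX m : measurable_fun setT (X m) by exact: measurable_clamp.
have Xb m x : `|X m x| <= m%:R by apply: clamp_bd.
have X2b m x : `|X m x ^+ 2| <= m%:R ^+ 2 by rewrite normrX ler_sqr ?nnegrE.
have IX2 m : Int (fun x => X m x ^+ 2).
  by apply: Int_bd (X2b m); exact: measurable_funX.
have WX m : W n (X m) by apply: measurable_clamp; exact: mof_W.
have EX m : E (fun x => `|X m x ^+ 2|) <= E (fun x => u x ^+ 2).
  rewrite (eq_Ex _ (g := fun x => X m x ^+ 2)); last by move=> x; rewrite ger0_norm ?sqr_ge0.
  have h1 : E (fun x => X m x ^+ 2) <= E (fun x => X m x * mof u n x).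
    apply: Ex_le => //; first by apply: IntMb (Xb m) => //; exact: mof_Int.
    by move=> x; apply: clamp_sqr.
  rewrite (mof_mulE Iu (WX m) (Xb m)) in h1.
  have h2 : 2 * E (fun x => X m x * u x) <= E (fun x => X m x ^+ 2) + E (fun x => u x ^+ 2).
    have I1 : Int (fun x => X m x * u x) by apply: IntMb (Xb m).
    rewrite -ExZ// -ExD//; apply: Ex_le; [exact: IntZ|exact: IntD|].
    by move=> x; have := sqr_ge0 (X m x - u x); nra.
  lra.
have [|IE EE] := fatou_L1 IX2 (measurable_funX 2 mf) _ EX.
  apply: aeW => x; have c := @clamp_cvg _ (mof u n x).
  by under eq_fun do rewrite expr2; rewrite expr2; exact: cvgM.
split => //; apply: le_trans EE; apply: Ex_le => //; first exact: Int_norm.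
by move=> x; exact: ler_norm.
Qed.

(** From S <= 1 + S^2 and the orthogonality of increments. The bound is crude, but it serves only to
    place L^2 functions in H_1. *)
Lemma mart_L2_sq f N : mart f -> (forall n, Int (fun x => f n x ^+ 2)) ->
  E (fun x => sq (f ^~ x) N) <= 1 + E (fun x => f N x ^+ 2).
Proof.
move=> mf If2; have [Wf If Ef] := mf.
have mfn n := Int_meas (If n).
have mdl n : measurable_fun setT (fun x => dl (f ^~ x) n) by exact: measurable_dl.
have Id n : Int (fun x => dl (f ^~ x) n ^+ 2).
  apply: (@Int_le _ _ _ _ _ (fun x => 2 * f n x ^+ 2 + 2 * (if n is m.+1 then f m x else 0) ^+ 2)).
  - exact: measurable_funX.
  - move=> x; rewrite ger0_norm ?sqr_ge0// /dl.
    case: n => [|n]; first by have := sqr_ge0 (f 0%N x); nra.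
    by have := sqr_ge0 (f n.+1 x + f n x); nra.
  - apply: IntD; apply: IntZ => //; case: n => [|n] //; exact: Int_cst.
have Ifd k : Int (fun x => f k x * dl (f ^~ x) k.+1) by exact: Int_mul_sqr.
have IS : Int (fun x => \sum_(k < N) f k x * dl (f ^~ x) k.+1) by exact: Int_sum.
have ES : E (fun x => \sum_(k < N) f k x * dl (f ^~ x) k.+1) = 0.
  by rewrite Ex_sum// big1// => k _; exact: (mart_mul HF mf).
rewrite -[1](Ex_cst P) -ExD//; last exact: Int_cst.
have -> : E (fun x => 1 + f N x ^+ 2) =
   E (fun x => (1 + f N x ^+ 2) - 2 * \sum_(k < N) f k x * dl (f ^~ x) k.+1).
  rewrite ExB ?ExZ// ?ES ?mulr0 ?subr0//; last exact: IntZ.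
  by apply: IntD => //; exact: Int_cst.
apply: Ex_le; first exact: (mart_Int_sq N mf).
  by apply: IntB; [apply: IntD => //; exact: Int_cst|exact: IntZ].
move=> x; have := sqr_path (f ^~ x) N; rewrite -sq_sqr /=.
by have := sqr_ge0 (sq (f ^~ x) N - 1); nra.
Qed.

Lemma mof_L2_sq u N : Int u -> Int (fun x => u x ^+ 2) ->
  E (fun x => sq (mof u ^~ x) N) <= 1 + E (fun x => u x ^+ 2).
Proof.
move=> Iu Iu2; have [_ h] := mof_L2 N Iu Iu2.
apply: le_trans (mart_L2_sq N (mof_mart Iu) (fun n => (mof_L2 n Iu Iu2).1)) _.
by rewrite lerD2l.
Qed.

Lemma clamp_L1 u : Int u -> E (fun x => `|u x - clamp n%:R (u x)|) @[n --> \oo] --> (0 : R).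
Proof.
move=> Iu; have mu := Int_meas Iu.
have [| | | | |_] := @Ex_dct _ _ _ P (fun n x => `|u x - clamp n%:R (u x)|) (fun=> 0) (fun x => `|u x|).
- by move=> n; apply: measurable_norm; apply: measurable_funB => //; exact: measurable_clamp.
- exact: measurable_cst.
- exact: Int_norm.
- apply: aeW => x; rewrite -[0](normr0 R) -(subrr (u x)).
  by apply: cvg_norm; apply: cvgB; [exact: cvg_cst|exact: clamp_cvg].
- by apply: aeW => x n; rewrite normr_id; exact: clamp_dist.
- by rewrite Ex_cst.
Qed.

(** Truncating u provides the approximating martingales required by [tr_cvg]. *)
Lemma mof_approx u (e : R) : Int u -> 0 < e -> exists (f : nat -> Omega -> R) c, [/\ mart f,
  forall n, E (fun x => sq (f ^~ x) n) <= c & forall n, E (fun x => `|mof u n x - f n x|) <= e].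
Proof.
move=> Iu e0; have mu := Int_meas Iu.
have := clamp_L1 Iu => /cvgrPdist_lt /(_ e e0) [m _ /(_ m (leqnn m))].
rewrite /= sub0r normrN ger0_norm; last by apply: Ex_ge0.
move=> hm; pose w x := clamp m%:R (u x).
have mw : measurable_fun setT w by exact: measurable_clamp.
have wb x : `|w x| <= m%:R by exact: clamp_bd.
have Iw : Int w by exact: Int_bd wb.
have Iw2 : Int (fun x => w x ^+ 2).
  apply: (@Int_bd _ _ _ _ (m%:R ^+ 2)); first exact: measurable_funX.
  by move=> x; rewrite normrX ler_sqr ?nnegrE.
exists (mof w), (1 + E (fun x => w x ^+ 2)); split.
- exact: mof_mart.
- by move=> n; exact: mof_L2_sq.
move=> n; apply: le_trans (ltW hm).
apply: le_trans (mof_norm n (IntB Iu Iw)).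
have h := mof_sub n Iu Iw.
rewrite (@ae_eq_Ex _ _ _ P _ (fun x => `|mof (fun x => u x - w x) n x|)) //.
- by apply: measurable_norm; apply: measurable_funB; exact: Int_meas (mof_Int _ _).
- by apply: measurable_norm; exact: Int_meas (mof_Int _ (IntB Iu Iw)).
- by apply: filterS h => x /= /[apply] ->.
Qed.

End conditional_martingale.

(** * Identification of almost sure limits with the closing function *)

Section density.
Context d (T : measurableType d) (R : realType) (mu : {measure set T -> \bar R}).
Variables (phi : T -> R) (mphi : measurable_fun setT phi) (phi0 : forall x, 0 <= phi x).

Definition density_measure (A : set T) : \bar R := (\int[mu]_(x in A) (phi x)%:E)%E.

Let density0 : density_measure set0 = 0%E. Proof. exact: integral_set0. Qed.

Let density_ge0 A : (0 <= density_measure A)%E.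
Proof. by apply: integral_ge0 => x _; rewrite lee_fin. Qed.

Let density_sigma_additive : semi_sigma_additive density_measure.
Proof.
by apply: semi_sigma_additive_nng_induced => [|x]; [exact/measurable_EFinP|rewrite lee_fin].
Qed.

HB.instance Definition _ := isMeasure.Build _ _ _ density_measure
  density0 density_ge0 density_sigma_additive.

Definition density_pack : {measure set T -> \bar R} := density_measure.

End density.

Section martingale_closure.
Context d (Omega : measurableType d) (R : realType) (P : probability Omega R).
Variable F : nat -> set (set Omega).
Hypothesis HF : is_filtration F.
Notation E := (Ex P).
Notation Int := (Int P).
Notation mart := (mart P F).
Let sF n : sigma_algebra setT (F n) := filt_sigma HF n.
Let mF n : F n `<=` measurable := filt_measurable HF (n := n).

(** Uniqueness of measures on the pi-system of the union of the F n. Since f and g are signed, the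
    measures compared have the nonnegative densities p = f^+ + g^- and q = g^+ + f^-, with p - q = f
    - g. *)
Lemma ae_eq_filtration (f g : Omega -> R) : Int f -> Int g ->
  (forall n A, F n A -> E (fun x => \1_A x * f x) = E (fun x => \1_A x * g x)) ->
  f = g %[ae P].
Proof.
move=> If Ig fg.
have mf := Int_meas If; have mg := Int_meas Ig.
pose p x := Num.max (f x) 0 + Num.max (- g x) 0.
pose q x := Num.max (g x) 0 + Num.max (- f x) 0.
have pq x : p x - q x = f x - g x.
  by rewrite /p /q; case: (leP (f x) 0) => ?; case: (leP (- f x) 0) => ?;
     case: (leP (g x) 0) => ?; case: (leP (- g x) 0) => ?; lra.
have Ip : Int p by apply: IntD; apply: Int_max; rewrite ?Int_cst//; first [exact: IntN|exact: Int_cst].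
have Iq : Int q by apply: IntD; apply: Int_max; rewrite ?Int_cst//; first [exact: IntN|exact: Int_cst].
have p0 x : 0 <= p x by rewrite addr_ge0// le_max lexx orbT.
have q0 x : 0 <= q x by rewrite addr_ge0// le_max lexx orbT.
have mp := Int_meas Ip; have mq := Int_meas Iq.
have mgen : (measurable : set (set Omega)) = <<s \bigcup_n F n >> by case: HF.
have GI : setI_closed (\bigcup_n F n).
  move=> A B [m _ Am] [n _ Bn]; exists (maxn m n) => //.
  have Am' : F (maxn m n) A by apply: (filt_le HF _ Am); exact: leq_maxl.
  have Bn' : F (maxn m n) B by apply: (filt_le HF _ Bn); exact: leq_maxr.
  rewrite -(sub_measurableE (sF _)); apply: (@measurableI _ (g_sigma_algebraType (F (maxn m n)))).
    by rewrite sub_measurableE.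
  by rewrite sub_measurableE.
have dens (h : Omega -> R) A : Int h -> measurable A -> (\int[P]_(x in A) (h x)%:E)%E = (E (fun x => \1_A x * h x))%:E.
  by move=> Ih mA; rewrite int_setE.
have eqpq A : measurable A -> density_measure P p A = density_measure P q A.
  move=> mA.
  apply: (@measure_unique _ R Omega (\bigcup_n F n) (fun=> setT) mgen GI _ _
    (density_pack P mp p0) (density_pack P mq q0)) => //.
  - by move=> _; exists 0%N => //; exact: (filt_setT HF).
  - by rewrite bigcup_const.
  - move=> B [n _ FB]; rewrite /= /density_measure; have mB : measurable B := mF FB.
    rewrite !dens//; congr EFin.
    apply/eqP; rewrite -subr_eq0 -ExB; [|exact: Int_indM..].
    rewrite (eq_Ex _ (g := fun x => \1_B x * f x - \1_B x * g x)).
      by rewrite ExB; [rewrite (fg n B FB) subrr|exact: Int_indM..].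
    by move=> x; rewrite -!mulrBr pq.
  - by move=> _; rewrite /= /density_measure ExE// ltry.
have : EFin \o f = EFin \o g %[ae P].
  apply: integral_ae_eq => //; first exact/measurable_EFinP.
  move=> A _ mA; rewrite !dens//; congr EFin.
  have := eqpq A mA; rewrite /density_measure !dens// => -[e].
  apply/eqP; rewrite -subr_eq0 -ExB; [|exact: Int_indM..].
  rewrite (eq_Ex _ (g := fun x => \1_A x * p x - \1_A x * q x)).
    by rewrite ExB; [rewrite e subrr|exact: Int_indM..].
  by move=> x; rewrite -!mulrBr pq.
by apply: filterS => x /= /[apply] -[].
Qed.

Lemma mart_E_le (f : nat -> Omega -> R) m n A : mart f -> (m <= n)%N -> F m A ->
  E (fun x => \1_A x * f n x) = E (fun x => \1_A x * f m x).
Proof.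
move=> [Wf If Ef]; elim: n => [|n IH]; first by rewrite leqn0 => /eqP ->.
rewrite leq_eqVlt => /predU1P[->//|]; rewrite ltnS => mn FA.
rewrite -IH//; have FnA : F n A by exact: (filt_le HF mn).
have := Ef n A FnA; under eq_Ex do rewrite mulrBr.
rewrite ExB; [|by apply: Int_indM => //; exact: mF FA..].
by move=> /eqP; rewrite subr_eq0 => /eqP.
Qed.

Lemma mx_L1 (f : nat -> Omega -> R) c : mart f -> (forall n, E (fun x => sq (f ^~ x) n) <= c) ->
  exists G, [/\ Int G, forall x, 0 <= G x & \forall x \ae P, forall n, mx (f ^~ x) n <= G x].
Proof.
move=> mf fc; have [_ If _] := mf.
have [|||| G [IG _ G0 hG]] := @monotone_L1 _ _ _ P (fun n x => mx (f ^~ x) n) (50 * c).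
- by move=> n; exact: mart_Int_mx.
- by move=> n x; exact: mx_ge0.
- by move=> n x; exact: mx_mono.
- by move=> n; apply: le_trans (davis_M HF n mf) _; rewrite ler_pM2l.
by exists G; split => //; apply: filterS hG => x [].
Qed.

(* For martingales bounded in H_1, almost sure convergence is convergence in L^1
   (Davis' maximal function dominates), so the limit closes the martingale. *)
Lemma mof_cvg u (f : nat -> Omega -> R) c : Int u -> mart f ->
  (forall n, E (fun x => sq (f ^~ x) n) <= c) ->
  (forall n A, F n A -> E (fun x => \1_A x * f n x) = E (fun x => \1_A x * u x)) ->
  \forall x \ae P, f ^~ x @ \oo --> u x.
Proof.
move=> Iu mf fc fu; have [Wf If Ef] := mf.
have mfn n := Int_meas (If n).
have cf := mart_cvg HF mf fc.
have [G [IG G0 hG]] := mx_L1 mf fc.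
pose l := limf f.
have ml : measurable_fun setT l by exact: measurable_limf.
have cl : \forall x \ae P, f ^~ x @ \oo --> l x by apply: filterS cf => x; exact: limf_cvg.
have dom : \forall x \ae P, forall n, `|f n x| <= G x.
  by apply: filterS hG => x h n; apply: le_trans (mx_ge (f ^~ x) n) (h n).
have [Il _] := Ex_dct mfn ml IG cl dom.
have : l = u %[ae P].
  apply: ae_eq_filtration => // n A FA; have mA : measurable A := mF FA.
  have [| | | | |_ c1] := @Ex_dct _ _ _ P (fun n x => \1_A x * f n x) (fun x => \1_A x * l x) G.
  - by move=> m; exact: (Int_meas (Int_indM mA (If m))).
  - exact: (Int_meas (Int_indM mA Il)).
  - exact: IG.
  - by apply: filterS cl => x h; apply: cvgM => //; exact: cvg_cst.
  - apply: filterS dom => x h m; rewrite normrM.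
    by rewrite (le_trans _ (h m))// ler_piMl// indicE; case: (_ \in _); rewrite ?normr1 ?normr0.
  rewrite -(cvg_lim _ c1)//; apply/cvg_lim => //; apply: cvg_near_cst; near=> m.
  by rewrite (mart_E_le mf _ FA) ?fu//; near: m; exists n.
by move=> e; apply: filterS2 cl e => x h /(_ I) <-.
Unshelve. all: by end_near. Qed.

End martingale_closure.

(** * The norms of BMO, weak L^1 and H_1 *)

Section bmo_extraction.
Context d (Omega : measurableType d) (R : realType) (P : probability Omega R).
Variable F : nat -> set (set Omega).
Hypothesis HF : is_filtration F.
Notation E := (Ex P).
Notation Int := (Int P).
Notation W n X := (measurable_wrt (F n) X).
Notation mart := (mart P F).
Notation mof := (martingale_of P F).
Let sF n : sigma_algebra setT (F n) := filt_sigma HF n.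
Let mF n : F n `<=` measurable := filt_measurable HF (n := n).
Variables (p : R) (b : Omega -> R).
Hypothesis p1 : 1 <= p.
Notation osc n x := (b x - pred_process (mof b) n x).

Lemma pred_dl n x : mof b n x - pred_process (mof b) n x = dl (mof b ^~ x) n.
Proof. by case: n. Qed.

Lemma BMO_norm_ge0 : (0 <= BMO_norm P F p b)%E.
Proof.
apply: (@le_trans _ _ ('N[P]_+oo[cond_expe P (F 0%N) (fun x => (`|osc 0%N x| `^ p)%:E)] `^ (p^-1))%E).
  exact: poweR_ge0.
by apply: ereal_sup_ubound; exists 0%N.
Qed.

Lemma BMO_osc K : b \in Lfun P 1 -> (BMO_norm P F p b <= K%:E)%E ->
  forall n, Int (fun x => `|osc n x| `^ p) /\ forall A, F n A ->
    E (fun x => \1_A x * `|osc n x| `^ p) <= K `^ p * E (\1_A).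
Proof.
move=> Lb bK n; have Ib : Int b by apply/Lfun1_integrable.
have p0 : 0 < p by exact: lt_le_trans ltr01 p1.
have mb : measurable_fun setT (pred_process (mof b) n).
  by case: n => [|n]; [exact: measurable_cst|exact: Int_meas (mof_Int HF _ Ib)].
apply: (cond_expe_Linfty (sF n) (mF (n := n))).
- apply: (measurableT_comp (measurable_powR p)).
  by apply: measurable_norm; apply: measurable_funB => //; exact: Int_meas Ib.
- by move=> x; exact: powR_ge0.
have h : ('N[P]_+oo[cond_expe P (F n) (fun x => (`|osc n x| `^ p)%:E)] `^ (p^-1) <= K%:E)%E.
  by apply: le_trans bK; apply: ereal_sup_ubound; exists n.
have K0 : 0 <= K by rewrite -lee_fin; apply: le_trans h; exact: poweR_ge0.
move: h; set N := Lnorm _ _ _; have N0 : (0 <= N)%E by exact: Lnorm_ge0.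
move=> h; rewrite -[N]poweRe1// -(@mulVf _ p (negbT (gt_eqF p0))) poweRrM -poweR_EFin.
by apply: gt0_ler_poweR => //; rewrite ?in_itv/= ?leey ?andbT ?poweR_ge0 ?lee_fin// ltW.
Qed.

Lemma le_1powR (y : R) : 0 <= y -> y <= 1 + y `^ p.
Proof.
move=> y0; case: (leP y 1) => h; first by have := powR_ge0 y p; lra.
have : y `^ 1 <= y `^ p by apply: ler_powR => //; exact: ltW.
by rewrite powRr1//; lra.
Qed.

(** The term n = 0 suffices: there the oscillation is b itself, because b_{-1} = 0. *)
Lemma BMO_norm_gt0 : b \in Lfun P 1 -> ~ (b = cst 0 %[ae P]) -> (0 < BMO_norm P F p b)%E.
Proof.
move=> Lb nb; rewrite lt0e BMO_norm_ge0 andbT; apply/eqP => b0; apply: nb.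
have Ib : Int b by apply/Lfun1_integrable.
have p0 : p != 0 by rewrite gt_eqF// (lt_le_trans ltr01 p1).
have [|IO EO] := @BMO_osc 0 Lb _ 0%N; first by rewrite b0.
have := EO setT (filt_setT HF 0); rewrite powR0// mul0r => h.
have : (fun x => `|osc 0%N x| `^ p) = cst 0 %[ae P].
  apply: Ex_eq0 => //.
  apply/eqP; rewrite eq_le; apply/andP; split.
    by apply: le_trans h; rewrite le_eqVlt; apply/orP; left; apply/eqP;
       apply: eq_Ex => x; rewrite indicE in_setT mul1r.
  by apply: Ex_ge0 => x; exact: powR_ge0.
apply: filterS => x /= /[apply] /eqP; rewrite powR_eq0 p0 andbT normr_eq0 /= subr0.
by move=> /eqP.
Qed.

(** The increments of E_n b are bounded by B only almost everywhere; clamping them gives a version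
    bounded everywhere. The norm measures oscillation from b_{m-1} and [bmo_process] from b_m; the
    jump between them doubles the constant. *)
Lemma in_BMO_process : in_BMO P F p b -> exists B (bt : nat -> Omega -> R),
  [/\ bmo_process P F B bt, forall n, bt n = mof b n %[ae P] &
   forall n A, F n A -> E (fun x => \1_A x * bt n x) = E (fun x => \1_A x * b x)].
Proof.
move=> [Lb bfin]; have Ib : Int b by apply/Lfun1_integrable.
have mb : measurable_fun setT b by exact: Int_meas Ib.
have [K bK] : exists K, (BMO_norm P F p b <= K%:E)%E.
  exists (fine (BMO_norm P F p b)); rewrite fineK// ge0_fin_numE//; exact: BMO_norm_ge0.
(* The p-th powers are traded for first powers by y <= 1 + y^p, at the price of homogeneity in b. *)
pose B := 1 + K `^ p.
have B0 : 0 <= B by rewrite addr_ge0// powR_ge0.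
have Ip n : Int (pred_process (mof b) n).
  by case: n => [|n]; [exact: Int_cst|exact: mof_Int].
have Io n : Int (fun x => osc n x) by apply: IntB.
have I1 n A : F n A -> Int (\1_A).
  by move=> FA; have := Int_indM (mF FA) (Int_cst P 1); under eq_fun do rewrite mulr1.
have i0 (A : set Omega) x : 0 <= \1_A x :> R by rewrite indicE.
have oscB n A : F n A -> E (fun x => \1_A x * `|osc n x|) <= B * E (\1_A).
  move=> FA; have [IO EO] := BMO_osc Lb bK n; have mA : measurable A := mF FA.
  rewrite /B mulrDl mul1r; apply: le_trans (lerD (lexx _) (EO A FA)).
  rewrite -ExD; [|exact: I1 FA|exact: Int_indM].
  apply: Ex_le; [by apply: Int_indM => //; exact: Int_norm|by apply: IntD; [exact: I1 FA|exact: Int_indM]|].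
  by move=> x; have := ler_wpM2l (i0 A x) (le_1powR (normr_ge0 (osc n x))); lra.
have Wp n : W n (pred_process (mof b) n).
  case: n => [|n]; first exact: measurable_cst.
  by apply: (W_le HF (leqnSn n)); exact: mof_W.
have mm := mof_mart HF Ib.
have ID n : Int (fun x => dl (mof b ^~ x) n) := mart_Int_dl n mm.
have WD n : W n (fun x => dl (mof b ^~ x) n).
  by apply: (W_dl HF) => k; exact: mof_W.
have ED n A : F n A -> E (fun x => \1_A x * dl (mof b ^~ x) n) = E (fun x => \1_A x * osc n x).
  move=> FA; have mA : measurable A := mF FA.
  rewrite (eq_Ex _ (g := fun x => \1_A x * mof b n x - \1_A x * pred_process (mof b) n x)); last first.
    by move=> x; rewrite -pred_dl mulrBr.
  rewrite (eq_Ex _ (f := fun x => \1_A x * osc n x) (g := fun x => \1_A x * b x - \1_A x * pred_process (mof b) n x)); last first.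
    by move=> x; rewrite mulrBr.
  by rewrite !ExB ?mof_E//; apply: Int_indM => //; exact: mof_Int.
have absD n A : F n A -> `|E (fun x => \1_A x * dl (mof b ^~ x) n)| <= B * E (\1_A).
  move=> FA; have mA : measurable A := mF FA; rewrite ED//.
  apply: le_trans (oscB n A FA); apply: le_trans (Ex_norm (Int_indM mA (Io n))) _.
  rewrite le_eqVlt; apply/orP; left; apply/eqP; apply: eq_Ex => x.
  by rewrite normrM (ger0_norm (i0 A x)).
have bdD n : \forall x \ae P, `|dl (mof b ^~ x) n| <= B.
  have h1 : \forall x \ae P, 0 <= B - dl (mof b ^~ x) n.
    apply: (wrt_ge0 (sF n) (mF (n := n))).
    - by apply: measurable_funB; [exact: measurable_cst|exact: WD].
    - by apply: IntB => //; exact: Int_cst.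
    - move=> A FA; have mA : measurable A := mF FA.
      rewrite (eq_Ex _ (g := fun x => B * \1_A x - \1_A x * dl (mof b ^~ x) n)); last by move=> x; ring.
      rewrite ExB; [|apply: IntZ; exact: I1 FA|exact: Int_indM].
      rewrite ExZ; last exact: I1 FA.
      by have := absD n A FA; rewrite ler_norml => /andP[]; lra.
  have h2 : \forall x \ae P, 0 <= B + dl (mof b ^~ x) n.
    apply: (wrt_ge0 (sF n) (mF (n := n))).
    - by apply: measurable_funD; [exact: measurable_cst|exact: WD].
    - by apply: IntD => //; exact: Int_cst.
    - move=> A FA; have mA : measurable A := mF FA.
      rewrite (eq_Ex _ (g := fun x => B * \1_A x + \1_A x * dl (mof b ^~ x) n)); last by move=> x; ring.
      rewrite ExD; [|apply: IntZ; exact: I1 FA|exact: Int_indM].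
      rewrite ExZ; last exact: I1 FA.
      by have := absD n A FA; rewrite ler_norml => /andP[]; lra.
  by apply: filterS2 h1 h2 => x h1 h2; rewrite ler_norml; apply/andP; split; lra.
pose bt n x := \sum_(k < n.+1) clamp B (dl (mof b ^~ x) k).
have dlbt n x : dl (bt ^~ x) n = clamp B (dl (mof b ^~ x) n).
  rewrite {1}/dl /bt; case: n => [|n]; first by rewrite big_ord1 subr0.
  by rewrite big_ord_recr /= addrAC subrr add0r.
have aeb n : bt n = mof b n %[ae P].
  have h : \forall x \ae P, forall k, `|dl (mof b ^~ x) k| <= B by apply: ae_foralln.
  apply: filterS h => x h _; rewrite /bt -(sum_dl (mof b ^~ x)).
  by apply: eq_bigr => k _; exact: clamp_id.
have Wc n : W n (fun x => clamp B (dl (mof b ^~ x) n)) by apply: measurable_clamp; exact: WD.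
have Wbt n : W n (bt n).
  by apply: measurable_sum => k; apply: (W_le HF _ (Wc k)); rewrite -ltnS.
have Ic n : Int (fun x => clamp B (dl (mof b ^~ x) n)).
  by apply: (@Int_bd _ _ _ _ B); [exact: (W_meas HF (Wc n))|move=> x; exact: clamp_bd].
have Ibt n : Int (bt n) by apply: Int_sum.
have Ebt n A : F n A -> E (fun x => \1_A x * bt n x) = E (fun x => \1_A x * b x).
  move=> FA; have mA : measurable A := mF FA; rewrite -(mof_E HF Ib FA); apply: ae_eq_Ex.
  - exact: (Int_meas (Int_indM mA (Ibt n))).
  - exact: (Int_meas (Int_indM mA (mof_Int HF n Ib))).
  - by apply: filterS (aeb n) => x /= /[apply] ->.
have mbt : mart bt.
  split => // n A FA; have mA : measurable A := mF FA.
  under eq_Ex do rewrite mulrBr.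
  rewrite ExB; [|exact: Int_indM..].
  by rewrite !Ebt ?subrr//; exact: (filt_le HF (leqnSn n)).
exists (2 * B), bt; split => //; split => //.
  by move=> n x; rewrite dlbt (le_trans (clamp_bd _ B0))//; lra.
move=> m n A mn FA; have mA : measurable A := mF FA.
pose y x := mof b n x - pred_process (mof b) m x.
have Wy : W n y by apply: measurable_funB; [exact: mof_W|exact: (W_le HF mn)].
have Iy : Int y by apply: IntB => //; exact: mof_Int.
have step1 : E (fun x => \1_A x * `|y x|) <= B * E (\1_A).
  apply: le_trans (oscB m A FA).
  pose X x := \1_A x * Num.sg (y x).
  have WX : W n X.
    apply: measurable_funM; last exact: measurable_sgr.
    by apply: (W_le HF mn); exact: (wrt_indic (sF m) FA).
  have X1 x : `|X x| <= 1.
    rewrite /X normrM; apply: mulr_ile1 => //; last exact: sgr_bd.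
    by rewrite indicE; case: (_ \in _); rewrite ?normr1 ?normr0.
  have IXb : Int (fun x => X x * b x) by apply: IntMb X1 => //; exact: (W_meas HF WX).
  have IXm : Int (fun x => X x * mof b n x) by apply: IntMb X1; [exact: mof_Int|exact: (W_meas HF WX)].
  have IXp : Int (fun x => X x * pred_process (mof b) m x) by apply: IntMb X1 => //; exact: (W_meas HF WX).
  rewrite (eq_Ex _ (g := fun x => X x * mof b n x - X x * pred_process (mof b) m x)); last first.
    by move=> x; rewrite -mulrBr -/(y x) /X -mulrA -normrEsg.
  rewrite ExB// (mof_mulE HF Ib WX X1) -ExB//.
  apply: Ex_le; [exact: IntB|by apply: Int_indM => //; exact: Int_norm|].
  move=> x; rewrite -mulrBr /X -mulrA ler_wpM2l//.
  by apply: le_trans (ler_norm _) _; rewrite normrM ler_piMl// sgr_bd.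
apply: (@le_trans _ _ (E (fun x => \1_A x * `|y x| + B * \1_A x))).
  rewrite (@ae_eq_Ex _ _ _ P _ (fun x => \1_A x * `|mof b n x - mof b m x|)); last first.
  - apply: filterS2 (aeb n) (aeb m) => x h1 h2 _.
    by rewrite (h1 I) (h2 I).
  - exact: Int_meas (Int_indM mA (Int_norm (IntB (mof_Int HF n Ib) (mof_Int HF m Ib)))).
  - exact: Int_meas (Int_indM mA (Int_norm (IntB (Ibt n) (Ibt m)))).
  (* The comparison |b_n - b_m| <= |y| + B holds almost everywhere; taking the minimum turns it into
     an inequality at every point, as [Ex_le] requires. *)
  rewrite (@ae_eq_Ex _ _ _ P _ (fun x => \1_A x * Num.min `|mof b n x - mof b m x| (`|y x| + B))); last first.
  - apply: filterS (bdD m) => x h _; congr (_ * _); apply/esym/min_idPl.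
    rewrite -pred_dl in h; rewrite /y.
    have := ler_normB (mof b n x - pred_process (mof b) m x) (mof b m x - pred_process (mof b) m x).
    rewrite opprB addrA subrK; lra.
  - apply: measurable_funM; first exact: measurable_indic.
    apply: measurable_minr.
      exact: Int_meas (Int_norm (IntB (mof_Int HF n Ib) (mof_Int HF m Ib))).
    by apply: measurable_funD; [exact: Int_meas (Int_norm Iy)|exact: measurable_cst].
  - exact: Int_meas (Int_indM mA (Int_norm (IntB (mof_Int HF n Ib) (mof_Int HF m Ib)))).
  apply: Ex_le.
  - apply: Int_indM => //; apply: (@Int_le _ _ _ _ _ (fun x => `|mof b n x - mof b m x|)).
    + apply: measurable_minr.
        exact: Int_meas (Int_norm (IntB (mof_Int HF n Ib) (mof_Int HF m Ib))).
      by apply: measurable_funD; [exact: Int_meas (Int_norm Iy)|exact: measurable_cst].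
    + move=> x; rewrite ger0_norm; first by rewrite ge_min lexx.
      by rewrite le_min normr_ge0 addr_ge0.
    + exact: Int_norm (IntB (mof_Int HF n Ib) (mof_Int HF m Ib)).
  - by apply: IntD; [apply: Int_indM => //; exact: Int_norm|apply: IntZ; exact: I1 FA].
  move=> x; rewrite [B * _]mulrC -mulrDr ler_wpM2l//.
  by rewrite ge_min lexx orbT.
rewrite ExD; [|by apply: Int_indM => //; exact: Int_norm|apply: IntZ; exact: I1 FA].
rewrite ExZ; last exact: I1 FA.
lra.
Qed.

End bmo_extraction.

(** * The weak L^1 quasi-norm *)

Section ereal_cvg0.
Variable R : realType.
Implicit Types u : nat -> \bar R.

Lemma cvge0_le u e : u @ \oo --> 0%E -> (0 < e)%R -> \forall n \near \oo, (u n <= e%:E)%E.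
Proof.
move=> /fine_cvgP[fin /cvgrPdist_lt h] e0; near=> n.
have fn : u n \is a fin_num by near: n.
have : `|0 - fine (u n)| < e by near: n; exact: h.
rewrite sub0r normrN => hn; rewrite -(fineK fn) lee_fin.
by rewrite (le_trans (ler_norm _))// ltW.
Unshelve. all: by end_near. Qed.

Lemma le_cvge0 u : (forall n, (0 <= u n)%E) ->
  (forall e : R, 0 < e -> \forall n \near \oo, (u n <= e%:E)%E) -> u @ \oo --> 0%E.
Proof.
move=> u0 h; apply/fine_cvgP; split.
  near=> n; rewrite ge0_fin_numE//; apply: (@le_lt_trans _ _ 1%:E); last exact: ltry.
  by near: n; exact: h.
apply/cvgrPdist_le => e e0; near=> n.
rewrite /= sub0r normrN ger0_norm ?fine_ge0//.
have un : (u n <= e%:E)%E by near: n; exact: h.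
by rewrite -lee_fin fineK// ge0_fin_numE//; exact: le_lt_trans un (ltry _).
Unshelve. all: by end_near. Qed.

End ereal_cvg0.

Section weak_norm.
Context d (Omega : measurableType d) (R : realType) (P : probability Omega R).
Hypothesis cP : measure_is_complete P.
Notation E := (Ex P).
Notation pr A := (fine (P A)).

(** This is where completeness of P enters: the commutator of an L^2 function is known only to agree
    almost everywhere with a measurable function. *)
Lemma ae_measurable (f g : Omega -> R) : f = g %[ae P] -> measurable_fun setT f ->
  measurable_fun setT g.
Proof.
move=> fg mf; apply/measurable_EFinP; apply: (ae_measurable_fun cP (f := EFin \o f)).
  by apply: filterS fg => x /= /[apply] ->.
exact/measurable_EFinP.
Qed.

Lemma weakL1_le (f : Omega -> R) c : measurable_fun setT f ->
  (forall t, 0 < t -> t * pr [set x | t < `|f x| ] <= c) -> (weakL1_norm P f <= c%:E)%E.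
Proof.
move=> mf h; apply: ge_ereal_sup => _ [t t0 <-].
have mA : measurable [set x | t < `|f x| ] by apply: measurable_gt; exact: measurable_norm.
by rewrite -[P _]fineK ?fin_num_measure// -EFinM lee_fin; exact: h.
Qed.

Lemma weakL1_ge (f : Omega -> R) c t : measurable_fun setT f -> 0 < t ->
  (weakL1_norm P f <= c%:E)%E -> t * pr [set x | t < `|f x| ] <= c.
Proof.
move=> mf t0 h; have mA : measurable [set x | t < `|f x| ] by apply: measurable_gt; exact: measurable_norm.
rewrite -lee_fin EFinM fineK ?fin_num_measure//; apply: le_trans h.
by apply: ereal_sup_ubound; exists t.
Qed.

Lemma weakL1_ge0 (f : Omega -> R) : (0 <= weakL1_norm P f)%E.
Proof.
have h : (1%:E * P [set x | (1 < `|f x|)%R] <= weakL1_norm P f)%E.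
  by apply: ereal_sup_ubound; exists 1 => //=; exact: ltr01.
by apply: le_trans h; rewrite mul1e measure_ge0.
Qed.

Lemma ae_weakL1 (f g : Omega -> R) : measurable_fun setT g -> f = g %[ae P] ->
  weakL1_norm P f = weakL1_norm P g.
Proof.
move=> mg fg; have mf : measurable_fun setT f.
  by apply: ae_measurable mg; apply: filterS fg => x /[apply].
rewrite /weakL1_norm; congr ereal_sup; apply/seteqP.
have key t : P [set x | t < `|f x| ] = P [set x | t < `|g x| ].
  have mF : measurable [set x | t < `|f x| ] by apply: measurable_gt; exact: measurable_norm.
  have mG : measurable [set x | t < `|g x| ] by apply: measurable_gt; exact: measurable_norm.
  have [N [mN N0 NP]] := fg.
  have le (A B : set Omega) : measurable A -> measurable B -> (forall x, ~ N x -> A x -> B x) -> (P A <= P B)%E.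
    move=> mA mB AB; rewrite -[leRHS]adde0 -N0; apply: le_trans (measureU2 P mB mN).
    apply: le_measure; rewrite ?inE//; first exact: measurableU.
    by move=> x Ax; have [Nx|Nx] := pselect (N x); [right|left; exact: AB].
  have eqN x : ~ N x -> f x = g x.
    by move=> Nx; apply: contrapT => h; apply: Nx; apply: NP => /= /(_ I).
  by apply/eqP; rewrite eq_le !le//= => x Nx; rewrite /= eqN.
by split => _ [t t0 <-]; exists t => //; rewrite key.
Qed.

Lemma weakL1_eq0 (f : Omega -> R) : measurable_fun setT f ->
  (forall t, 0 < t -> pr [set x | t < `|f x| ] = 0) -> f = cst 0 %[ae P].
Proof.
move=> mf h; have mA t : measurable [set x | t < `|f x| ].
  by apply: measurable_gt; exact: measurable_norm.
have : P.-negligible (\bigcup_n [set x | n.+1%:R^-1 < `|f x| ]).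
  apply: negligible_bigcup => n; apply/negligibleP => //.
  by rewrite -[LHS]fineK ?fin_num_measure// h// invr_gt0.
apply: negligibleS => x /= nx; apply: contrapT => nB; apply: nx => _.
apply/eqP; rewrite -normr_eq0; apply: contrapT => /negP fx0; apply: nB.
have fp : 0 < `|f x| by rewrite lt_neqAle eq_sym fx0 normr_ge0.
have [i _ /(_ i (leqnn i)) ie] := near_infty_natSinv_lt (PosNum fp).
by exists i.
Qed.

(** The weak norm satisfies only a quasi-triangle inequality, so the event |f - g| > t is split at
    the level t / 2. *)
Lemma weakL1_uniq (c : nat -> Omega -> R) (f g : Omega -> R) :
  (forall k, measurable_fun setT (c k)) -> measurable_fun setT f -> measurable_fun setT g ->
  weakL1_norm P (c k \- f) @[k --> \oo] --> 0%E ->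
  weakL1_norm P (c k \- g) @[k --> \oo] --> 0%E -> f = g %[ae P].
Proof.
move=> mc mf mg cf cg.
have : (fun x => f x - g x) = cst 0 %[ae P]; last first.
  by apply: filterS => x /= /[apply] /eqP; rewrite subr_eq0 => /eqP.
apply: weakL1_eq0; first exact: measurable_funB.
move=> t t0; apply/eqP; rewrite eq_le fine_ge0 ?measure_ge0// andbT.
apply/ler_addgt0Pl => e e0; rewrite addr0.
have e'0 : 0 < t / 2 * (e / 2) by rewrite mulr_gt0//; lra.
have t20 : 0 < t / 2 by lra.
have [k h1 h2] : exists2 k, (weakL1_norm P (c k \- f)%R <= (t / 2 * (e / 2))%:E)%E &
   (weakL1_norm P (c k \- g)%R <= (t / 2 * (e / 2))%:E)%E.
  have [n1 _ hn1] := cvge0_le cf e'0; have [n2 _ hn2] := cvge0_le cg e'0.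
  by exists (maxn n1 n2); [apply: hn1; exact: leq_maxl|apply: hn2; exact: leq_maxr].
have mf' : measurable_fun setT (c k \- f) by exact: measurable_funB.
have mg' : measurable_fun setT (c k \- g) by exact: measurable_funB.
have := weakL1_ge mf' t20 h1; have := weakL1_ge mg' t20 h2.
rewrite !ler_pM2l//.
have mS (h : Omega -> R) s : measurable_fun setT h -> measurable [set x | s < `|h x| ].
  by move=> mh; apply: measurable_gt; exact: measurable_norm.
have : pr [set x | t < `|f x - g x| ] <= pr [set x | t / 2 < `|c k x - f x| ] + pr [set x | t / 2 < `|c k x - g x| ].
  apply: pr_leU; try exact: mS.
  - by apply: mS; exact: measurable_funB.
  - move=> x /= h.
    have [h'|h'] := ltP (t / 2) (`|c k x - f x|); first by left.
    right; have := ler_normB (c k x - g x) (c k x - f x).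
    have -> : c k x - g x - (c k x - f x) = f x - g x by ring.
    lra.
rewrite /=; lra.
Qed.

End weak_norm.

(** * The H_1 norm on finite horizons and the density of L^2 *)

Section H1_norm.
Context d (Omega : measurableType d) (R : realType) (P : probability Omega R).
Variable F : nat -> set (set Omega).
Hypothesis HF : is_filtration F.
Notation E := (Ex P).
Notation Int := (Int P).
Notation W n X := (measurable_wrt (F n) X).
Notation mart := (mart P F).
Notation mof := (martingale_of P F).
Implicit Types f g : nat -> Omega -> R.
Let mF n : F n `<=` measurable := filt_measurable HF (n := n).

Lemma diff_seqE f n x : diff_seq f n x = dl (f ^~ x) n.
Proof. by rewrite /diff_seq /dl; case: n. Qed.

Lemma partial_qv f N x :
  (\sum_(0 <= n < N.+1) (`|diff_seq f n x| ^+ 2)%:E)%E = (qv (f ^~ x) N)%:E.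
Proof.
rewrite sumEFin /qv big_mkord; congr EFin; apply: eq_bigr => k _.
by rewrite diff_seqE real_normK// num_real.
Qed.

Lemma sq_le_square_function f N x : ((sq (f ^~ x) N)%:E <= square_function f x)%E.
Proof.
rewrite /sq -powR12_sqrt ?qv_ge0// -poweR_EFin /square_function.
have h : ((qv (f ^~ x) N)%:E <= \sum_(0 <= n <oo) (`|diff_seq f n x| ^+ 2)%:E)%E.
  by rewrite -partial_qv; apply: nneseries_lim_ge => k _ _; rewrite lee_fin sqr_ge0.
apply: gt0_ler_poweR => //; rewrite ?invr_ge0// in_itv/= ?leey ?andbT ?lee_fin ?qv_ge0//.
by apply: le_trans h; rewrite lee_fin qv_ge0.
Qed.

Lemma square_function_le f x c : 0 <= c -> (forall N, sq (f ^~ x) N <= c) ->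
  (square_function f x <= c%:E)%E.
Proof.
move=> c0 h; rewrite /square_function.
have -> : c%:E = ((c ^+ 2)%:E `^ (2^-1))%E.
  by rewrite poweR_EFin powR12_sqrt ?sqr_ge0// sqrtr_sqr ger0_norm.
have pos n : (0 <= n)%N -> xpredT n -> (0 <= (`|diff_seq f n x| ^+ 2)%:E)%E.
  by rewrite lee_fin sqr_ge0.
apply: gt0_ler_poweR => //; rewrite ?invr_ge0// ?in_itv/= ?leey ?andbT ?lee_fin ?sqr_ge0//.
  by apply: nneseries_ge0 => n _ _; exact: pos.
apply: lime_le; first by apply: is_cvg_nneseries => n _ _; exact: pos.
apply: nearW => -[|N]; first by rewrite big_geq// lee_fin sqr_ge0.
by rewrite partial_qv lee_fin -sq_sqr ler_sqr ?nnegrE ?sq_ge0.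
Qed.

Lemma measurable_square_function f : (forall n, measurable_fun setT (f n)) ->
  measurable_fun setT (square_function f).
Proof.
move=> mf; apply: (measurableT_comp (measurable_poweR _)).
apply: (@ge0_emeasurable_sum _ _ _ setT (fun k x => (`|diff_seq f k x| ^+ 2)%:E) xpredT) => [k x _ _|k _].
  by rewrite lee_fin sqr_ge0.
apply/measurable_EFinP; apply: measurable_funX; apply: measurable_norm.
rewrite (_ : diff_seq f k = (fun x => dl (f ^~ x) k)); first exact: measurable_dl.
by apply/funext => x; exact: diff_seqE.
Qed.

Lemma square_function_ge0 f x : (0 <= square_function f x)%E.
Proof. exact: poweR_ge0. Qed.

Lemma H1_normE f : (H1_norm P f = \int[P]_x square_function f x)%E.
Proof.
rewrite /H1_norm Lnorm1; apply: eq_integral => x _.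
by rewrite gee0_abs// square_function_ge0.
Qed.

Lemma H1_norm_ge f N : mart f -> ((E (fun x => sq (f ^~ x) N))%:E <= H1_norm P f)%E.
Proof.
move=> mf; have [Wf If Ef] := mf; have Isq := mart_Int_sq N mf.
rewrite H1_normE -ExE//; apply: ge0_le_integral => //.
- by move=> x _; rewrite lee_fin sq_ge0.
- by apply/measurable_EFinP; exact: Int_meas Isq.
- by apply: measurable_square_function => n; exact: Int_meas (If n).
- by move=> x _; exact: sq_le_square_function.
Qed.

Lemma H1_norm_le f c : mart f -> (forall N, E (fun x => sq (f ^~ x) N) <= c) ->
  (H1_norm P f <= c%:E)%E.
Proof.
move=> mf fc; have [Wf If Ef] := mf.
have [|||| G [IG EG G0 hG]] := @monotone_L1 _ _ _ P (fun n x => sq (f ^~ x) n) c.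
- by move=> n; exact: mart_Int_sq mf.
- by move=> n x; exact: sq_ge0.
- by move=> n x; exact: sq_mono.
- exact: fc.
apply: (@le_trans _ _ (E G)%:E); last by rewrite lee_fin.
rewrite H1_normE -ExE//; apply: ae_ge0_le_integral => //.
- by move=> x _; exact: square_function_ge0.
- by apply: measurable_square_function => n; exact: Int_meas (If n).
- by move=> x _; rewrite lee_fin.
- by apply/measurable_EFinP; exact: Int_meas IG.
- by apply: filterS hG => x [_ h] _; apply: square_function_le.
Qed.

Lemma H1_norm_ge0 f : (0 <= H1_norm P f)%E. Proof. exact: Lnorm_ge0. Qed.

Lemma H1_norm_fin f : mart f -> (H1_norm P f < +oo)%E ->
  forall N, E (fun x => sq (f ^~ x) N) <= fine (H1_norm P f).
Proof.
move=> mf fin N; rewrite -lee_fin [leRHS]fineK; first exact: H1_norm_ge.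
by rewrite ge0_fin_numE// H1_norm_ge0.
Qed.

(** Meant for g = E_n u - f_n with u measurable at time N and t the tail of f: after N the
    increments of g are those of -f. *)
Lemma sq_split (g t : nat -> R) N M : (forall k, (k <= N)%N -> dl t k = 0) ->
  (forall k, (N < k)%N -> dl g k = - dl t k) ->
  sq g M <= \sum_(k < N.+1) `|dl g k| + sq t M.
Proof.
move=> t0 gt.
have h : qv g M <= (\sum_(k < N.+1) `|dl g k|) ^+ 2 + qv t M.
  apply: (@le_trans _ _ (qv g N + qv t M)); last first.
    by rewrite lerD2r -sq_sqr ler_sqr ?nnegrE ?sq_ge0 ?sumr_ge0// sq_le_sum.
  elim: M => [|M IH].
    have : qv g 0 <= qv g N by rewrite -!sq_sqr ler_sqr ?nnegrE ?sq_ge0// sq_mono.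
    by have := qv_ge0 t 0; lra.
  case: (leqP M.+1 N) => MN.
    have : qv g M.+1 <= qv g N by rewrite -!sq_sqr ler_sqr ?nnegrE ?sq_ge0// sq_mono.
    by have := qv_ge0 t M.+1; lra.
  by rewrite !qvS gt// sqrrN; lra.
set s := \sum_(k < N.+1) _ in h *; have s0 : 0 <= s by apply: sumr_ge0.
rewrite -[leRHS]ger0_norm ?addr_ge0 ?sq_ge0// -sqrtr_sqr ler_wsqrtr//.
by apply: le_trans h _; rewrite -sq_sqr; have := sq_ge0 t M; nra.
Qed.

Lemma bounded_Lfun2 (u : Omega -> R) c : measurable_fun setT u -> (forall x, `|u x| <= c) ->
  u \in Lfun P 2%:E.
Proof.
move=> mu uc.
have I2 : Int (fun x => u x ^+ 2).
  apply: (@Int_bd _ _ _ _ (c ^+ 2)); first exact: measurable_funX.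
  by move=> x; rewrite normrX ler_sqr ?nnegrE//; exact: le_trans (uc x).
rewrite inE; apply/andP; split; rewrite inE //= /finite_norm unlock.
apply: poweR_lty.
rewrite (_ : (\int[P]_x _)%E = (\int[P]_x (u x ^+ 2)%:E)%E); first by rewrite ExE// ltry.
by apply: eq_integral => x _; rewrite /= powR_mulrn// real_normK// num_real.
Qed.

Lemma Lfun2_Int (u : Omega -> R) : u \in Lfun P 2%:E -> Int u /\ Int (fun x => u x ^+ 2).
Proof.
move=> Lu; have I2 : Int (fun x => u x ^+ 2) := Lfun2_integrable_sqr Lu.
split => //; apply: (@Int_le _ _ _ _ _ (fun x => 1 + u x ^+ 2)).
- by move: Lu; rewrite inE => /andP[/[!inE]].
- move=> x; rewrite -(real_normK (num_real (u x))).
  have := sqr_ge0 (`|u x| - 1); have := sqr_ge0 (`|u x| + 1); nra.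
- by apply: IntD => //; exact: Int_cst.
Qed.

(** The approximation is a truncation of f N. Beyond N only the tail of S(f) contributes, and up to
    N there are finitely many increments, each small in L^1. *)
Lemma H1_dense f c : mart f -> (forall N, E (fun x => sq (f ^~ x) N) <= c) ->
  forall e : R, 0 < e -> exists2 u, u \in Lfun P 2%:E &
    (H1_norm P (fun n => mof u n \- f n)%R <= e%:E)%E.
Proof.
move=> mf fc e e0; have [Wf If Ef] := mf.
have [|N HN] := E_sq_tail HF mf fc (e := e / 2); first by lra.
(* N+1 increments, each of L^1 norm at most 2 [del], contribute e / 2; the tail contributes the
   other half. *)
pose del := e / (4 * N.+1%:R).
have del0 : 0 < del by rewrite divr_gt0// mulr_gt0.
have IfN := If N.
have [m hm] : exists m, E (fun x => `|f N x - clamp m%:R (f N x)|) <= del.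
  have /cvgrPdist_lt /(_ del del0) [m _ /(_ m (leqnn m))] := clamp_L1 IfN.
  rewrite /= sub0r normrN ger0_norm; last by apply: Ex_ge0.
  by move=> /ltW h; exists m.
pose u x := clamp m%:R (f N x).
have Wu : W N u by apply: measurable_clamp; exact: Wf.
have mu := W_meas HF Wu.
have ub x : `|u x| <= m%:R by exact: clamp_bd.
have Iu : Int u by exact: Int_bd ub.
exists u; first exact: bounded_Lfun2 ub.
pose g n x := mof u n x - f n x.
have mm := mof_mart HF Iu.
have mg : mart g by exact: (mart_sub HF mm mf).
have Ig n : Int (g n) by case: mg.
apply: (@H1_norm_le g) => // M.
have uN k : (N <= k)%N -> u = mof u k %[ae P].
  by move=> Nk; apply: (mof_uniq HF) => //; exact: (W_le HF Nk).
have fk k : (k <= N)%N -> f k = mof (f N) k %[ae P].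
  by move=> kN; apply: (mof_uniq HF) => // A FA; rewrite (mart_E_le HF mf kN FA).
have Eg k : (k <= N)%N -> E (fun x => `|g k x|) <= del.
  move=> kN; apply: le_trans hm.
  rewrite (@ae_eq_Ex _ _ _ P _ (fun x => `|mof (fun x => u x - f N x) k x|)); last first.
  - apply: filterS2 (mof_sub HF k Iu IfN) (fk k kN) => x h1 h2 _.
    by rewrite (h1 I) /g (h2 I).
  - by apply: measurable_norm; exact: Int_meas (mof_Int HF k (IntB Iu IfN)).
  - by apply: measurable_norm; exact: Int_meas (Ig k).
  apply: le_trans (mof_norm HF k (IntB Iu IfN)) _.
  by rewrite le_eqVlt; apply/orP; left; apply/eqP; apply: eq_Ex => x; rewrite distrC.
have Edl (k : nat) : (k <= N)%N -> E (fun x => `|dl (g ^~ x) k|) <= 2 * del.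
  case: k => [|k] kN.
    by rewrite (eq_Ex _ (g := fun x => `|g 0%N x|)); [have := Eg 0%N kN; lra|move=> x; rewrite /dl subr0].
  apply: (@le_trans _ _ (E (fun x => `|g k.+1 x| + `|g k x|))).
    apply: Ex_le; [exact: Int_norm (mart_Int_dl _ mg)|by apply: IntD; exact: Int_norm|].
    by move=> x; exact: ler_normB.
  rewrite ExD; [|exact: Int_norm..].
  by have := Eg _ kN; have := Eg k (ltnW kN); lra.
have ae_le : \forall x \ae P, sq (g ^~ x) M <= \sum_(k < N.+1) `|dl (g ^~ x) k| + sq (tail (f ^~ x) N) M.
  have h : \forall x \ae P, forall k, (N <= k)%N -> u x = mof u k x.
    apply/ae_foralln => k; case: (boolP (N <= k)%N) => [Nk|_]; last exact: aeW.
    by apply: filterS (uN k Nk) => x h _; exact: h.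
  apply: filterS h => x h; apply: sq_split => k kN.
    by rewrite dl_tail ltnNge kN.
  rewrite dl_tail kN; case: k kN => [//|k] kN.
  by rewrite /dl /g -(h k.+1 (ltnW kN)) -(h k kN); ring.
have Isum : Int (fun x => \sum_(k < N.+1) `|dl (g ^~ x) k|).
  by apply: Int_sum => k _; exact: Int_norm (mart_Int_dl _ mg).
have It := mart_Int_sq M (mart_tail HF N mf).
have Isq := mart_Int_sq M mg.
pose rhs x := \sum_(k < N.+1) `|dl (g ^~ x) k| + sq (tail (f ^~ x) N) M.
have Irhs : Int rhs by exact: IntD.
have -> : E (fun x => sq (g ^~ x) M) = E (fun x => Num.min (sq (g ^~ x) M) (rhs x)).
  apply: ae_eq_Ex; first exact: Int_meas Isq.
    by apply: measurable_minr; [exact: Int_meas Isq|exact: Int_meas Irhs].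
  by apply: filterS ae_le => x h _; apply/esym/min_idPl.
apply: (@le_trans _ _ (E rhs)).
  apply: Ex_le => //; last by move=> x; rewrite ge_min lexx orbT.
  apply: (@Int_le _ _ _ _ _ (fun x => sq (g ^~ x) M)) => //.
    by apply: measurable_minr; [exact: Int_meas Isq|exact: Int_meas Irhs].
  move=> x; rewrite ger0_norm; first by rewrite ge_min lexx.
  by rewrite le_min sq_ge0 /rhs addr_ge0 ?sq_ge0// sumr_ge0.
rewrite /rhs ExD// Ex_sum; last by move=> k _; exact: Int_norm (mart_Int_dl _ mg).
have h1 : \sum_(k < N.+1) E (fun x => `|dl (g ^~ x) k|) <= \sum_(k < N.+1) (2 * del).
  by apply: ler_sum => k _; apply: Edl; rewrite -ltnS.
have h2 : \sum_(k < N.+1) (2 * del) = e / 2.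
  by rewrite sumr_const card_ord /del -mulr_natr; field; rewrite nat1r pnatr_eq0.
have := HN M; lra.
Qed.

Lemma L2_approx_ex f c : mart f -> (forall N, E (fun x => sq (f ^~ x) N) <= c) ->
  exists u, L2_approx P F u f.
Proof.
move=> mf fc.
have h k : {u | u \in Lfun P 2%:E & (H1_norm P (fun n => mof u n \- f n)%R <= (k.+1%:R^-1)%:E)%E}.
  by apply: cid2; apply: (H1_dense mf fc); rewrite invr_gt0.
exists (fun k => s2val (h k)); split; first by move=> k; exact: (s2valP (h k)).
apply: le_cvge0 => [k|e e0]; first exact: H1_norm_ge0.
near=> k; apply: le_trans (s2valP' (h k)) _; rewrite lee_fin ltW//.
by near: k; exact: (near_infty_natSinv_lt (PosNum e0)).
Unshelve. all: by end_near. Qed.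

End H1_norm.

(** * Commutators *)

Section commutator_extension.
Context d (Omega : measurableType d) (R : realType) (P : probability Omega R).
Hypothesis cP : measure_is_complete P.
Variable F : nat -> set (set Omega).
Hypothesis HF : is_filtration F.
Notation E := (Ex P).
Notation Int := (Int P).
Notation pr A := (fine (P A)).
Notation mart := (mart P F).
Notation mof := (martingale_of P F).
Implicit Types f g : nat -> Omega -> R.

(** The form in which H_1 bounds are carried around: for a martingale, [H1_norm_le] and [H1_norm_ge]
    make it equivalent to |f|_{H_1} <= c. *)
Definition H1_bdd (c : R) f := mart f /\ forall N, E (fun x => sq (f ^~ x) N) <= c.

(** Minkowski's inequality for S_N along each path, by induction on N; [h1] is the Cauchy-Schwarz
    inequality in the plane that the step requires. *)
Lemma H1_bdd_sub c c' f g : H1_bdd c f -> H1_bdd c' g ->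
  H1_bdd (c + c') (fun n x => f n x - g n x).
Proof.
move=> [mf fc] [mg gc]; split; first exact: mart_sub.
move=> N; apply: (@le_trans _ _ (E (fun x => sq (f ^~ x) N + sq (g ^~ x) N))); last first.
  by rewrite ExD; [rewrite lerD|exact: (mart_Int_sq N mf)|exact: (mart_Int_sq N mg)].
have mfg := mart_sub HF mf mg.
apply: Ex_le; [exact: (mart_Int_sq N mfg)|by apply: IntD; [exact: (mart_Int_sq N mf)|exact: (mart_Int_sq N mg)]|].
move=> x.
suff h : qv (fun n => f n x - g n x) N <= (sq (f ^~ x) N + sq (g ^~ x) N) ^+ 2.
  rewrite -[leRHS]ger0_norm ?addr_ge0 ?sq_ge0// -sqrtr_sqr; exact: ler_wsqrtr.
have dlB n : dl (fun n => f n x - g n x) n = dl (f ^~ x) n - dl (g ^~ x) n.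
  by rewrite /dl; case: n => [|n]; ring.
rewrite sqrrD !sq_sqr; elim: N => [|N IH].
  rewrite !qv0 /= -[f 0%N x ^+ 2](real_normK (num_real _)) -[g 0%N x ^+ 2](real_normK (num_real _)).
  rewrite /sq !qv0 !sqrtr_sqr -[(f 0%N x - g 0%N x) ^+ 2](real_normK (num_real _)).
  have := ler_normB (f 0%N x) (g 0%N x); have := normr_ge0 (f 0%N x - g 0%N x).
  move: `|_ - _| `|f _ _| `|g _ _| => u v w; rewrite mulr2n; nra.
rewrite !qvS dlB.
have h1 : sq (f ^~ x) N * sq (g ^~ x) N + `|dl (f ^~ x) N.+1 * dl (g ^~ x) N.+1| <=
    sq (f ^~ x) N.+1 * sq (g ^~ x) N.+1.
  have e1 : sq (f ^~ x) N.+1 ^+ 2 = sq (f ^~ x) N ^+ 2 + dl (f ^~ x) N.+1 ^+ 2 by rewrite !sq_sqr qvS.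
  have e2 : sq (g ^~ x) N.+1 ^+ 2 = sq (g ^~ x) N ^+ 2 + dl (g ^~ x) N.+1 ^+ 2 by rewrite !sq_sqr qvS.
  have p0 := sq_ge0 (f ^~ x) N.+1; have q0 := sq_ge0 (g ^~ x) N.+1.
  have := sq_ge0 (f ^~ x) N; have := sq_ge0 (g ^~ x) N.
  rewrite normrM; move: e1 e2; rewrite -![dl _ _ ^+ 2](real_normK (num_real _)).
  have := normr_ge0 (dl (f ^~ x) N.+1); have := normr_ge0 (dl (g ^~ x) N.+1).
  move: `|dl (f ^~ x) _| `|dl (g ^~ x) _| p0 q0.
  move: (sq (f ^~ x) N.+1) (sq (g ^~ x) N.+1) (sq (f ^~ x) N) (sq (g ^~ x) N) => p q u v a b p0 q0 b0 a0 e1 e2 v0 u0.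
  rewrite -ler_sqr ?nnegrE ?mulr_ge0 ?addr_ge0 ?mulr_ge0//.
  rewrite [(p * q) ^+ 2]exprMn e1 e2; have := sqr_ge0 (a * v - b * u); nra.
have := ler_norm (- (dl (f ^~ x) N.+1 * dl (g ^~ x) N.+1)); rewrite normrN.
rewrite sqrrB; move: IH; rewrite !mulr2n; lra.
Qed.

(** * Identification of an extension by continuity with an explicit function [G] *)

Section generic.
Variables (T : (Omega -> R) -> (Omega -> R)) (b : Omega -> R).
Variables (G : (nat -> Omega -> R) -> Omega -> R) (C : R).
Hypothesis C0 : 0 < C.
Hypothesis G_meas : forall c f, H1_bdd c f -> measurable_fun setT (G f).
Hypothesis G_L2 : forall u, Int u -> Int (fun x => u x ^+ 2) ->
  commutator T b u = G (mof u) %[ae P].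
Hypothesis G_sub : forall c c' f g, H1_bdd c f -> H1_bdd c' g ->
  G (fun n x => f n x - g n x) = (fun x => G f x - G g x) %[ae P].
Hypothesis G_weak : forall c f t, H1_bdd c f -> 0 < t ->
  t * pr [set x | t < `|G f x| ] <= C * c.

Lemma H1_bdd_L2 u : u \in Lfun P 2%:E -> exists c, H1_bdd c (mof u).
Proof.
move=> Lu; have [Iu Iu2] := Lfun2_Int Lu.
exists (1 + E (fun x => u x ^+ 2)); split; first exact: mof_mart.
by move=> N; exact: mof_L2_sq.
Qed.

Lemma G_weakL1 c f : H1_bdd c f -> (weakL1_norm P (G f) <= C%:E * H1_norm P f)%E.
Proof.
move=> Hf; have [mf fc] := Hf.
have fin : (H1_norm P f < +oo)%E by apply: le_lt_trans (H1_norm_le mf fc) (ltry _).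
have e : H1_norm P f = (fine (H1_norm P f))%:E.
  by rewrite fineK// ge0_fin_numE// H1_norm_ge0.
rewrite e -EFinM; apply: (weakL1_le (G_meas Hf)) => t t0.
apply: G_weak t0; split => //; exact: (H1_norm_fin mf fin).
Qed.

(** Almost everywhere G (mof u_k) - G f = G (mof u_k - f), so the weak bound on G turns convergence
    in H_1 into convergence in weak L^1. *)
Lemma commutator_L2_cvg c f u : H1_bdd c f -> L2_approx P F u f ->
  (forall k, measurable_fun setT (commutator T b (u k))) /\
  weakL1_norm P (commutator T b (u k) \- G f) @[k --> \oo] --> 0%E.
Proof.
move=> Hf [Lu Hu].
have aeL k : commutator T b (u k) = G (mof (u k)) %[ae P].
  by have [Iu Iu2] := Lfun2_Int (Lu k); exact: G_L2.
have mc k : measurable_fun setT (commutator T b (u k)).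
  have [c' Hm] := H1_bdd_L2 (Lu k).
  by apply: (ae_measurable cP _ (G_meas Hm)); apply: filterS (aeL k) => x /[apply].
split => //; apply: le_cvge0 => [k|e e0]; first exact: weakL1_ge0.
have eC : 0 < e / C by rewrite divr_gt0.
have := cvge0_le Hu eC; apply: filterS => k hk.
have [c' Hm] := H1_bdd_L2 (Lu k).
have Hmf := H1_bdd_sub Hm Hf.
rewrite (ae_weakL1 cP (G_meas Hmf)); last first.
  apply: filterS2 (aeL k) (G_sub Hm Hf) => x h1 h2 _.
  by rewrite (h2 I) /= (h1 I).
apply: le_trans (G_weakL1 Hmf) _.
apply: (@le_trans _ _ (C%:E * (e / C)%:E)%E).
  by apply: lee_wpmul2l => //; rewrite lee_fin ltW.
by rewrite -EFinM mulrCA divff ?mulr1// gt_eqF.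
Qed.

Lemma commutator_extension c f : H1_bdd c f ->
  is_commutator_H1 P F T b f (G f) /\
  forall g : Omega -> R, is_commutator_H1 P F T b f g -> g = G f %[ae P].
Proof.
move=> Hf; have [mf fc] := Hf.
have [u Hu] := L2_approx_ex HF mf fc.
split.
  split; [exact: G_meas Hf|by exists u|].
  by move=> v Hv; have [] := commutator_L2_cvg Hf Hv.
move=> g [mg _ /(_ u Hu) cg].
have [mc cG] := commutator_L2_cvg Hf Hu.
exact: weakL1_uniq mc mg (G_meas Hf) cg cG.
Qed.

Lemma commutator_H1P c f : H1_bdd c f ->
  is_commutator_H1 P F T b f (commutator_H1 P F T b f) /\
  commutator_H1 P F T b f = G f %[ae P].
Proof.
move=> Hf; have [h1 h2] := commutator_extension Hf.
have h : is_commutator_H1 P F T b f (commutator_H1 P F T b f).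
  by apply: xgetPex; exists (G f).
by split => //; exact: h2.
Qed.

End generic.
End commutator_extension.

(** * Brackets and summation by parts *)

Section bracket_paths.
Variable R : realType.
Implicit Types (a b th f g : nat -> R).

Definition bracket a b n := \sum_(k < n.+1) dl a k * dl b k.

Lemma bracketS a b n : bracket a b n.+1 = bracket a b n + dl a n.+1 * dl b n.+1.
Proof. by rewrite /bracket big_ord_recr. Qed.

Lemma bracket_le a b n : `|bracket a b n| <= \sum_(k < n.+1) `|dl a k * dl b k|.
Proof. exact: ler_norm_sum. Qed.

Lemma bracket_sub f g b n :
  bracket (fun n => f n - g n) b n = bracket f b n - bracket g b n.
Proof.
rewrite /bracket -sumrB; apply: eq_bigr => k _.
by rewrite /dl; case: (k : nat) => [|m]; ring.
Qed.

Lemma bracket_cvg a b M : (forall n, \sum_(k < n.+1) `|dl a k * dl b k| <= M) ->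
  cvgn (bracket a b).
Proof.
move=> h.
have : cvgn (series (fun k => dl a k * dl b k)).
  apply: normed_cvg; apply: nondecreasing_is_cvgn.
    by apply/nondecreasing_seqP => n; rewrite -subr_ge0 seriesSB; exact: normr_ge0.
  exists M => _ [n _ <-]; apply: le_trans (h n).
  have -> : [normed series (fun k => dl a k * dl b k)] n = \sum_(k < n) `|dl a k * dl b k|.
    by rewrite -(big_mkord xpredT (fun k => `|dl a k * dl b k|)).
  by rewrite big_ord_recr lerDl /=.
move=> /cvg_ex[l hl]; apply/cvg_ex; exists l.
have := hl; rewrite -(cvg_shiftS (series _)); apply: cvg_trans; apply: near_eq_cvg.
by apply: nearW => n; rewrite seriesEord.
Qed.

Lemma tr_sub th f g n :
  tr th (fun n => f n - g n) n = tr th f n - tr th g n.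
Proof.
by rewrite /tr -sumrB; apply: eq_bigr => k _; rewrite /dl; ring.
Qed.

(** The coefficients of U(f) in the overview, with the time shift of [tr]. *)
Definition para_coef th f n := th n * f n - tr th f n.

Lemma para_coef_sub th f g n :
  para_coef th (fun n => f n - g n) n = para_coef th f n - para_coef th g n.
Proof. by rewrite /para_coef tr_sub; ring. Qed.

Lemma tr_subl th th' b n : tr (fun n => th n - th' n) b n = tr th b n - tr th' b n.
Proof. by rewrite /tr -sumrB; apply: eq_bigr => k _; rewrite mulrBl. Qed.

(* Summation by parts: the increments of [b f - bracket f b] are
   [b_k df_{k+1} + f_k db_{k+1}]. *)
Lemma product_path th f b (z : nat -> R) n :
  tr th (fun n => b n * f n - bracket f b n + z n) n =
  tr th z n + tr (para_coef th f) b n + b n * tr th f n - bracket (tr th f) b n.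
Proof.
elim: n => [|n IH].
  rewrite /tr !big_ord0 /bracket big_ord1 /dl /= /tr big_ord0; ring.
have rec (c g : nat -> R) : tr c g n.+1 = tr c g n + c n * dl g n.+1.
  by rewrite /tr big_ord_recr.
rewrite !rec IH bracketS dl_tr.
have -> : dl (fun n => b n * f n - bracket f b n + z n) n.+1 =
    b n * dl f n.+1 + f n * dl b n.+1 + dl z n.+1.
  rewrite {1}/dl bracketS (dlS b n) (dlS f n) (dlS z n); ring.
rewrite (dlS b n) /para_coef; ring.
Qed.

End bracket_paths.

(** * The function Pi f and the product of b with an L^2 function *)

Section operators.
Context d (Omega : measurableType d) (R : realType) (P : probability Omega R).
Variable F : nat -> set (set Omega).
Hypothesis HF : is_filtration F.
Notation E := (Ex P).
Notation Int := (Int P).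
Notation W n X := (measurable_wrt (F n) X).
Notation mart := (mart P F).
Notation mof := (martingale_of P F).
Notation H1_bdd := (H1_bdd P F).
Implicit Types f g : nat -> Omega -> R.
Let sF n : sigma_algebra setT (F n) := filt_sigma HF n.
Let mF n : F n `<=` measurable := filt_measurable HF (n := n).

Variables (B : R) (bt : nat -> Omega -> R) (b : Omega -> R).
Hypothesis Hb : bmo_process P F B bt.
Hypothesis Ib : Int b.
Hypothesis btE : forall n A, F n A -> E (fun x => \1_A x * bt n x) = E (fun x => \1_A x * b x).
Let K := 65 * B ^+ 2.
Let mb : mart bt. Proof. by case: Hb. Qed.
Let Wb n : W n (bt n). Proof. by case: mb. Qed.
Let mbt n : measurable_fun setT (bt n). Proof. exact: (W_meas HF (@Wb n)). Qed.
Let B0 : 0 <= B := bmo_ge0 Hb.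
Let K0 : 0 <= K. Proof. by rewrite mulr_ge0// sqr_ge0. Qed.
Let dlB n x : `|dl (bt ^~ x) n| <= B. Proof. by case: Hb. Qed.
Let mbb : measurable_fun setT b := Int_meas Ib.

Lemma bt_sq N : E (fun x => sq (bt ^~ x) N) <= 1 + K.
Proof.
have mq : measurable_fun setT (fun x => qv (bt ^~ x) N) by exact: measurable_qv.
have Iq : Int (fun x => qv (bt ^~ x) N).
  apply: Int_bd mq _ => x; rewrite ger0_norm ?qv_ge0//; exact: (bmo_qv_bd Hb).
have h : E (fun x => qv (bt ^~ x) N) <= K.
  have := bmo_qv HF Hb (leq0n N) (filt_setT HF 0).
  have -> : E (\1_[set: Omega]) = 1.
    by rewrite -[RHS](Ex_cst P); apply: eq_Ex => x; rewrite indicE in_setT.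
  rewrite mulr1; apply: le_trans.
  rewrite le_eqVlt; apply/orP; left; apply/eqP; apply: eq_Ex => x.
  by rewrite indicE in_setT mul1r qv0 /dl subr0 subrK.
apply: (@le_trans _ _ (E (fun x => 1 + qv (bt ^~ x) N))); last first.
  by rewrite ExD ?Ex_cst ?lerD2l//; exact: Int_cst.
apply: Ex_le; [exact: (mart_Int_sq N mb)|by apply: IntD => //; exact: Int_cst|].
by move=> x; rewrite -sq_sqr; have := sqr_ge0 (sq (bt ^~ x) N - 1); nra.
Qed.

Lemma bt_cvg : \forall x \ae P, bt ^~ x @ \oo --> b x.
Proof. exact: (mof_cvg HF Ib mb bt_sq btE). Qed.

(** With u in L^2 this dominates all products b_n u in [mof_product]. It comes from the maximal
    John-Nirenberg bound started at time 0. *)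
Lemma bt_L2 : exists D, [/\ Int D, forall x, 0 <= D x &
  \forall x \ae P, forall n, bt n x ^+ 2 <= D x].
Proof.
have I1 : E (\1_[set: Omega]) = 1.
  by rewrite -[RHS](Ex_cst P); apply: eq_Ex => x; rewrite indicE in_setT.
have mt N : measurable_fun setT (fun x => mx (tail (bt ^~ x) 0) N).
  apply: (@measurable_mx _ _ _ (fun k x => bt (maxn k 0) x - bt 0%N x)) => j _.
  exact: measurable_funB.
have tb N x : mx (tail (bt ^~ x) 0) N <= 2 * ((maxn N 0).+1%:R * B).
  by apply: le_trans (mx_tail _ _ _) _; rewrite ler_pM2l//; exact: (bmo_mx_bd Hb).
have [|||| G [IG _ G0 hG]] := @monotone_L1 _ _ _ P (fun N x => mx (tail (bt ^~ x) 0) N ^+ 2) (64 * B ^+ 2).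
- move=> N; apply: (@Int_bd _ _ _ _ ((2 * ((maxn N 0).+1%:R * B)) ^+ 2)).
    exact: measurable_funX.
  by move=> x; rewrite ger0_norm ?sqr_ge0// ler_sqr ?nnegrE ?mx_ge0 ?mulr_ge0.
- by move=> N x; exact: sqr_ge0.
- by move=> N x; rewrite ler_sqr ?nnegrE ?mx_ge0//; exact: mx_mono.
- move=> N; have := john_nirenberg HF Hb (leq0n N) (filt_setT HF 0); rewrite I1 mulr1.
  apply: le_trans; rewrite le_eqVlt; apply/orP; left; apply/eqP; apply: eq_Ex => x.
  by rewrite indicE in_setT mul1r.
exists (fun x => 2 * B ^+ 2 + 2 * G x); split.
- by apply: IntD; [exact: Int_cst|exact: IntZ].
- by move=> x; rewrite addr_ge0// mulr_ge0// sqr_ge0.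
apply: filterS hG => x [_ h] n.
have h1 : `|bt 0%N x| <= B by have := dlB 0 x; rewrite /dl subr0.
have h2 := h n; have := mx_ge (tail (bt ^~ x) 0) n; rewrite /tail maxn0 => h3.
have h4 : (bt n x - bt 0%N x) ^+ 2 <= G x.
  apply: le_trans h2; rewrite -(real_normK (num_real (bt n x - _))).
  by rewrite ler_sqr ?nnegrE ?mx_ge0.
have h5 : bt 0%N x ^+ 2 <= B ^+ 2.
  by rewrite -(real_normK (num_real (bt 0%N x))) ler_sqr ?nnegrE.
have := sqr_ge0 (bt n x - 2 * bt 0%N x); nra.
Qed.

Lemma b_osc n (X : Omega -> R) : W n X -> (forall x, 0 <= X x) -> Int X ->
  Int (fun x => X x * (b x - bt n x)) /\
  E (fun x => `|X x * (b x - bt n x)|) <= B * E X.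
Proof.
move=> WX X0 IX; have mX := W_meas HF WX.
apply: (@fatou_L1 _ _ _ P (fun m x => X x * (bt (n + m)%N x - bt n x))).
- move=> m; under eq_fun do rewrite mulrC.
  apply: (@IntMb _ _ _ _ ((n + m).+1%:R * B + n.+1%:R * B)) => //.
    exact: measurable_funB.
  move=> x; apply: le_trans (ler_normB _ _) _.
  by apply: lerD; exact: (bmo_bd Hb).
- by apply: measurable_funM => //; exact: measurable_funB.
- apply: filterS bt_cvg => x h; apply: cvgM; first exact: cvg_cst.
  apply: cvgB; last exact: cvg_cst.
  have := h; rewrite -(cvg_shiftn n); apply: cvg_trans; apply: near_eq_cvg.
  by apply: nearW => m; rewrite addnC.
- move=> m; have := bmo_osc HF Hb (leq_addr m n) WX X0 IX.
  apply: le_trans; rewrite le_eqVlt; apply/orP; left; apply/eqP; apply: eq_Ex => x.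
  by rewrite normrM (ger0_norm (X0 x)).
Qed.

Definition Pi f : Omega -> R := limf (fun n x => bracket (f ^~ x) (bt ^~ x) n).

Let mbr f n : mart f -> measurable_fun setT (fun x => bracket (f ^~ x) (bt ^~ x) n).
Proof.
move=> [_ If _]; apply: measurable_sum => k; apply: measurable_funM; apply: measurable_dl => j _.
  exact: Int_meas (If j).
exact: mbt.
Qed.

(** By Fefferman's inequality the bracket converges absolutely almost everywhere, with an integrable
    function dominating all its partial sums. *)
Lemma bracket_dom c f : H1_bdd c f -> exists M, [/\ Int M, E M <= (2 + K) * c, forall x, 0 <= M x &
  \forall x \ae P, bracket (f ^~ x) (bt ^~ x) @ \oo --> Pi f x /\
    forall n, \sum_(k < n.+1) `|dl (f ^~ x) k * dl (bt ^~ x) k| <= M x].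
Proof.
move=> [mf fc].
have [|||| M [IM EM M0 hM]] := @monotone_L1 _ _ _ P
  (fun n x => \sum_(k < n.+1) `|dl (f ^~ x) k * dl (bt ^~ x) k|) ((2 + K) * c).
- by move=> n; have [] := fefferman HF Hb n mf.
- by move=> n x; apply: sumr_ge0.
- by move=> n x; rewrite [leRHS]big_ord_recr lerDl /=.
- move=> n; have [_ h] := fefferman HF Hb n mf; apply: le_trans h _.
  by apply: ler_wpM2l (fc n); rewrite addr_ge0.
exists M; split => //; apply: filterS hM => x [_ h]; split => //.
by apply: limf_cvg; exact: bracket_cvg h.
Qed.

Lemma measurable_Pi f : mart f -> measurable_fun setT (Pi f).
Proof. by move=> mf; apply: measurable_limf => n; exact: mbr. Qed.

Lemma Pi_L1 c f : H1_bdd c f -> Int (Pi f) /\ E (fun x => `|Pi f x|) <= (2 + K) * c.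
Proof.
move=> Hf; have [mf fc] := Hf; have [M [IM EM M0 hM]] := bracket_dom Hf.
apply: (@fatou_L1 _ _ _ P (fun n x => bracket (f ^~ x) (bt ^~ x) n)).
- move=> n; apply: Int_sum => k _; under eq_fun do rewrite mulrC.
  by apply: IntMb (dlB k); [exact: (mart_Int_dl k mf)|exact: measurable_dl].
- exact: measurable_Pi.
- by apply: filterS hM => x [].
- move=> n; have [If h] := fefferman HF Hb n mf.
  apply: (@le_trans _ _ ((2 + K) * E (fun x => sq (f ^~ x) n))); last first.
    by apply: ler_wpM2l (fc n); rewrite addr_ge0.
  apply: le_trans h; apply: Ex_le => //; last by move=> x; exact: bracket_le.
  apply: Int_norm; apply: Int_sum => k _; under eq_fun do rewrite mulrC.
  by apply: IntMb (dlB k); [exact: (mart_Int_dl k mf)|exact: measurable_dl].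
Qed.

Lemma Pi_sub c c' f g : H1_bdd c f -> H1_bdd c' g ->
  Pi (fun n x => f n x - g n x) = (fun x => Pi f x - Pi g x) %[ae P].
Proof.
move=> Hf Hg; have [M1 [_ _ _ h1]] := bracket_dom Hf; have [M2 [_ _ _ h2]] := bracket_dom Hg.
apply: filterS2 h1 h2 => x [c1 _] [c2 _] _; apply: limf_lim.
under eq_fun do rewrite (bracket_sub (f ^~ x) (g ^~ x)).
exact: cvgB c1 c2.
Qed.

Lemma mof_ae u v n : Int u -> Int v -> u = v %[ae P] -> mof u n = mof v n %[ae P].
Proof.
move=> Iu Iv uv; apply: (mof_uniq HF) => //; [exact: mof_W|exact: mof_Int|].
move=> A FA; have mA : measurable A := mF FA.
rewrite mof_E//; apply: ae_eq_Ex.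
- exact: Int_meas (Int_indM mA Iu).
- exact: Int_meas (Int_indM mA Iv).
- by apply: filterS uv => x /= /[apply] ->.
Qed.

Lemma mof_Pi_sub c c' f g n : H1_bdd c f -> H1_bdd c' g ->
  mof (Pi (fun n x => f n x - g n x)) n = (fun x => mof (Pi f) n x - mof (Pi g) n x) %[ae P].
Proof.
move=> Hf Hg; have [If _] := Pi_L1 Hf; have [Ig _] := Pi_L1 Hg.
have [Ifg _] := Pi_L1 (H1_bdd_sub HF Hf Hg).
have h1 := mof_ae n Ifg (IntB If Ig) (Pi_sub Hf Hg).
by apply: filterS2 h1 (mof_sub HF n If Ig) => x e1 e2 _; rewrite (e1 I) (e2 I).
Qed.

(* The product [b f] of [b] with an L^2 function is not in H_1; only its
   conditional expectations are described. *)
Lemma mof_product u n : Int u -> Int (fun x => u x ^+ 2) ->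
  Int (fun x => b x * u x) /\
  mof (fun x => b x * u x) n =
    (fun x => bt n x * mof u n x - bracket (mof u ^~ x) (bt ^~ x) n + mof (Pi (mof u)) n x) %[ae P].
Proof.
move=> Iu Iu2; set f := mof u; have mf : mart f := mof_mart HF Iu.
have [Wf If Ef] := mf; have mu := Int_meas Iu.
have Hf : H1_bdd (1 + E (fun x => u x ^+ 2)) f by split => // N; exact: mof_L2_sq.
have [IPi _] := Pi_L1 Hf.
have [D [ID D0 hD]] := bt_L2.
have [M [IM _ M0 hM]] := bracket_dom Hf.
have IDu : Int (fun x => D x + u x ^+ 2) by exact: IntD.
have mbu m : measurable_fun setT (fun x => bt m x * u x) by exact: measurable_funM.
have domx : \forall x \ae P, forall m, `|bt m x * u x| <= D x + u x ^+ 2.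
  apply: filterS hD => x h m; have := h m; rewrite normrM.
  rewrite -[bt m x ^+ 2](real_normK (num_real _)) -[u x ^+ 2](real_normK (num_real _)).
  have := sqr_ge0 (`|bt m x| - `|u x|); have := sqr_ge0 `|bt m x|; have := sqr_ge0 `|u x|; nra.
have cvx : \forall x \ae P, (bt n x * u x) @[n --> \oo] --> b x * u x.
  by apply: filterS bt_cvg => x h; apply: cvgM => //; exact: cvg_cst.
have [Ibu _] := Ex_dct mbu (measurable_funM mbb mu) IDu cvx domx.
split => //; apply: ae_eq_sym.
have Ibr m : Int (fun x => bracket (f ^~ x) (bt ^~ x) m).
  apply: Int_sum => k _; under eq_fun do rewrite mulrC.
  by apply: IntMb (dlB k); [exact: (mart_Int_dl k mf)|exact: measurable_dl].
have Ibf m : Int (fun x => bt m x * f m x) by apply: IntMb (bmo_bd Hb m).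
have IX m : Int (fun x => bt m x * f m x - bracket (f ^~ x) (bt ^~ x) m) by exact: IntB.
have Wbr m : W m (fun x => bracket (f ^~ x) (bt ^~ x) m).
  apply: measurable_sum => k; have km : (k <= m)%N by rewrite -ltnS.
  by apply: measurable_funM; apply: (W_le HF km); apply: (W_dl HF).
apply: (mof_uniq HF) => //.
- apply: measurable_funD; last exact: mof_W.
  apply: measurable_funB; last exact: Wbr.
  by apply: measurable_funM; [exact: Wb|exact: Wf].
- by apply: IntD => //; exact: mof_Int.
move=> A FA; have mA : measurable A := mF FA.
have ind1 x : `|\1_A x : R| <= 1 by rewrite indicE; case: (_ \in _); rewrite ?normr1 ?normr0.
(* b_m f_m minus the bracket is a martingale: its increments are b_m df_{m+1} + f_m db_{m+1}, whose
   expectations over A vanish. *)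
have step m : (n <= m)%N -> E (fun x => \1_A x * (bt m x * f m x - bracket (f ^~ x) (bt ^~ x) m)) =
   E (fun x => \1_A x * (bt n x * f n x - bracket (f ^~ x) (bt ^~ x) n)).
  elim: m => [|m IH]; first by rewrite leqn0 => /eqP ->.
  rewrite leq_eqVlt => /predU1P[->//|]; rewrite ltnS => nm; rewrite -IH//.
  have WA : W m (\1_A : Omega -> R) by apply: (W_le HF nm); exact: (wrt_indic (sF n) FA).
  have I1 : Int (fun x => (\1_A x * bt m x) * dl (f ^~ x) m.+1).
    under eq_fun do rewrite -mulrA; apply: Int_indM => //.
    by apply: IntMb (bmo_bd Hb m) => //; exact: (mart_Int_dl _ mf).
  have I2 : Int (fun x => (\1_A x * f m x) * dl (bt ^~ x) m.+1).
    under eq_fun do rewrite -mulrA; apply: Int_indM => //; under eq_fun do rewrite mulrC.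
    by apply: IntMb (dlB _) => //; exact: measurable_dl.
  have e1 : E (fun x => (\1_A x * bt m x) * dl (f ^~ x) m.+1) = 0.
    by rewrite (mart_mul HF mf)//; apply: measurable_funM => //; exact: Wb.
  have e2 : E (fun x => (\1_A x * f m x) * dl (bt ^~ x) m.+1) = 0.
    by rewrite (mart_mul HF mb)//; apply: measurable_funM => //; exact: Wf.
  rewrite (eq_Ex _ (g := fun x => \1_A x * (bt m x * f m x - bracket (f ^~ x) (bt ^~ x) m) +
    ((\1_A x * bt m x) * dl (f ^~ x) m.+1 + (\1_A x * f m x) * dl (bt ^~ x) m.+1))); last first.
    move=> x; rewrite bracketS.
    have := dlS (f ^~ x) m; have := dlS (bt ^~ x) m => /= -> ->; ring.
  rewrite ExD; [|exact: Int_indM|exact: IntD].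
  by rewrite ExD// e1 e2 !addr0.
have EZ : E (fun x => \1_A x * mof (Pi f) n x) = E (fun x => \1_A x * Pi f x) by rewrite mof_E.
rewrite (eq_Ex _ (g := fun x => \1_A x * (bt n x * f n x - bracket (f ^~ x) (bt ^~ x) n) +
   \1_A x * mof (Pi f) n x)); last by move=> x; rewrite mulrDr.
rewrite ExD; [|exact: Int_indM|by apply: Int_indM => //; exact: mof_Int].
rewrite EZ.
have [| | | | |_ c1] := @Ex_dct _ _ _ P (fun m x => \1_A x * (bt m x * u x)) (fun x => \1_A x * (b x * u x)) (fun x => D x + u x ^+ 2).
- by move=> m; apply: measurable_funM => //; exact: measurable_indic.
- by apply: measurable_funM; [exact: measurable_indic|exact: measurable_funM].
- exact: IDu.
- by apply: filterS cvx => x h; apply: cvgM => //; exact: cvg_cst.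
- by apply: filterS domx => x h m; rewrite normrM; apply: le_trans (h m); rewrite ler_piMl.
have [| | | | |_ c2] := @Ex_dct _ _ _ P (fun m x => \1_A x * bracket (f ^~ x) (bt ^~ x) m) (fun x => \1_A x * Pi f x) M.
- by move=> m; apply: measurable_funM; [exact: measurable_indic|exact: Int_meas (Ibr m)].
- by apply: measurable_funM; [exact: measurable_indic|exact: Int_meas IPi].
- exact: IM.
- by apply: filterS hM => x [h _]; apply: cvgM => //; exact: cvg_cst.
- apply: filterS hM => x [_ h] m; rewrite normrM; apply: le_trans (h m).
  by apply: le_trans (bracket_le _ _ _); rewrite ler_piMl.
(* Let m tend to infinity. Since b_m is bounded and F_m-measurable, f_m may be replaced by u, after
   which dominated convergence applies to both terms. *)
have c3 : E (fun x => \1_A x * (bt n x * f n x - bracket (f ^~ x) (bt ^~ x) n)) =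
   E (fun x => \1_A x * (b x * u x)) - E (fun x => \1_A x * Pi f x).
  rewrite -(cvg_lim _ (cvgB c1 c2))//; apply/esym/cvg_lim => //.
  apply: cvg_near_cst; near=> m.
  have nm : (n <= m)%N by near: m; exists n.
  rewrite -(step m nm) /=.
  rewrite (eq_Ex _ (f := fun x => \1_A x * (bt m x * f m x - bracket (f ^~ x) (bt ^~ x) m))
    (g := fun x => (\1_A x * bt m x) * f m x - \1_A x * bracket (f ^~ x) (bt ^~ x) m)); last first.
    by move=> x; ring.
  have WA : W m (fun x => \1_A x * bt m x).
    apply: measurable_funM; last exact: Wb.
    by apply: (W_le HF nm); exact: (wrt_indic (sF n) FA).
  have Ab x : `|\1_A x * bt m x| <= m.+1%:R * B.
    by rewrite normrM; apply: le_trans (bmo_bd Hb m x); rewrite ler_piMl.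
  rewrite ExB; last first.
  - exact: Int_indM.
  - by apply: IntMb Ab => //; exact: (W_meas HF WA).
  rewrite (mof_mulE HF Iu WA Ab); congr (_ - _); apply: eq_Ex => x; ring.
by rewrite c3 subrK.
Unshelve. all: by end_near. Qed.

End operators.

Lemma eq_cvgn (R : realType) (u v : nat -> R) (l : R) : u =1 v -> u @ \oo --> l -> v @ \oo --> l.
Proof. by move=> /funext ->. Qed.

Lemma norm_three (R : realFieldType) (t x y z : R) :
  `|x| <= t / 3 -> `|y| <= t / 3 -> `|z| <= t / 3 -> `|x + y - z| <= t.
Proof. by move=> hx hy hz; have := ler_normB (x + y) z; have := ler_normD x y; lra. Qed.

(** Each of the three terms of [T, b] f is taken at level t / 3: the weak type bound for T (Pi f),
    and L^1 bounds for U(f) and Pi (T f). *)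
Lemma weak_constant (R : realFieldType) (t c k q p1 p2 p3 : R) : 0 < t ->
  q <= p1 + (p2 + p3) -> t / 3 * p1 <= 2 * ((2 + k) * c) ->
  t / 3 * p2 <= 50 * ((1 + k) * (100 * c)) -> t / 3 * p3 <= (2 + k) * c ->
  t * q <= 3 * (3 * (2 + k) + 5000 * (1 + k)) * c.
Proof. by move=> t0 hq a1 a2 a3; have := ler_wpM2l (ltW t0) hq; lra. Qed.

(** * The commutator with the transform T *)

Section commutators.
Context d (Omega : measurableType d) (R : realType) (P : probability Omega R).
Variable F : nat -> set (set Omega).
Hypothesis HF : is_filtration F.
Notation E := (Ex P).
Notation Int := (Int P).
Notation W n X := (measurable_wrt (F n) X).
Notation pr A := (fine (P A)).
Notation mart := (mart P F).
Notation mof := (martingale_of P F).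
Notation H1_bdd := (H1_bdd P F).
Implicit Types f g : nat -> Omega -> R.

Lemma weak_L1 (f : Omega -> R) t : Int f -> 0 < t ->
  t * pr [set x | t < `|f x| ] <= E (fun x => `|f x|).
Proof.
move=> If t0; have mf := Int_meas (Int_norm If).
apply: le_trans (markov_ge (Int_norm If) _ t0) => //.
rewrite ler_pM2l//; apply: pr_le; [exact: measurable_gt|exact: measurable_ge|].
by move=> x /= /ltW.
Qed.

Lemma H1_mx c f N : H1_bdd c f -> E (fun x => mx (f ^~ x) N) <= 50 * c.
Proof. by move=> [mf fc]; apply: le_trans (davis_M HF N mf) _; rewrite ler_pM2l. Qed.

Lemma H1_L1 c f N : H1_bdd c f -> E (fun x => `|f N x|) <= 50 * c.
Proof.
move=> Hf; have [[_ If _] _] := Hf; apply: le_trans (H1_mx N Hf).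
by apply: Ex_le; [exact: Int_norm|exact: (mart_Int_mx N If)|move=> x; exact: (mx_ge (f ^~ x))].
Qed.

Lemma H1_cvg c f : H1_bdd c f -> \forall x \ae P, f ^~ x @ \oo --> limf f x.
Proof. by move=> [mf fc]; apply: filterS (mart_cvg HF mf fc) => x; exact: limf_cvg. Qed.

Lemma H1_limf_L1 c f : H1_bdd c f -> Int (limf f) /\ E (fun x => `|limf f x|) <= 50 * c.
Proof.
move=> Hf; have [[Wf If _] _] := Hf; apply: (fatou_L1 If).
- by apply: measurable_limf => n; exact: Int_meas.
- exact: H1_cvg Hf.
- by move=> n; exact: H1_L1.
Qed.

Lemma H1_bdd_ge0 c f : H1_bdd c f -> 0 <= c.
Proof. by move=> [_ fc]; apply: le_trans (fc 0%N); apply: Ex_ge0 => x; exact: sq_ge0. Qed.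

Variables (B : R) (bt : nat -> Omega -> R) (b : Omega -> R).
Hypothesis Hb : bmo_process P F B bt.
Hypothesis Ib : Int b.
Hypothesis btE : forall n A, F n A -> E (fun x => \1_A x * bt n x) = E (fun x => \1_A x * b x).
Let K := 65 * B ^+ 2.
Let mb : mart bt. Proof. by case: Hb. Qed.
Let K0 : 0 <= K. Proof. by rewrite mulr_ge0// sqr_ge0. Qed.
Notation Pi := (Pi bt).

Section transform.
Variables (eps e : nat -> Omega -> R).
Hypothesis We : forall n, W n (e n).
Hypothesis e1 : forall n x, `|e n x| <= 1.
Hypothesis eE : \forall x \ae P, forall n, eps n x = e n x.
Notation T := (martingale_transform P F eps).

Let mtrf f n : mart f -> measurable_fun setT (fun x => tr (e ^~ x) (f ^~ x) n).
Proof. by move=> mf; have [_ It _] := mart_tr HF mf We e1; exact: Int_meas. Qed.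

Definition trT f n x := tr (e ^~ x) (f ^~ x) n.

Lemma trT_H1 c f : H1_bdd c f -> H1_bdd c (trT f).
Proof.
move=> [mf fc]; have mt := mart_tr HF mf We e1; split => // N.
apply: le_trans (fc N); apply: Ex_le; [exact: (mart_Int_sq N mt)|exact: (mart_Int_sq N mf)|].
by move=> x; apply: sq_tr => k; exact: e1.
Qed.

Lemma trT_mof_cvg u : Int u -> \forall x \ae P, trT (mof u) ^~ x @ \oo --> limf (trT (mof u)) x.
Proof.
move=> Iu.
have : \forall x \ae P, cvgn (tr (e ^~ x) (mof u ^~ x)).
  by apply: (tr_cvg HF (mof_mart HF Iu) We e1) => r r0; exact: (mof_approx HF Iu r0).
by apply: filterS => x; exact: limf_cvg.
Qed.

Lemma trT_mof_weak u t : Int u -> 0 < t ->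
  t * pr [set x | t < `|limf (trT (mof u)) x| ] <= 2 * E (fun x => `|u x|).
Proof.
move=> Iu t0; have mm := mof_mart HF Iu.
rewrite mulrC -ler_pdivlMr//; apply: limf_weak.
- by move=> n; exact: mtrf.
- by apply: filterS (trT_mof_cvg Iu) => x h; apply/cvg_ex; exists (limf (trT (mof u)) x).
move=> n; rewrite ler_pdivlMr// mulrC; apply: le_trans (weak11 HF n mm We e1 t0) _.
by rewrite ler_pM2l//; exact: mof_norm.
Qed.

Lemma martingale_transformE u : Int u ->
  T u = limf (trT (mof u)) %[ae P].
Proof.
move=> Iu; apply: filterS2 eE (trT_mof_cvg Iu) => x eEx h _.
rewrite /martingale_transform; apply: cvg_lim => //.
(* The term k = 0 of the series vanishes because eps_{-1} = 0; after a shift by one the partial sums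
   are those of [tr]. *)
have := h; rewrite -[in X in _ -> X]cvg_shiftS; apply: cvg_trans; apply: near_eq_cvg; apply: nearW => n.
rewrite /= /series /= big_mkord big_ord_recl /= mul0r add0r.
by apply: eq_bigr => k _; rewrite diff_seqE /= eEx.
Qed.

Definition para f n x := tr (para_coef (e ^~ x) (f ^~ x)) (bt ^~ x) n.

(** The increasing majorant of the coefficients is the sum of the maximal functions of f and T f,
    each of expectation at most 50 c by Davis' inequality. *)
Lemma para_H1 c f : H1_bdd c f -> H1_bdd ((1 + K) * (100 * c)) (para f).
Proof.
move=> Hf; have Ht := trT_H1 Hf; have [[Wf If _] _] := Hf; have [[Wt It _] _] := Ht.
have [||||| mp hp] := @paraproduct _ _ _ _ _ HF _ _ Hb
  (fun n x => para_coef (e ^~ x) (f ^~ x) n) (fun n x => mx (f ^~ x) n + mx (trT f ^~ x) n).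
- move=> n; apply: measurable_funB; last exact: Wt.
  by apply: measurable_funM; [exact: We|exact: Wf].
- move=> n; apply: measurable_funD.
    apply: (@measurable_mx _ (g_sigma_algebraType (F n)) _ (fun k x => f k x)) => k kn.
    exact: (W_le HF kn).
  apply: (@measurable_mx _ (g_sigma_algebraType (F n)) _ (fun k x => trT f k x)) => k kn.
  exact: (W_le HF kn (@Wt k)).
- move=> n x; rewrite /para_coef (le_trans (ler_normB _ _))// lerD//; last exact: (mx_ge (trT f ^~ x)).
  by rewrite normrM; apply: le_trans (mx_ge (f ^~ x) n); rewrite ler_piMl.
- by move=> n x; apply: lerD; exact: mx_mono.
- by move=> n; apply: IntD; [exact: (mart_Int_mx n If)|exact: (mart_Int_mx n It)].
split => // N; apply: le_trans (hp N) _; apply: ler_wpM2l; first by rewrite addr_ge0.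
rewrite ExD; [|exact: (mart_Int_mx N If)|exact: (mart_Int_mx N It)].
have := H1_mx N Hf; have := H1_mx N Ht; lra.
Qed.

(* The adapted process [e] is a version of [eps] bounded by 1 everywhere. *)
Definition comm_T f x := limf (trT (mof (Pi f))) x + limf (para f) x - Pi (trT f) x.

Lemma comm_T_meas c f : H1_bdd c f -> measurable_fun setT (comm_T f).
Proof.
move=> Hf; have [IPi _] := Pi_L1 HF Hb Hf; have [mm _] := para_H1 Hf; have [mt _] := trT_H1 Hf.
apply: measurable_funB; last exact: (measurable_Pi HF Hb mt).
apply: measurable_funD; apply: measurable_limf => n; first exact: (mtrf n (mof_mart HF IPi)).
by have [_ It _] := mm; exact: Int_meas (It n).
Qed.

(** Along almost every path, [product_path] with z_n = E_n (Pi f) gives the partial sums of T (b u).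
    In the limit the term b T u cancels against the second half of the commutator. *)
Lemma comm_T_L2 u : Int u -> Int (fun x => u x ^+ 2) -> commutator T b u = comm_T (mof u) %[ae P].
Proof.
move=> Iu Iu2; have mm := mof_mart HF Iu.
have Hf : H1_bdd (1 + E (fun x => u x ^+ 2)) (mof u) by split => // N; exact: (mof_L2_sq HF).
have [IPi _] := Pi_L1 HF Hb Hf; have Ht := trT_H1 Hf.
have [Ibu _] := mof_product HF Hb Ib btE 0 Iu Iu2.
have hp : \forall x \ae P, forall n, mof (fun x => b x * u x) n x =
    bt n x * mof u n x - bracket (mof u ^~ x) (bt ^~ x) n + mof (Pi (mof u)) n x.
  apply: ae_foralln => n; have [_] := mof_product HF Hb Ib btE n Iu Iu2.
  by apply: filterS => x /(_ I).
have [M [_ _ _ hM]] := bracket_dom HF Hb Ht.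
have hT : \forall x \ae P, T (fun x => b x * u x) x = limf (trT (mof (fun x => b x * u x))) x /\
    T u x = limf (trT (mof u)) x.
  by apply: filterS2 (martingale_transformE Ibu) (martingale_transformE Iu) => x h1 h2; rewrite h1// h2.
have h0 : \forall x \ae P, trT (mof (fun x => b x * u x)) ^~ x @ \oo -->
    limf (trT (mof (Pi (mof u)))) x + limf (para (mof u)) x + b x * limf (trT (mof u)) x - Pi (trT (mof u)) x.
  have c1 : \forall x \ae P, trT (mof (Pi (mof u))) ^~ x + para (mof u) ^~ x @ \oo -->
      limf (trT (mof (Pi (mof u)))) x + limf (para (mof u)) x.
    by apply: filterS2 (trT_mof_cvg IPi) (H1_cvg (para_H1 Hf)) => x; exact: cvgD.
  have c2 : \forall x \ae P, bt ^~ x * trT (mof u) ^~ x @ \oo --> b x * limf (trT (mof u)) x.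
    by apply: filterS2 (bt_cvg HF Hb Ib btE) (trT_mof_cvg Iu) => x; exact: cvgM.
  have c12 : \forall x \ae P, trT (mof (Pi (mof u))) ^~ x + para (mof u) ^~ x + bt ^~ x * trT (mof u) ^~ x @ \oo -->
      limf (trT (mof (Pi (mof u)))) x + limf (para (mof u)) x + b x * limf (trT (mof u)) x.
    by apply: filterS2 c1 c2 => x; exact: cvgD.
  apply: filterS3 hp hM c12 => x hpx [c3 _] c4.
  apply: eq_cvgn (cvgB c4 c3) => n /=.
  rewrite [RHS]/trT; have -> : mof (fun x => b x * u x) ^~ x = (fun n =>
    bt n x * mof u n x - bracket (mof u ^~ x) (bt ^~ x) n + mof (Pi (mof u)) n x).
    by apply/funext => k; rewrite hpx.
  by rewrite (product_path _ _ (bt ^~ x)).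
apply: filterS2 hT h0 => x [e1x e2x] h _.
rewrite /commutator /= e1x e2x (limf_lim h) /comm_T.
set l1 := limf _ x; set l2 := limf _ x; set l3 := limf _ x; set l4 := Pi _ x.
by rewrite addrAC addrK.
Qed.

Lemma comm_T_sub c c' f g : H1_bdd c f -> H1_bdd c' g ->
  comm_T (fun n x => f n x - g n x) = (fun x => comm_T f x - comm_T g x) %[ae P].
Proof.
move=> Hf Hg; have Hfg := H1_bdd_sub HF Hf Hg.
have [If _] := Pi_L1 HF Hb Hf; have [Ig _] := Pi_L1 HF Hb Hg.
have h1 : \forall x \ae P, limf (trT (mof (Pi (fun n x => f n x - g n x)))) x =
    limf (trT (mof (Pi f))) x - limf (trT (mof (Pi g))) x.
  have hm : \forall x \ae P, forall n, mof (Pi (fun n x => f n x - g n x)) n x = mof (Pi f) n x - mof (Pi g) n x.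
    by apply: ae_foralln => n; apply: filterS (mof_Pi_sub HF Hb n Hf Hg) => x /(_ I).
  apply: filterS3 hm (trT_mof_cvg If) (trT_mof_cvg Ig) => x hmx c1 c2; apply: limf_lim.
  apply: eq_cvgn (cvgB c1 c2) => n /=.
  have eq : mof (Pi (fun n x => f n x - g n x)) ^~ x = (fun n => mof (Pi f) n x - mof (Pi g) n x).
    by apply/funext => k; exact: hmx.
  apply: etrans (congr1 (fun a => tr (e ^~ x) a n) (esym eq)).
  by rewrite [RHS](tr_sub _ (mof (Pi f) ^~ x)).
have h2 : \forall x \ae P, limf (para (fun n x => f n x - g n x)) x = limf (para f) x - limf (para g) x.
  apply: filterS2 (H1_cvg (para_H1 Hf)) (H1_cvg (para_H1 Hg)) => x c1 c2; apply: limf_lim.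
  apply: eq_cvgn (cvgB c1 c2) => n /=.
  have eq : para_coef (e ^~ x) (fun n => f n x - g n x) = (fun n =>
     para_coef (e ^~ x) (f ^~ x) n - para_coef (e ^~ x) (g ^~ x) n).
    by apply/funext => k; rewrite (para_coef_sub _ (f ^~ x)).
  apply: etrans (congr1 (fun a => tr a (bt ^~ x) n) (esym eq)).
  by rewrite [RHS]tr_subl.
have h3 : \forall x \ae P, Pi (trT (fun n x => f n x - g n x)) x = Pi (trT f) x - Pi (trT g) x.
  have -> : trT (fun n x => f n x - g n x) = (fun n x => trT f n x - trT g n x).
    by apply/funext => n; apply/funext => x; rewrite /trT (tr_sub _ (f ^~ x)).
  by apply: filterS (Pi_sub HF Hb (trT_H1 Hf) (trT_H1 Hg)) => x /(_ I).
apply: filterS3 h1 h2 h3 => x e1x e2x e3x _.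
have aux (l1 l2 l3 l4 l5 l6 : R) : l1 - l2 + (l3 - l4) - (l5 - l6) = l1 + l3 - l5 - (l2 + l4 - l6).
  by ring.
by rewrite [LHS](congr2 (fun a c => a - c) (congr2 +%R e1x e2x) e3x); exact: aux.
Qed.

Lemma comm_T_weak c f t : H1_bdd c f -> 0 < t ->
  t * pr [set x | t < `|comm_T f x| ] <= 3 * (3 * (2 + K) + 5000 * (1 + K)) * c.
Proof.
move=> Hf t0; have [If hf] := Pi_L1 HF Hb Hf; have [It ht] := Pi_L1 HF Hb (trT_H1 Hf).
have [Ip hp] := H1_limf_L1 (para_H1 Hf).
have t3 : 0 < t / 3 by rewrite divr_gt0.
have mG := comm_T_meas Hf.
have mT : measurable_fun setT (limf (trT (mof (Pi f)))).
  by apply: measurable_limf => n; exact: (mtrf n (mof_mart HF If)).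
have mA (X : Omega -> R) s : measurable_fun setT X -> measurable [set x | s < `|X x| ].
  by move=> mX; apply: measurable_gt; exact: measurable_norm.
have w1 := trT_mof_weak If t3; have w2 := weak_L1 Ip t3; have w3 := weak_L1 It t3.
have h1 := @pr_leU _ _ _ P [set x | t < `|comm_T f x| ] [set x | t / 3 < `|limf (trT (mof (Pi f))) x| ]
  ([set x | t / 3 < `|limf (para f) x| ] `|` [set x | t / 3 < `|Pi (trT f) x| ])
  (mA _ _ mG) (mA _ _ mT) (measurableU _ _ (mA _ _ (Int_meas Ip)) (mA _ _ (Int_meas It))).
have h2 := @pr_leU _ _ _ P ([set x | t / 3 < `|limf (para f) x| ] `|` [set x | t / 3 < `|Pi (trT f) x| ]) _ _
  (measurableU _ _ (mA _ _ (Int_meas Ip)) (mA _ _ (Int_meas It))) (mA _ _ (Int_meas Ip)) (mA _ _ (Int_meas It)) (fun x h => h).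
have {}h1 : pr [set x | t < `|comm_T f x| ] <= pr [set x | t / 3 < `|limf (trT (mof (Pi f))) x| ] +
   (pr [set x | t / 3 < `|limf (para f) x| ] + pr [set x | t / 3 < `|Pi (trT f) x| ]).
  apply: le_trans (h1 _) (lerD (lexx _) h2) => x /= tx.
  apply: contrapT => /not_orP[/negP n1 /not_orP[/negP n2 /negP n3]].
  move: n1 n2 n3; rewrite -!leNgt => n1 n2 n3; move: tx; rewrite ltNge => /negP; apply.
  exact: norm_three n1 n2 n3.
exact: (weak_constant t0 h1 (le_trans w1 (ler_wpM2l _ hf)) (le_trans w2 hp) (le_trans w3 ht)).
Qed.

End transform.
End commutators.

Lemma sum_constant (R : realFieldType) (c k B p1 p2 p3 : R) : 0 <= c ->
  p1 <= (2 + k) * c -> p2 <= (2 + k) * c -> p3 <= B * (50 * c) ->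
  p1 + p2 + p3 <= ((2 + k) + (2 + k) + B * 50 + 1) * c.
Proof. lra. Qed.

Lemma norm_first (R : realFieldType) (m q o g1 g2 g3 : R) :
  `|m - q - o| <= g1 -> `|q| <= g2 -> `|o| <= g3 -> `|m| <= g1 + (g2 + g3).
Proof.
move=> a1 a2 a3; have := ler_normD (m - q - o) (q + o); have := ler_normD q o.
have -> : m - q - o + (q + o) = m by ring.
lra.
Qed.

(** * The commutators with E_n and their maximal function *)

Section commutator_cond_exp.
Context d (Omega : measurableType d) (R : realType) (P : probability Omega R).
Hypothesis cP : measure_is_complete P.
Variable F : nat -> set (set Omega).
Hypothesis HF : is_filtration F.
Notation E := (Ex P).
Notation Int := (Int P).
Notation mart := (mart P F).
Notation mof := (martingale_of P F).
Notation H1_bdd := (H1_bdd P F).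
Implicit Types f g : nat -> Omega -> R.
Variables (B : R) (bt : nat -> Omega -> R) (b : Omega -> R).
Hypothesis Hb : bmo_process P F B bt.
Hypothesis Ib : Int b.
Hypothesis btE : forall n A, F n A -> E (fun x => \1_A x * bt n x) = E (fun x => \1_A x * b x).
Let K := 65 * B ^+ 2.
Let mb : mart bt. Proof. by case: Hb. Qed.
Let Ibt n : Int (bt n). Proof. by case: mb. Qed.
Let B0 : 0 <= B := bmo_ge0 Hb.
Let K0 : 0 <= K. Proof. by rewrite mulr_ge0// sqr_ge0. Qed.
Let dlB n x : `|dl (bt ^~ x) n| <= B. Proof. by case: Hb. Qed.
Notation Pi := (Pi bt).

Definition comm_E n f x :=
  mof (Pi f) n x - bracket (f ^~ x) (bt ^~ x) n - f n x * (b x - bt n x).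

Let Int_bracket n f : mart f -> Int (fun x => bracket (f ^~ x) (bt ^~ x) n).
Proof.
move=> mf; apply: Int_sum => k _; under eq_fun do rewrite mulrC.
by apply: IntMb (dlB k); [exact: (mart_Int_dl k mf)|case: Hb => -[_ If _] _ _; apply: measurable_dl => j _; exact: Int_meas].
Qed.

Let osc_L1 n c f : H1_bdd c f -> Int (fun x => f n x * (b x - bt n x)) /\
  E (fun x => `|f n x * (b x - bt n x)|) <= B * (50 * c).
Proof.
move=> Hf; have [[Wf If _] _] := Hf.
have [|||Io Eo] := @b_osc _ _ _ P F HF B bt b Hb Ib btE n (fun x => `|f n x|).
- by apply: measurable_norm; exact: Wf.
- by move=> x; exact: normr_ge0.
- exact: Int_norm.
split.
  apply: (@Int_le _ _ _ _ _ (fun x => `| `|f n x| * (b x - bt n x)|)).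
  - apply: measurable_funM; first exact: Int_meas (If n).
    by apply: measurable_funB; [exact: Int_meas Ib|exact: Int_meas (Ibt n)].
  - by move=> x; rewrite !normrM normr_id.
  - exact: Int_norm.
rewrite (eq_Ex _ (g := fun x => `| `|f n x| * (b x - bt n x)|)); last first.
  by move=> x; rewrite !normrM normr_id.
by apply: le_trans Eo _; apply: ler_wpM2l => //; exact: (H1_L1 HF).
Qed.

Lemma comm_E_L1 n c f : H1_bdd c f -> Int (comm_E n f) /\
  E (fun x => `|comm_E n f x|) <= ((2 + K) + (2 + K) + B * 50 + 1) * c.
Proof.
move=> Hf; have [mf fc] := Hf; have [Ip hp] := Pi_L1 HF Hb Hf.
have Im := mof_Int HF n Ip; have Ir := Int_bracket n mf; have [Io ho] := osc_L1 n Hf.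
have IG : Int (comm_E n f) by apply: IntB => //; exact: IntB.
split => //.
have hm := le_trans (mof_norm HF n Ip) hp.
have hr : E (fun x => `|bracket (f ^~ x) (bt ^~ x) n|) <= (2 + K) * c.
  have [Is hs] := fefferman HF Hb n mf.
  apply: le_trans (le_trans (Ex_le (Int_norm Ir) Is _) hs) _.
    by move=> x; exact: bracket_le.
  by apply: ler_wpM2l; rewrite ?addr_ge0.
have c0 := H1_bdd_ge0 Hf.
apply: (@le_trans _ _ (E (fun x => `|mof (Pi f) n x| + `|bracket (f ^~ x) (bt ^~ x) n| +
    `|f n x * (b x - bt n x)|))).
  apply: Ex_le; [exact: Int_norm|apply: IntD; [apply: IntD|]; exact: Int_norm|].
  move=> x; apply: le_trans (ler_normB _ _) _; apply: lerD => //; exact: ler_normB.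
rewrite ExD; [|apply: IntD; exact: Int_norm|exact: Int_norm].
rewrite ExD; [|exact: Int_norm..].
exact: sum_constant c0 hm hr ho.
Qed.

Lemma comm_E_L2 n u : Int u -> Int (fun x => u x ^+ 2) ->
  commutator (cond_exp P (F n)) b u = comm_E n (mof u) %[ae P].
Proof.
move=> Iu Iu2; have [_] := mof_product HF Hb Ib btE n Iu Iu2.
apply: filterS => x /(_ I) h _; rewrite /commutator.
have aux (p l q m v : R) : p = v * l - q + m -> p - b x * l = m - q - l * (b x - v).
  by move=> ->; ring.
exact: aux h.
Qed.

Lemma comm_E_sub n c c' f g : H1_bdd c f -> H1_bdd c' g ->
  comm_E n (fun n x => f n x - g n x) = (fun x => comm_E n f x - comm_E n g x) %[ae P].
Proof.
move=> Hf Hg; apply: filterS (mof_Pi_sub HF Hb n Hf Hg) => x /(_ I) h _.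
have aux (p1 p2 p3 q1 q2 l1 l2 v : R) : p1 = p2 - p3 ->
  p1 - (q1 - q2) - (l1 - l2) * v = p2 - q1 - l1 * v - (p3 - q2 - l2 * v) by move=> ->; ring.
rewrite /comm_E [bracket _ _ _](bracket_sub (f ^~ x) (g ^~ x)); exact: aux h.
Qed.

Lemma comm_E_P n c f : H1_bdd c f ->
  is_commutator_H1 P F (cond_exp P (F n)) b f (commutator_H1 P F (cond_exp P (F n)) b f) /\
  commutator_H1 P F (cond_exp P (F n)) b f = comm_E n f %[ae P].
Proof.
move=> Hf.
have C0 : 0 < (2 + K) + (2 + K) + B * 50 + 1 by rewrite ltr_wpDl// ?addr_ge0// mulr_ge0.
apply: (commutator_H1P cP HF (G := comm_E n) C0) Hf => //.
- by move=> c' f' Hf'; have [IG _] := comm_E_L1 n Hf'; exact: (Int_meas IG).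
- exact: comm_E_L2.
- exact: comm_E_sub.
- move=> c' f' t Hf' t0; have [I h] := comm_E_L1 n Hf'.
  exact: le_trans (weak_L1 I t0) h.
Qed.

(* The oscillation term is dominated by the maximal function of the
   paraproduct with coefficients [mx f], uniformly in [n]. *)
Lemma osc_max c f : H1_bdd c f -> exists G, [/\ Int G, E G <= 5000 * (1 + K) * c, forall x, 0 <= G x &
  \forall x \ae P, forall n, `|f n x * (b x - bt n x)| <= G x].
Proof.
move=> Hf; have [[Wf If _] _] := Hf.
have [||||| mp hp] := @paraproduct _ _ _ _ _ HF _ _ Hb
  (fun n x => mx (f ^~ x) n) (fun n x => mx (f ^~ x) n).
- move=> n; apply: (@measurable_mx _ (g_sigma_algebraType (F n)) _ (fun k x => f k x)) => k kn.
  exact: (W_le HF kn).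
- move=> n; apply: (@measurable_mx _ (g_sigma_algebraType (F n)) _ (fun k x => f k x)) => k kn.
  exact: (W_le HF kn).
- by move=> n x; rewrite ger0_norm ?mx_ge0.
- by move=> n x; exact: mx_mono.
- by move=> n; exact: (mart_Int_mx n If).
pose V n x := tr (mx (f ^~ x)) (bt ^~ x) n.
have HV : H1_bdd ((1 + K) * (50 * c)) V.
  split => // N; apply: le_trans (hp N) _; apply: ler_wpM2l; first by rewrite addr_ge0.
  exact: (H1_mx HF N Hf).
have [[_ IV _] _] := HV.
have [|||| G [IG EG G0 hG]] := @monotone_L1 _ _ _ P (fun n x => mx (V ^~ x) n) (50 * ((1 + K) * (50 * c))).
- by move=> n; exact: (mart_Int_mx n IV).
- by move=> n x; exact: mx_ge0.
- by move=> n x; exact: mx_mono.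
- by move=> n; exact: (H1_mx HF n HV).
(* The constant 5000 is 2 * 50 * 50: the factor of [abel_transform], and Davis' inequality for f and
   for its paraproduct. *)
exists (fun x => 2 * G x); split.
- exact: IntZ.
- rewrite ExZ//; apply: le_trans (ler_wpM2l _ EG) _ => //.
  by rewrite le_eqVlt; apply/orP; left; apply/eqP; ring.
- by move=> x; rewrite mulr_ge0.
apply: filterS2 hG (bt_cvg HF Hb Ib btE) => x [_ hx] hb n.
have cv : (`|f n x| * `|bt (m + n)%N x - bt n x|) @[m --> \oo] --> `|f n x| * `|b x - bt n x|.
  apply: cvgM; first exact: cvg_cst.
  apply: cvg_norm; apply: cvgB; last exact: cvg_cst.
  by have := hb; rewrite -(cvg_shiftn n).
rewrite normrM; apply: (cvgn_le cv) => m.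
apply: le_trans (abel_transform (f ^~ x) (bt ^~ x) (leq_addl m n)) _.
by rewrite ler_pM2l//; exact: hx.
Qed.

Lemma maximal_commutator_mx c f : H1_bdd c f ->
  ('N[P]_1[maximal_commutator P F b f] < +oo)%E ->
  forall N, E (fun x => mx (mof (Pi f) ^~ x) N) <=
    fine ('N[P]_1[maximal_commutator P F b f])%E + ((2 + K) + 5000 * (1 + K)) * c.
Proof.
move=> Hf Mfin N; set M := maximal_commutator P F b f in Mfin *.
have hM : \forall x \ae P, forall n, commutator_H1 P F (cond_exp P (F n)) b f x = comm_E n f x.
  by apply: ae_foralln => n; have [_] := comm_E_P n Hf; apply: filterS => x /(_ I).
have mM : measurable_fun setT M.
  (* The maximal commutator is pointwise a supremum over countably many measurable functions,
     measurable by their specification in [comm_E_P]. *)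
  have -> : M = (fun x => esups (fun n => `|commutator_H1 P F (cond_exp P (F n)) b f x|%:E) 0).
    apply/funext => x; rewrite /M /maximal_commutator /esups /sdrop /=; congr ereal_sup.
    by apply/seteqP; split => [y [n _ <-]|y [n _ <-]]; exists n.
  apply: (@measurable_fun_esups _ _ _ _ (fun n x => `|commutator_H1 P F (cond_exp P (F n)) b f x|%:E)) => n.
  apply/measurable_EFinP; apply: measurable_norm.
  by have [[]] := comm_E_P n Hf.
have M0 x : (0 <= M x)%E.
  apply: (@le_trans _ _ `|commutator_H1 P F (cond_exp P (F 0%N)) b f x|%:E).
    by rewrite lee_fin.
  by apply: ereal_sup_ubound; exists 0%N.
have [G [IG EG G0 hG]] := osc_max Hf.
have [D [ID ED D0 hD]] := bracket_dom HF Hb Hf.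
have [Ip _] := Pi_L1 HF Hb Hf.
have Imm : Int (fun x => mx (mof (Pi f) ^~ x) N) by apply: mart_Int_mx => k; exact: mof_Int.
have IDG : Int (fun x => D x + G x) by exact: IntD.
have NE : ('N[P]_1[M] = \int[P]_x M x)%E.
  by rewrite Lnorm1; apply: eq_integral => x _; rewrite gee0_abs.
have Nf : 'N[P]_1[M]%E = (fine ('N[P]_1[M])%E)%:E.
  by rewrite fineK// ge0_fin_numE// Lnorm_ge0.
have EDG : E (fun x => D x + G x) <= ((2 + K) + 5000 * (1 + K)) * c.
  by rewrite ExD// mulrDl lerD.
rewrite -lee_fin EFinD -Nf NE -ExE//.
apply: (@le_trans _ _ (\int[P]_x (M x + (D x + G x)%:E))%E); last first.
  rewrite ge0_integralD//; last 2 first.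
  - by move=> x _; rewrite lee_fin addr_ge0.
  - by apply/measurable_EFinP; exact: (Int_meas IDG).
  by rewrite ExE// leeD2l// lee_fin.
apply: ae_ge0_le_integral => //.
- by move=> x _; rewrite lee_fin mx_ge0.
- by apply/measurable_EFinP; exact: (Int_meas Imm).
- by move=> x _; rewrite adde_ge0// lee_fin addr_ge0.
- by apply: emeasurable_funD => //; apply/measurable_EFinP; exact: (Int_meas IDG).
apply: filterS3 hM hG hD => x hMx hGx [_ hDx] _.
(* Where M exceeds the maximal function of E_n (Pi f) the bound is immediate; elsewhere M is finite
   and can be handled as a real number. *)
case: (leP (M x) (mx (mof (Pi f) ^~ x) N)%:E) => [hle|hlt]; last first.
  apply: le_trans (ltW hlt) _; rewrite leeDl// lee_fin addr_ge0//.
have Mx : M x = (fine (M x))%:E.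
  by rewrite fineK// ge0_fin_numE//; apply: le_lt_trans hle (ltry _).
rewrite Mx -EFinD lee_fin; apply: mx_le => k _.
have hk : `|comm_E k f x| <= fine (M x).
  rewrite -lee_fin -Mx -hMx; apply: ereal_sup_ubound; exists k => //.
exact: norm_first hk (le_trans (bracket_le (f ^~ x) (bt ^~ x) k) (hDx k)) (hGx k).
Qed.

End commutator_cond_exp.

(** The term k c is absorbed as (k / b)(c b); here b stands for the BMO norm, so its positivity is
    essential. *)
Lemma final_constant (R : realFieldType) (b m c k : R) : 0 < b -> 0 <= m -> 0 <= c -> 0 <= k ->
  200 * m + k * c <= (200 + k / b) * (c * b + m).
Proof.
move=> b0 m0 c0 k0; have -> : (200 + k / b) * (c * b + m) = 200 * (c * b) + 200 * m + k * c + (k / b) * m.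
  by field; rewrite gt_eqF.
have := mulr_ge0 c0 (ltW b0); have : 0 <= k / b * m by rewrite mulr_ge0// divr_ge0// ltW.
lra.
Qed.

Lemma comm_T_constant (R : comPzRingType) (k m c : R) :
  200 * (m + (2 + k + 5000 * (1 + k)) * c) + (5000 * (1 + k) + (2 + k)) * c =
  200 * m + ((2 + k + 5000 * (1 + k)) * 200 + (5000 * (1 + k) + (2 + k))) * c.
Proof. ring. Qed.

(** * The L^1 bound for the commutator with T *)

Section commutator_L1.
Context d (Omega : measurableType d) (R : realType) (P : probability Omega R).
Variable F : nat -> set (set Omega).
Hypothesis HF : is_filtration F.
Notation E := (Ex P).
Notation Int := (Int P).
Notation W n X := (measurable_wrt (F n) X).
Notation mof := (martingale_of P F).
Notation H1_bdd := (H1_bdd P F).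
Variables (B : R) (bt : nat -> Omega -> R).
Hypothesis Hb : bmo_process P F B bt.
Let K := 65 * B ^+ 2.
Variable e : nat -> Omega -> R.
Hypothesis We : forall n, W n (e n).
Hypothesis e1 : forall n x, `|e n x| <= 1.

(** Davis' inequality [davis_S] puts E_n (Pi f) in H_1 with norm at most 4 a, where T is bounded;
    returning to L^1 costs a factor 50, whence 200. *)
Lemma comm_T_L1 a c f : H1_bdd c f ->
  (forall N, E (fun x => mx (mof (Pi bt f) ^~ x) N) <= a) ->
  Int (comm_T P F bt e f) /\
  E (fun x => `|comm_T P F bt e f x|) <= 200 * a + (5000 * (1 + K) + (2 + K)) * c.
Proof.
move=> Hf ha; have [If _] := Pi_L1 HF Hb Hf.
have [It ht] := Pi_L1 HF Hb (trT_H1 HF We e1 Hf).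
have [Ip hp] := H1_limf_L1 HF (para_H1 HF Hb We e1 Hf).
have mm := mof_mart HF If.
have Hm : H1_bdd (4 * a) (mof (Pi bt f)).
  by split => // N; apply: le_trans (davis_S HF N mm) _; rewrite ler_pM2l.
have [IT hT] := H1_limf_L1 HF (trT_H1 HF We e1 Hm).
have Is := IntD IT Ip; have IG := IntB Is It; split => //.
apply: (@le_trans _ _ (E (fun x => `|limf (trT e (mof (Pi bt f))) x| + `|limf (para bt e f) x| +
    `|Pi bt (trT e f) x|))).
  apply: Ex_le; [exact: Int_norm|apply: IntD; [apply: IntD|]; exact: Int_norm|].
  by move=> x; apply: le_trans (ler_normB _ _) _; apply: lerD => //; exact: ler_normD.
rewrite ExD; [|apply: IntD; exact: Int_norm|exact: Int_norm].
rewrite ExD; [|exact: Int_norm..].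
have aux (p1 p2 p3 k : R) : p1 <= 50 * (4 * a) -> p2 <= 50 * ((1 + k) * (100 * c)) -> p3 <= (2 + k) * c ->
  p1 + p2 + p3 <= 200 * a + (5000 * (1 + k) + (2 + k)) * c.
  by move=> h1 h2 h3; apply: le_trans (lerD (lerD h1 h2) h3) _;
    rewrite le_eqVlt; apply/orP; left; apply/eqP; ring.
exact: aux hT hp ht.
Qed.

End commutator_L1.

Theorem corollary4p15 (R : realType) (d : measure_display)
    (Omega : measurableType d) (P : probability Omega R)
    (F : nat -> set (set Omega)) (eps : nat -> Omega -> R)
    (p : R) (b : Omega -> R) :
  measure_is_complete P ->
  is_filtration F ->
  adapted F eps ->
  (ereal_sup (range (fun k => 'N[P]_+oo[EFin \o eps k])) <= 1)%E ->
  1 <= p ->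
  in_BMO P F p b ->
  (forall c : R, ~ (b = cst c %[ae P])) ->
  (exists C : R, forall f : nat -> Omega -> R, in_H1 P F f ->
     is_commutator_H1 P F (martingale_transform P F eps) b f
       (commutator_H1 P F (martingale_transform P F eps) b f) /\
     (weakL1_norm P (commutator_H1 P F (martingale_transform P F eps) b f)
        <= C%:E * H1_norm P f)%E) /\
  (exists C : R, forall f : nat -> Omega -> R, in_H1b P F p b f ->
     ('N[P]_1[EFin \o commutator_H1 P F (martingale_transform P F eps) b f]
        <= C%:E * H1b_norm P F p b f)%E).
Proof.
move=> cP HF Aeps eps1 p1 bB nb; have [Lb bfin] := bB.
have Ib : Int P b by apply/Lfun1_integrable.
have [B [bt [Hb _ btE]]] := in_BMO_process HF p1 bB.
have B0 := bmo_ge0 Hb.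
(* Clamping keeps the process adapted and bounds it by 1 at every point, as [weak11] requires. *)
pose e n x := clamp 1 (eps n x).
have We n : measurable_wrt (F n) (e n) by apply: measurable_clamp; exact: Aeps.
have e1 n x : `|e n x| <= 1 by exact: clamp_bd.
have eE : \forall x \ae P, forall n, eps n x = e n x.
  apply: ae_foralln => n.
  have h : ('N[P]_+oo[EFin \o eps n] <= 1)%E.
    by apply: le_trans eps1; apply: ereal_sup_ubound; exists n.
  apply: filterS (Linfty_ae h) => x; rewrite /= lee_fin => hx.
  by rewrite /e clamp_id.
set T := martingale_transform P F eps.
set K := 65 * B ^+ 2; have K0 : 0 <= K by rewrite mulr_ge0// sqr_ge0.
set C1 := 3 * (3 * (2 + K) + 5000 * (1 + K)).
have C10 : 0 < C1 by rewrite /C1; clearbody K; lra.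
have H1f f : in_H1 P F f -> H1_bdd P F (fine (H1_norm P f)) f.
  move=> [mf ffin]; have mf' := is_martingale_mart HF mf; split => //.
  exact: (H1_norm_fin mf' ffin).
have Gm c f : H1_bdd P F c f -> measurable_fun setT (comm_T P F bt e f).
  exact: (comm_T_meas HF Hb We e1).
have G2 := comm_T_L2 HF Hb Ib btE We e1 eE.
have Gs c c' f g (Hf : H1_bdd P F c f) (Hg : H1_bdd P F c' g) := comm_T_sub HF Hb We e1 Hf Hg.
have Gw c f t (Hf : H1_bdd P F c f) (t0 : 0 < t) : t * fine (P [set x | t < `|comm_T P F bt e f x| ]) <= C1 * c.
  exact: (comm_T_weak HF Hb We e1 Hf t0).
have key c f : H1_bdd P F c f ->
    is_commutator_H1 P F T b f (commutator_H1 P F T b f) /\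
    commutator_H1 P F T b f = comm_T P F bt e f %[ae P].
  exact: (commutator_H1P cP HF C10 Gm G2 Gs Gw).
split.
  exists C1 => f /H1f Hf; have [h1 h2] := key _ _ Hf; split => //.
  rewrite (ae_weakL1 cP (Gm _ _ Hf) h2).
  exact: (G_weakL1 Gm Gw Hf).
set C2 := ((2 + K) + 5000 * (1 + K)) * 200 + (5000 * (1 + K) + (2 + K)).
have C20 : 0 <= C2 by rewrite /C2; clearbody K; lra.
set beta := fine (BMO_norm P F p b).
have b0 : (0 < BMO_norm P F p b)%E by apply: BMO_norm_gt0 => //; exact: nb.
have betaE : BMO_norm P F p b = beta%:E by rewrite fineK// ge0_fin_numE// ltW.
have beta0 : 0 < beta by rewrite -lte_fin -betaE.
exists (200 + C2 / beta) => f [Hf Hfin]; have Hc := H1f f Hf; have [mf ffin] := Hf.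
set c := fine (H1_norm P f) in Hc.
have c0 : 0 <= c := H1_bdd_ge0 Hc.
have cE : H1_norm P f = c%:E by rewrite fineK// ge0_fin_numE// H1_norm_ge0.
have M0 : (0 <= 'N[P]_1[maximal_commutator P F b f])%E by exact: Lnorm_ge0.
move: Hfin; rewrite /H1b_norm cE betaE => Hfin.
have Mfin : ('N[P]_1[maximal_commutator P F b f] < +oo)%E.
  by apply: le_lt_trans Hfin; rewrite leeDr// lee_fin mulr_ge0// ltW.
set m := fine 'N[P]_1[maximal_commutator P F b f]%E.
have mE : 'N[P]_1[maximal_commutator P F b f]%E = m%:E by rewrite fineK// ge0_fin_numE.
have m0 : 0 <= m by rewrite -lee_fin -mE.
have [IG hG] := comm_T_L1 HF Hb We e1 Hc (maximal_commutator_mx cP HF Hb Ib btE Hc Mfin).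
have [h1 h2] := key _ _ Hc; have [mC _ _] := h1.
have -> : 'N[P]_1[EFin \o commutator_H1 P F T b f]%E = (Ex P (fun x => `|comm_T P F bt e f x|))%:E.
  rewrite Lnorm1 -ExE; last exact: Int_norm.
  apply: ae_eq_integral => //.
  - by apply/measurable_EFinP; exact: measurable_norm.
  - by apply/measurable_EFinP; apply: measurable_norm; exact: Gm Hc.
  - by apply: filterS h2 => x /= /[apply] ->.
rewrite mE -[(c%:E * beta%:E)%E]EFinM -EFinD -EFinM lee_fin.
apply: le_trans hG (le_trans _ (final_constant beta0 m0 c0 C20)).
by rewrite [leLHS](comm_T_constant K m c).
Qed.
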